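(* Let $m,n\geq 1$, let $\zeta\in\mathbb{C}^m$, let $M\neq 0$ be a finitely generated $\mathcal{O}_\zeta$-module, and let $p:\mathcal{O}^n_\zeta\rightarrow M$ be an epimorphism of $\mathcal{O}_\zeta$-modules. If $\mathrm{depth}_{\mathfrak{m}_\zeta}M=0$, then for any infinite dimensional complex Banach space $E$ there is an $\mathcal{O}_\zeta$-homomorphism $\phi:\mathcal{O}^E_\zeta\rightarrow M$ that does not factor through $p$, i.e., there is no $\mathcal{O}_\zeta$-homomorphism $\psi:\mathcal{O}^E_\zeta\to\mathcal{O}^n_\zeta$ with $\phi=p\psi$.
   Context: $\mathcal{O}^E_\zeta$ denotes the set of germs at $\zeta\in\mathbb{C}^m$ of holomorphic functions with values in the Banach space $E$; $\mathcal{O}_\zeta=\mathcal{O}^{\mathbb{C}}_\zeta$ is the local ring of scalar holomorphic germs at $\zeta$, $\mathfrak{m}_\zeta$ is its maximal ideal (germs vanishing at $\zeta$), $\mathcal{O}^n_\zeta=\mathcal{O}^{\mathbb{C}^n}_\zeta$, and $\mathcal{O}^E_\zeta$ is an $\mathcal{O}_\zeta$-module. Homomorphisms are purely algebraic. Depth: for a Noetherian ring $R$, an ideal $I\subset R$ and a finitely generated $R$-module $M$ with $M\neq IM$, $\mathrm{depth}_I M>0$ means that there is an $r\in I$ that is a nonzerodivisor on $M$ and satisfies $rM\neq M$; otherwise $\mathrm{depth}_I M=0$. If $M=IM$ (in particular if $M=0$), $\mathrm{depth}_I M=+\infty$ by convention. *)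

(* Defs.v *)
From HB Require Import structures.
From mathcomp Require Import all_boot all_order all_algebra.
From mathcomp Require Import all_classical all_reals all_analysis.
From mathcomp Require Import complex.

Set Implicit Arguments.
Unset Strict Implicit.
Unset Printing Implicit Defensive.

Import Order.TTheory GRing.Theory Num.Theory.
Import numFieldNormedType.Exports.

Local Open Scope classical_set_scope.
Local Open Scope ring_scope.
Local Open Scope quotient_scope.

Section Germs.
Context {K : numFieldType} {V : normedModType K} (z : V).

(* [differentiable] is Frechet differentiability over the scalar field K: when
   K = R[i] it is complex differentiability, so that [holo_at] says that f is
   holomorphic on some neighbourhood of z. *)
Definition holo_at (W : normedModType K) (f : V -> W) : Prop :=
  \forall x \near z, differentiable f x.

Lemma holo_cst (W : normedModType K) (a : W) : holo_at (cst a).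
Proof. by near=> x; exact: differentiable_cst. Unshelve. all: by end_near. Qed.

Lemma holoD (W : normedModType K) (f g : V -> W) :
  holo_at f -> holo_at g -> holo_at (f + g).
Proof.
move=> hf hg; near=> x; apply: differentiableD; first by near: x.
by near: x.
Unshelve. all: by end_near. Qed.

Lemma holoN (W : normedModType K) (f : V -> W) : holo_at f -> holo_at (- f).
Proof.
move=> hf; near=> x; apply: differentiableN; by near: x.
Unshelve. all: by end_near. Qed.

Lemma scaler_is_bilinear (W : normedModType K) :
  bilinear_for
    (GRing.Scale.Law.clone _ _ *:%R _) (GRing.Scale.Law.clone _ _ *:%R _)
    (fun (a : K) (w : W) => a *: w).
Proof.
split=> [w|a] b x y /=.
- by rewrite scalerDl scalerA.
- by rewrite scalerDr !scalerA mulrC.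
Qed.

Lemma differentiable_scale (W : normedModType K) (f : V -> K) (g : V -> W) x :
  differentiable f x -> differentiable g x ->
  differentiable (fun y => f y *: g y) x.
Proof.
move=> df dg.
pose sM := bilinear_isBilinear.Build K K W W _ _ (fun (a : K) (w : W) => a *: w)
  (@scaler_is_bilinear W).
pose sB : {bilinear K -> W -> W} := HB.pack (fun (a : K) (w : W) => a *: w) sM.
have := @differentiable_comp _ V (K * W)%type W (fun y => (f y, g y))
  (fun p => sB p.1 p.2) x.
apply; first exact: differentiable_pair.
by apply: differentiable_bilin => p; exact: scale_continuous.
Qed.

Lemma holoZ (W : normedModType K) (f : V -> K) (g : V -> W) :
  holo_at f -> holo_at g -> holo_at (fun y => f y *: g y).
Proof.
move=> hf hg; near=> x; apply: differentiable_scale; first by near: x.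
by near: x.
Unshelve. all: by end_near. Qed.

(* Only the values near z matter in a germ, so its representatives can be taken
   to be functions on all of V. *)
Definition holofun (W : normedModType K) := {f : V -> W | `[< holo_at f >]}.

Definition germ_rel (W : normedModType K) (f g : holofun W) : bool :=
  `[< \forall x \near z, val f x = val g x >].

Lemma germ_rel_refl (W : normedModType K) : reflexive (@germ_rel W).
Proof. by move=> f; apply/asboolP; near=> x. Unshelve. all: by end_near. Qed.

Lemma germ_rel_sym (W : normedModType K) : symmetric (@germ_rel W).
Proof.
move=> f g; apply/asboolP/asboolP => h; near=> x; apply/esym; by near: x.
Unshelve. all: by end_near. Qed.

Lemma germ_rel_trans (W : normedModType K) : transitive (@germ_rel W).
Proof.
move=> g f h /asboolP fg /asboolP gh; apply/asboolP; near=> x.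
by apply: (@eq_trans _ _ (val g x)); near: x.
Unshelve. all: by end_near. Qed.

Canonical germ_equiv (W : normedModType K) :=
  EquivRel (@germ_rel W) (@germ_rel_refl W) (@germ_rel_sym W)
           (@germ_rel_trans W).

Definition germ (W : normedModType K) := {eq_quot (germ_equiv W)}.
HB.instance Definition _ (W : normedModType K) := Choice.on (germ W).
HB.instance Definition _ (W : normedModType K) := EqQuotient.on (germ W).

Definition germ_of (W : normedModType K) (f : V -> W) (hf : holo_at f) :
    germ W :=
  \pi_(germ W) (exist (fun f => `[< holo_at f >]) f (asboolT hf)).

Definition germ_repr (W : normedModType K) (a : germ W) : V -> W :=
  val (repr a).

Lemma germ_repr_holo (W : normedModType K) (a : germ W) :
  holo_at (germ_repr a).
Proof. exact: (asboolW (valP (repr a))). Qed.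

Lemma germ_ofK (W : normedModType K) (f : V -> W) (hf : holo_at f) :
  \forall x \near z, germ_repr (germ_of hf) x = f x.
Proof.
rewrite /germ_repr /germ_of; case: piP => g /eqmodP/asboolP /= h.
by near=> x; apply/esym; near: x.
Unshelve. all: by end_near. Qed.

Lemma eq_germ_of (W : normedModType K) (f g : V -> W)
    (hf : holo_at f) (hg : holo_at g) :
  (\forall x \near z, f x = g x) -> germ_of hf = germ_of hg.
Proof. by move=> fg; apply/eqmodP/asboolP. Qed.

Lemma germ_reprK (W : normedModType K) (a : germ W) :
  germ_of (germ_repr_holo a) = a.
Proof.
rewrite -[RHS]reprK /germ_of; congr (\pi_(germ W) _); exact: val_inj.
Qed.

Lemma germP (W : normedModType K) (a b : germ W) :
  (\forall x \near z, germ_repr a x = germ_repr b x) -> a = b.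
Proof. by move=> ab; rewrite -[a]germ_reprK -[b]germ_reprK; exact: eq_germ_of. Qed.

Definition germ_add (W : normedModType K) (a b : germ W) : germ W :=
  germ_of (holoD (germ_repr_holo a) (germ_repr_holo b)).
Definition germ_opp (W : normedModType K) (a : germ W) : germ W :=
  germ_of (holoN (germ_repr_holo a)).
Definition germ_cst (W : normedModType K) (w : W) : germ W :=
  germ_of (holo_cst w).
Definition germ_scale (W : normedModType K) (a : germ K) (b : germ W) :
    germ W :=
  germ_of (holoZ (germ_repr_holo a) (germ_repr_holo b)).

Section Near.
Variable W : normedModType K.
Implicit Types a b : germ W.
Lemma near_germ_add a b : \forall x \near z,
  germ_repr (germ_add a b) x = germ_repr a x + germ_repr b x.
Proof. exact: germ_ofK. Qed.
Lemma near_germ_opp a : \forall x \near z,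
  germ_repr (germ_opp a) x = - germ_repr a x.
Proof. exact: germ_ofK. Qed.
Lemma near_germ_cst (w : W) : \forall x \near z, germ_repr (germ_cst w) x = w.
Proof. exact: germ_ofK. Qed.
Lemma near_germ_scale (c : germ K) a : \forall x \near z,
  germ_repr (germ_scale c a) x = germ_repr c x *: germ_repr a x.
Proof. exact: germ_ofK. Qed.
End Near.

Section Zmodule.
Variable W : normedModType K.

Lemma germ_addA : associative (@germ_add W).
Proof.
move=> a b c; apply: germP; near=> x.
rewrite (near (near_germ_add a (germ_add b c)) x)//.
rewrite (near (near_germ_add b c) x)//.
rewrite (near (near_germ_add (germ_add a b) c) x)//.
by rewrite (near (near_germ_add a b) x)// addrA.
Unshelve. all: by end_near. Qed.

Lemma germ_addC : commutative (@germ_add W).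
Proof.
move=> a b; apply: germP; near=> x.
rewrite (near (near_germ_add a b) x)//.
by rewrite (near (near_germ_add b a) x)// addrC.
Unshelve. all: by end_near. Qed.

Lemma germ_add0 : left_id (germ_cst (0 : W)) (@germ_add W).
Proof.
move=> a; apply: germP; near=> x.
rewrite (near (near_germ_add (germ_cst 0) a) x)//.
by rewrite (near (near_germ_cst (0 : W)) x)// add0r.
Unshelve. all: by end_near. Qed.

Lemma germ_addN : left_inverse (germ_cst (0 : W)) (@germ_opp W) (@germ_add W).
Proof.
move=> a; apply: germP; near=> x.
rewrite (near (near_germ_add (germ_opp a) a) x)//.
rewrite (near (near_germ_opp a) x)//.
by rewrite (near (near_germ_cst (0 : W)) x)// addNr.
Unshelve. all: by end_near. Qed.

HB.instance Definition _ :=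
  GRing.isZmodule.Build (germ W) germ_addA germ_addC germ_add0 germ_addN.
End Zmodule.

Section ScaleLemmas.
Variable W : normedModType K.

Lemma germ_scaleA (a b : germ K) (c : germ W) :
  germ_scale a (germ_scale b c) = germ_scale (germ_scale a b) c.
Proof.
apply: germP; near=> x.
rewrite (near (near_germ_scale a (germ_scale b c)) x)//.
rewrite (near (near_germ_scale b c) x)//.
rewrite (near (near_germ_scale (germ_scale a b) c) x)//.
by rewrite (near (near_germ_scale a b) x)// scalerA.
Unshelve. all: by end_near. Qed.

Lemma germ_scale1 : left_id (@germ_cst K 1) (@germ_scale W).
Proof.
move=> a; apply: germP; near=> x.
rewrite (near (near_germ_scale (@germ_cst K 1) a) x)//.
by rewrite (near (@near_germ_cst K 1) x)// scale1r.
Unshelve. all: by end_near. Qed.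

Lemma germ_scaleDr : right_distributive (@germ_scale W) +%R.
Proof.
move=> a b c; apply: germP; near=> x.
rewrite (near (near_germ_scale a (germ_add b c)) x)//.
rewrite (near (near_germ_add b c) x)//.
rewrite (near (near_germ_add (germ_scale a b) (germ_scale a c)) x)//.
rewrite (near (near_germ_scale a b) x)//.
by rewrite (near (near_germ_scale a c) x)// scalerDr.
Unshelve. all: by end_near. Qed.

Lemma germ_scaleDl (c : germ W) : {morph @germ_scale W ^~ c : a b / a + b}.
Proof.
move=> a b; apply: germP; near=> x.
rewrite (near (near_germ_scale (germ_add a b) c) x)//.
rewrite (near (near_germ_add a b) x)//.
rewrite (near (near_germ_add (germ_scale a c) (germ_scale b c)) x)//.
rewrite (near (near_germ_scale a c) x)//.
by rewrite (near (near_germ_scale b c) x)// scalerDl.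
Unshelve. all: by end_near. Qed.
End ScaleLemmas.

Lemma germ_mulC : commutative (@germ_scale K).
Proof.
move=> a b; apply: germP; near=> x.
rewrite (near (near_germ_scale a b) x)//.
by rewrite (near (near_germ_scale b a) x)// /GRing.scale/= mulrC.
Unshelve. all: by end_near. Qed.

Lemma germ_1neq0 : @germ_cst K 1 != 0.
Proof.
apply/eqP => e.
have h1 := nbhs_singleton (@near_germ_cst K 1).
have h0 := nbhs_singleton (@near_germ_cst K 0).
by move/eqP: (oner_neq0 K); apply; rewrite -h1 e -[RHS]h0.
Qed.

(* Multiplication of scalar germs is the scaling of K-valued germs, as
   a *: b = a * b in K. *)
Definition germ_ring := germ K.
HB.instance Definition _ := GRing.Zmodule.on germ_ring.
HB.instance Definition _ := GRing.Zmodule_isComNzRing.Build germ_ring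
  (@germ_scaleA K) germ_mulC (@germ_scale1 K)
  (fun a b c => germ_scaleDl c a b) germ_1neq0.

HB.instance Definition _ (W : normedModType K) :=
  GRing.Zmodule_isLmodule.Build germ_ring (germ W)
    (@germ_scaleA W) (@germ_scale1 W) (@germ_scaleDr W) (@germ_scaleDl W).

(* The value at z does not depend on the representative, since near z includes
   z itself. *)
Definition germ_max_ideal : set germ_ring := [set a | germ_repr a z = 0].

End Germs.

Arguments germ {K V} z W.
Arguments germ_ring {K V} z.
Arguments germ_max_ideal {K V} z.

Section Modules.
Context {A : comNzRingType} (M : lmodType A).

Definition finitely_generated : Prop :=
  exists k (g : 'I_k -> M),
    forall x, exists c : 'I_k -> A, x = \sum_(i < k) c i *: g i.

Definition ideal_smul (I : set A) : set M :=
  [set x | exists k (a : 'I_k -> A) (y : 'I_k -> M),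
     (forall i, I (a i)) /\ x = \sum_(i < k) a i *: y i].

Definition nonzerodivisor_on (r : A) : Prop :=
  forall x : M, r *: x = 0 -> x = 0.

(* depth_I M is +oo when I M = M, hence the first conjunct. *)
Definition depth_eq0 (I : set A) : Prop :=
  ideal_smul I <> [set: M] /\
  ~ (exists r, [/\ I r, nonzerodivisor_on r
                 & range (fun x : M => r *: x) <> [set: M]]).

End Modules.

(* Main.v *)
(** Since [M] has depth 0 and the ring of germs is Noetherian, some [v <> 0] in [M]
    is annihilated by the maximal ideal. For every linear functional [l] on [E], the
    map [f |-> l (f zeta) v] is then a homomorphism of modules; take [l] unbounded
    and suppose that this map is [p \o psi].

    The Taylor coefficients of [psi e], for [e] a constant germ, are bounded
    functionals of [e]. If one of them, of degree [d], was unbounded, choose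
    recursively vectors [e_k] of norm at most 1 at which it is very large, and put
    [f = \sum_k e_k z_1 ^ (L k)] with [L > d], where [z_1] is the first coordinate
    centred at [zeta]. As
    [f = e_0 + z_1 ^ L e_1 + ... + z_1 ^ (L N) f_N], linearity of [psi] shows that the
    coefficients of [psi f] grow faster than any geometric sequence, which is
    absurd.

    Lift [v] to [h] in [O ^ n], reduced modulo [ker p], so that the leading exponent
    of [h] is not that of any element of [ker p]. Since [psi e - l(e) h] belongs to
    [ker p], [l(e)] vanishes as soon as the finitely many coefficients of [psi e] up
    to that exponent do. Hence [l] is bounded, a contradiction.

    Noetherianity and reduced lifts come from the division of power series for a
    degree compatible order on monomials, whose convergence is a small perturbation
    argument in a weighted l^1 norm. The Taylor expansion of holomorphic functions
    is derived without integration: Goursat's theorem is proved for trapezoidal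
    sums, and circle integrals are replaced by averages over the roots of unity of
    order [2 ^ n]. *)

Require Import Defs.
From HB Require Import structures.
From mathcomp Require Import all_boot all_order all_algebra.
From mathcomp Require Import all_classical all_reals all_analysis.
From mathcomp Require Import complex.
From mathcomp Require Import ring lra.
From mathcomp Require mpoly.
Import -(notations) mpoly.

Set Implicit Arguments.
Unset Strict Implicit.
Unset Printing Implicit Defensive.

Import Order.TTheory GRing.Theory Num.Theory.
Import numFieldNormedType.Exports.

Local Open Scope classical_set_scope.
Local Open Scope ring_scope.

(** * Norms, differentiability and Goursat's theorem *)

(** Nothing is known about the continuity of [psi], and the radius of convergence of [psi f] may
    depend on [f] in an uncontrolled way. Linearity over germs is the only handle: multiplication by
    a power of a variable shifts exponents, so that a finite identity isolates one coefficient and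
    no limit is ever taken through [psi]. Since the radius is unknown in advance, the growth has to
    beat all geometric rates at once. Degree compatibility of the term order serves twice. Every
    term has finitely many predecessors, so that finitely many coefficients control [l]. In bounded
    degree the order is also realized by additive integer weights, so that for a small radius the
    smallest term of a series dominates; the leading term is the smallest one because a power series
    has no largest. Membership in [ker p] is tested on leading terms alone, by Dickson's lemma, and
    no closedness of submodules is involved. In the socle argument prime avoidance runs over
    elements with maximal annihilator, which replaces primary decomposition. *)

Section RealNorm.
Context {R : realType}.
Local Notation C := (complex R : numFieldType).

(* The norm of a normed module over [R[i]] takes its values in [R[i]]. *)
Definition rnorm {W : normedModType C} (x : W) : R := complex.Re `|x|.

Local Notation cnorm := (@rnorm C).

Lemma ltr0c (e : R) : (0 < e%:C%C :> C) = (0 < e).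
Proof. by rewrite -[0 in LHS]/(0%:C%C) ltcR. Qed.

Section Theory.
Context {W : normedModType C}.
Implicit Types x y : W.

Lemma rnormE x : `|x| = (rnorm x)%:C%C.
Proof.
have : 0 <= `|x| by exact: normr_ge0.
rewrite /rnorm; case: (`|x|) => a b /=.
by rewrite lecE /= => /andP[/eqP -> _].
Qed.

Lemma rnorm_ge0 x : 0 <= rnorm x.
Proof. by rewrite -ler0c -rnormE. Qed.

Lemma ler_rnormD x y : rnorm (x + y) <= rnorm x + rnorm y.
Proof. by rewrite -lecR rmorphD /= -!rnormE ler_normD. Qed.

Lemma rnormN x : rnorm (- x) = rnorm x.
Proof. by rewrite /rnorm normrN. Qed.

Lemma rnormB x y : rnorm (x - y) = rnorm (y - x).
Proof. by rewrite -rnormN opprB. Qed.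

Lemma rnorm0 : rnorm (0 : W) = 0.
Proof. by rewrite /rnorm normr0. Qed.

Lemma rnorm_eq0 x : rnorm x = 0 -> x = 0.
Proof. by move=> h; apply/eqP; rewrite -normr_eq0 rnormE h. Qed.

Lemma rnorm_le0 x : rnorm x <= 0 -> x = 0.
Proof. by move=> h; apply: rnorm_eq0; apply/eqP; rewrite eq_le h rnorm_ge0. Qed.

Lemma rnormZ (a : C) x : rnorm (a *: x) = cnorm a * rnorm x.
Proof.
by apply: (complexI (R:=R)); rewrite rmorphM /= -!rnormE normrZ.
Qed.

Lemma ler_rnormB x y : rnorm (x - y) <= rnorm x + rnorm y.
Proof. by rewrite -(rnormN y) ler_rnormD. Qed.

Lemma ler_rdistD z x y : rnorm (x - y) <= rnorm (x - z) + rnorm (z - y).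
Proof. by rewrite -[x - y](subrKA z) ler_rnormD. Qed.

Lemma ler_rnorm_sum I (r : seq I) (P : pred I) (F : I -> W) :
  rnorm (\sum_(i <- r | P i) F i) <= \sum_(i <- r | P i) rnorm (F i).
Proof.
elim/big_ind2: _ => [|a x b y ha hb|//]; first by rewrite rnorm0.
by apply: le_trans (ler_rnormD _ _) _; exact: lerD.
Qed.

Lemma rnormrle (x : W) (e : R) : (`|x| <= e%:C%C) = (rnorm x <= e).
Proof. by rewrite rnormE lecR. Qed.

Lemma rnormrlt (x : W) (e : R) : (`|x| < e%:C%C) = (rnorm x < e).
Proof. by rewrite rnormE ltcR. Qed.

Lemma pos_complex (e : C) : 0 < e -> exists2 d : R, 0 < d & e = d%:C%C.
Proof.
case: e => a b; rewrite ltcE /= => /andP[/eqP -> a0]; by exists a.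
Qed.

Lemma near_rnormP (z : W) (P : set W) :
  (\forall x \near z, P x) <->
  exists2 e : R, 0 < e & forall x, rnorm (x - z) < e -> P x.
Proof.
split=> [/nbhs_ballP[e /= e0 h]|[e e0 h]].
  have [d d0 eE] := pos_complex e0.
  by exists d => // x xd; apply: h; rewrite -ball_normE /= distrC eE rnormrlt.
apply/nbhs_ballP; exists (e%:C%C) => /=; first by rewrite ltr0c.
by move=> x; rewrite -ball_normE /= distrC rnormrlt; exact: h.
Qed.

End Theory.

Lemma rnormM (a b : C) : cnorm (a * b) = cnorm a * cnorm b.
Proof. exact: (@rnormZ (complex R : numFieldType)). Qed.

Lemma rnorm1 : cnorm (1 : C) = 1.
Proof. by rewrite /rnorm normr1. Qed.

Lemma rnormX (a : C) n : cnorm (a ^+ n) = cnorm a ^+ n.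
Proof. by elim: n => [|n ih]; rewrite ?expr0 ?rnorm1// !exprS rnormM ih. Qed.

Lemma rnormV (a : C) : cnorm (a^-1) = (cnorm a)^-1.
Proof.
have [->|a0] := eqVneq a 0; first by rewrite invr0 rnorm0 invr0.
have ra0 : cnorm a != 0 by apply: contra_neq a0; exact: rnorm_eq0.
by apply: (mulfI ra0); rewrite -rnormM !mulfV// rnorm1.
Qed.

Lemma rnorm_real (a : R) : cnorm (a%:C%C : C) = `|a|.
Proof.
by apply: (complexI (R:=R)); rewrite -rnormE normc_def /= expr0n addr0 sqrtr_sqr.
Qed.

Lemma rnorm_prod I (r : seq I) (P : pred I) (F : I -> C) :
  cnorm (\prod_(i <- r | P i) F i) = \prod_(i <- r | P i) cnorm (F i).
Proof.
elim/big_ind2: _ => [|a x b y <- <-|//]; [exact: rnorm1|exact: rnormM].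
Qed.

Lemma Re_rnorm (a : C) : `|complex.Re a| <= cnorm a.
Proof.
rewrite -lecR -rnormE; exact: normc_ge_Re.
Qed.

Lemma Im_rnorm (a : C) : `|complex.Im a| <= cnorm a.
Proof.
have -> : complex.Im a = complex.Re (- 'i%C * a) by case: a => x y /=; ring.
apply: le_trans (Re_rnorm _) _; rewrite rnormM rnormN.
suff -> : cnorm ('i%C : C) = 1 by rewrite mul1r.
by apply: (complexI (R:=R)); rewrite -rnormE normc_def /= expr0n expr1n add0r sqrtr1.
Qed.

Section Diff.
Context {V W : normedModType C}.

Lemma differentiable_rnorm (f : V -> W) (z : V) : differentiable f z ->
  exists D : {linear V -> W}, continuous D /\ forall e : R, 0 < e ->
    exists2 d : R, 0 < d & forall h, rnorm h < d ->
      rnorm (f (z + h) - f z - D h) <= e * rnorm h.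
Proof.
move=> /diff_locallyP[dc /eqaddoP df]; exists ('d f z); split=> // e e0.
have /near_rnormP[d d0 h] := df (e%:C%C) (etrans (ltr0c e) e0).
exists d => // x xd; have := h x; rewrite subr0 => /(_ xd).
rewrite /= (rnormE x) -rmorphM /= rnormrle.
by rewrite !fctE /= opprD addrA (addrC x).
Qed.

(** A quadratic remainder is the form in which termwise differentiation of power series delivers
    differentiability. [A] and [B] carry no sign, whence [|A| + 1] and [|B| + 1] as denominators. *)
Lemma rnorm_differentiable (f : V -> W) (z : V) (D : {linear V -> W})
    (A B d : R) : 0 < d ->
  (forall h, rnorm (D h) <= A * rnorm h) ->
  (forall h, rnorm h < d ->
    rnorm (f (z + h) - f z - D h) <= B * rnorm h ^+ 2) ->
  differentiable f z.
Proof.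
move=> d0 DA fD.
have Dc : continuous D.
  move=> x P /near_rnormP[e e0 eP]; apply/near_rnormP.
  have A1 : 0 < `|A| + 1 by rewrite ltr_wpDl.
  exists (e / (`|A| + 1)); first exact: divr_gt0.
  move=> y; rewrite ltr_pdivlMr// => yx; apply: eP; rewrite -linearB.
  apply: le_lt_trans (DA _) _; apply: le_lt_trans yx.
  by rewrite mulrC ler_wpM2l ?rnorm_ge0// ler_wpDr// ler_norm.
apply/diff_locallyP.
have df : f \o shift z = cst (f z) + D +o_ 0 id.
  apply/eqaddoP => e e0; have [e1 e10 ->] := pos_complex e0.
  apply/near_rnormP; exists (Num.min d (e1 / (`|B| + 1))).
    by rewrite lt_min d0 divr_gt0// ltr_wpDl.
  move=> h; rewrite subr0 lt_min => /andP[hd].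
  rewrite ltr_pdivlMr ?ltr_wpDl// => he.
  rewrite /= (rnormE h) -rmorphM /= rnormrle !fctE /= opprD addrA (addrC h).
  apply: le_trans (fD _ hd) _; rewrite expr2 mulrA ler_wpM2r ?rnorm_ge0//.
  have := ler_norm B; have := rnorm_ge0 h; nra.
by rewrite (diff_unique Dc df).
Qed.

End Diff.
End RealNorm.

(** * Goursat's theorem for trapezoidal sums *)

Section Goursat.
Context {R : realType}.
Local Notation C := (complex R : numFieldType).
Local Notation cnorm := (@rnorm R C).

Definition cdiff (g : C -> C) (z : C) := exists a : C, forall e : R, 0 < e ->
  exists2 d : R, 0 < d & forall h, cnorm h < d ->
    cnorm (g (z + h) - g z - a * h) <= e * cnorm h.

(** The supremum of the left ends lies below every right end. Applied to the two coordinates of the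
    corners in the bisection. *)
Lemma nested_intervals (u h : nat -> R) :
  (forall k, h k.+1 = h k / 2) -> 0 <= h 0%N ->
  (forall k, u k <= u k.+1 <= u k + h k.+1) ->
  exists x, forall k, u k <= x <= u k + h k.
Proof.
move=> hS h0 uS.
have hge k : 0 <= h k by elim: k => // k ih; rewrite hS divr_ge0.
have umono : {homo u : m n / (m <= n)%N >-> m <= n}.
  by apply: homo_leq => [//|y x z|k]; [exact: le_trans|case/andP: (uS k)].
have vmono k d : u (k + d)%N + h (k + d)%N <= u k + h k.
  elim: d => [|d ih]; rewrite ?addn0// addnS; apply: le_trans ih.
  by have /andP[_] := uS (k + d)%N; rewrite hS; have := hge (k + d)%N; lra.
have ub k l : u l <= u k + h k.
  have [kl|/ltnW lk] := leqP k l.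
    have := vmono k (l - k)%N; rewrite subnKC//; have := hge l; lra.
  by apply: le_trans (umono _ _ lk) _; rewrite lerDl.
have sne : range u !=set0 by exists (u 0%N), 0%N.
exists (sup (range u)) => k; apply/andP; split.
  by apply: ub_le_sup; [exists (u k + h k) => _ [l _ <-]|exists k].
by apply: ge_sup => // _ [l _ <-].
Qed.

Lemma half_expr_lt (d : R) : 0 < d -> exists k, 2^-1 ^+ k < d.
Proof.
move=> d0; exists (Num.bound d^-1); rewrite exprVn -[ltRHS]invrK ltf_pV2 ?posrE ?invr_gt0 ?exprn_gt0//.
have : d^-1 < (Num.bound d^-1)%:R by apply: archi_boundP; rewrite invr_ge0 ltW.
move=> /lt_le_trans; apply; rewrite -natrX ler_nat ltnW//; exact: ltn_expl.
Qed.

Section Trapezoid.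
Variables g Phi : C -> C.

(* Trapezoidal sums along the image of [P, Q] under [Phi] play the role of the
   integral of [g]: like it they are exact when [g] is affine, which is all that
   the bisection argument needs. *)
Fixpoint trapezoid n (P Q : C) : C :=
  if n is n'.+1 then
    trapezoid n' P ((P + Q) / 2) + trapezoid n' ((P + Q) / 2) Q
  else (g (Phi P) + g (Phi Q)) / 2 * (Phi Q - Phi P).

Lemma trapezoid_rev n P Q : trapezoid n Q P = - trapezoid n P Q.
Proof.
elim: n P Q => [|n ih] P Q /=; first by ring.
by rewrite (addrC Q) ih (ih P) opprD [RHS]addrC.
Qed.

(** The trapezoidal rule integrates [a + b z] exactly, with primitive [a z + b z ^ 2 / 2], so only
    the deviation [e] from the affine function counts, multiplied by the length of the image.
    Lengths add up under halving, which makes the bound independent of [n]. Closure of [D] under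
    midpoints plays the role of convexity. *)
Lemma trapezoid_affine_approx (D : set C) (L e : R) (a b : C) n P Q :
  (forall x y, D x -> D y -> D ((x + y) / 2)) ->
  (forall x y, D x -> D y -> cnorm (Phi y - Phi x) <= L * cnorm (y - x)) ->
  0 <= e ->
  (forall x, D x -> cnorm (g (Phi x) - (a + b * Phi x)) <= e) ->
  D P -> D Q ->
  cnorm (trapezoid n P Q -
    ((a * Phi Q + b * Phi Q ^+ 2 / 2) - (a * Phi P + b * Phi P ^+ 2 / 2)))
  <= e * L * cnorm (Q - P).
Proof.
move=> Dm lip e0 ge; elim: n P Q => [|n ih] P Q DP DQ.
  rewrite /=.
  have -> : (g (Phi P) + g (Phi Q)) / 2 * (Phi Q - Phi P) -
    (a * Phi Q + b * Phi Q ^+ 2 / 2 - (a * Phi P + b * Phi P ^+ 2 / 2)) =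
    2^-1 * ((g (Phi P) - (a + b * Phi P)) + (g (Phi Q) - (a + b * Phi Q)))
    * (Phi Q - Phi P) by field.
  rewrite !rnormM rnormV.
  have -> : cnorm 2 = 2 by rewrite (_ : 2 = (2%:R)%:C%C) ?rnorm_real ?ger0_norm// rmorph_nat.
  rewrite -[leRHS]mulrA; apply: ler_pM => //.
  - by rewrite mulr_ge0 ?invr_ge0 ?rnorm_ge0.
  - exact: rnorm_ge0.
  - have := ler_rnormD (g (Phi P) - (a + b * Phi P)) (g (Phi Q) - (a + b * Phi Q)).
    have := ge _ DP; have := ge _ DQ; lra.
  - exact: lip.
have DM := Dm _ _ DP DQ.
have := ih _ _ DP DM; have := ih _ _ DM DQ => /=.
set M := (P + Q) / 2 => h1 h2.
have nQM : cnorm (Q - M) = cnorm (Q - P) / 2.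
  rewrite /M (_ : Q - _ = 2^-1 * (Q - P)); last by field.
  rewrite rnormM rnormV mulrC; congr (_ / _).
  by rewrite (_ : 2 = (2%:R)%:C%C) ?rnorm_real ?ger0_norm// rmorph_nat.
have nMP : cnorm (M - P) = cnorm (Q - P) / 2.
  by rewrite -nQM; congr (rnorm _); rewrite /M; field.
move: h1 h2; rewrite nQM nMP => h1 h2.
set X := (X in cnorm X).
set X1 := (X in cnorm X) in h1; set X2 := (X in cnorm X) in h2.
have -> : X = X2 + X1 by rewrite /X /X1 /X2; ring.
have := ler_rnormD X2 X1; lra.
Qed.

Definition boundary_sum n (p : C) (h : C) : C :=
  trapezoid n p (p + h) + trapezoid n (p + h) (p + h + 'i%C * h)
  + trapezoid n (p + h + 'i%C * h) (p + 'i%C * h) + trapezoid n (p + 'i%C * h) p.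

(** Each inner edge is run twice in opposite directions and cancels exactly by [trapezoid_rev]. One
    level of depth is spent in halving the outer edges. *)
Lemma boundary_sum_split n p h :
  boundary_sum n.+1 p h =
    boundary_sum n p (h / 2) + boundary_sum n (p + h / 2) (h / 2)
    + boundary_sum n (p + 'i%C * (h / 2)) (h / 2)
    + boundary_sum n (p + h / 2 + 'i%C * (h / 2)) (h / 2).
Proof.
(* Without divisions the vertices can be brought to a common syntactic form. *)
have [k ->] : exists k, h = k + k by exists (h / 2); field.
have -> : (k + k) / 2 = k by field.
rewrite /boundary_sum /=.
set i := 'i%C.
have -> : (p + (p + (k + k))) / 2 = p + k by field.
have -> : (p + (k + k) + (p + (k + k) + i * (k + k))) / 2 = p + k + k + i * k by field.
have -> : (p + (k + k) + i * (k + k) + (p + i * (k + k))) / 2 = p + k + i * k + i * k by field.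
have -> : (p + i * (k + k) + p) / 2 = p + i * k by field.
rewrite !addrA.
have -> : p + i * k + k = p + k + i * k by ring.
have -> : p + k + i * k + k = p + k + k + i * k by ring.
rewrite (_ : p + k + k + i * (k + k) = p + k + k + i * k + i * k); last by ring.
rewrite (_ : p + i * (k + k) = p + i * k + i * k); last by ring.
rewrite (trapezoid_rev n (p + k) (p + k + i * k)).
rewrite (trapezoid_rev n (p + i * k) (p + k + i * k)).
rewrite (trapezoid_rev n (p + k + i * k) (p + k + k + i * k)).
rewrite (trapezoid_rev n (p + k + i * k) (p + k + i * k + i * k)).
ring.
Qed.

Definition in_square (p : C) (h : R) (z : C) :=
  (0 <= complex.Re z - complex.Re p <= h) && (0 <= complex.Im z - complex.Im p <= h).

Lemma rnorm_ReIm (z : C) : cnorm z <= `|complex.Re z| + `|complex.Im z|.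
Proof.
case: z => a b /=.
have -> : (a +i* b)%C = a%:C%C + 'i%C * b%:C%C.
  by apply/eqP; rewrite eq_complex /=; apply/andP; split; apply/eqP; ring.
apply: le_trans (ler_rnormD _ _) _; rewrite rnormM !rnorm_real.
suff -> : cnorm ('i%C : C) = 1 by rewrite mul1r.
by apply: (complexI (R:=R)); rewrite -rnormE normc_def /= expr0n expr1n add0r sqrtr1.
Qed.

Lemma in_square_mid p h x y : in_square p h x -> in_square p h y ->
  in_square p h ((x + y) / 2).
Proof.
rewrite /in_square.
have -> : (x + y) / 2 = (2^-1 : R)%:C%C * (x + y) by rewrite fmorphV rmorph_nat mulrC.
case: x y p => [x1 x2] [y1 y2] [p1 p2] /=.
by move=> /andP[/andP[? ?] /andP[? ?]] /andP[/andP[? ?] /andP[? ?]]; apply/andP; split; apply/andP; lra.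
Qed.

Lemma in_square_dist p h x y : in_square p h x -> in_square p h y ->
  cnorm (x - y) <= 2 * h.
Proof.
move=> hx hy; apply: le_trans (rnorm_ReIm _) _.
move: hx hy; rewrite /in_square; case: x y p => [x1 x2] [y1 y2] [p1 p2] /=.
move=> /andP[/andP[? ?] /andP[? ?]] /andP[/andP[? ?] /andP[? ?]].
have : `|x1 - y1| <= h by rewrite ler_norml; apply/andP; lra.
have : `|x2 - y2| <= h by rewrite ler_norml; apply/andP; lra.
lra.
Qed.

(** The affine part has a primitive, whose increments cancel round the square. On each of the 4
    edges, of image length at most [L * h], the deviation is at most [e * L * (2 * h)], as two
    points of the square are at distance at most [2 * h]. *)
Lemma boundary_sum_small (p : C) (h L e : R) (z : C) n : 0 <= h -> 0 <= e -> 0 <= L ->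
  in_square p h z ->
  (forall x y, in_square p h x -> in_square p h y ->
    cnorm (Phi y - Phi x) <= L * cnorm (y - x)) ->
  (exists a : C, forall x, in_square p h x ->
    cnorm (g (Phi x) - g (Phi z) - a * (Phi x - Phi z)) <= e * cnorm (Phi x - Phi z)) ->
  cnorm (boundary_sum n p h%:C%C) <= 8 * e * L ^+ 2 * h ^+ 2.
Proof.
move=> h0 e0 L0 zsq lip [a ga].
pose b := g (Phi z) - a * Phi z.
have gb x : in_square p h x -> cnorm (g (Phi x) - (b + a * Phi x)) <= e * L * (2 * h).
  move=> xsq; rewrite (_ : _ - _ = g (Phi x) - g (Phi z) - a * (Phi x - Phi z)); last first.
    by rewrite /b; ring.
  apply: le_trans (ga _ xsq) _; rewrite -mulrA ler_wpM2l//.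
  apply: le_trans (lip _ _ zsq xsq) _; rewrite ler_wpM2l//.
  exact: in_square_dist xsq zsq.
have eL : 0 <= e * L * (2 * h) by rewrite !mulr_ge0.
have T := trapezoid_affine_approx n (@in_square_mid p h) lip eL gb.
have corner (s t : bool) : in_square p h (p + (s%:R * h)%:C%C + 'i%C * (t%:R * h)%:C%C).
  rewrite /in_square; case: (p) => p1 p2 /=; case: s t => [] [] /=;
  by apply/andP; split; apply/andP; lra.
have c00 := corner false false; have c10 := corner true false.
have c11 := corner true true; have c01 := corner false true.
rewrite !(mul0r, mul1r, mulr0, addr0) in c00 c10 c11 c01.
have i1 : cnorm ('i%C : C) = 1.
  by apply: (complexI (R:=R)); rewrite -rnormE normc_def /= expr0n expr1n add0r sqrtr1.
have hh : cnorm h%:C%C = h by rewrite rnorm_real ger0_norm.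
have := T _ _ c00 c10; have := T _ _ c10 c11; have := T _ _ c11 c01; have := T _ _ c01 c00.
rewrite /boundary_sum.
set i : C := 'i%C in i1 *; set k : C := h%:C%C in hh *.
rewrite (_ : cnorm (p + k - p) = h); last by rewrite -hh; congr (rnorm _); ring.
rewrite (_ : cnorm (p + k + i * k - (p + k)) = h); last first.
  by rewrite (_ : _ - _ = i * k) ?rnormM ?i1 ?mul1r//; ring.
rewrite (_ : cnorm (p + i * k - (p + k + i * k)) = h); last first.
  by rewrite (_ : _ - _ = - k) ?rnormN//; ring.
rewrite (_ : cnorm (p - (p + i * k)) = h); last first.
  by rewrite (_ : _ - _ = - (i * k)) ?rnormN ?rnormM ?i1 ?mul1r//; ring.
set X4 := (X in cnorm X <= _ -> _); move=> h4.
set X3 := (X in cnorm X <= _ -> _); move=> h3.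
set X2 := (X in cnorm X <= _ -> _); move=> h2.
set X1 := (X in cnorm X <= _ -> _); move=> h1.
set S := (X in cnorm X <= _).
have -> : S = X1 + X2 + X3 + X4 by rewrite /S /X1 /X2 /X3 /X4; ring.
have := ler_rnormD (X1 + X2 + X3) X4; have := ler_rnormD (X1 + X2) X3.
have := ler_rnormD X1 X2.
have -> : 8 * e * L ^+ 2 * h ^+ 2 = 4 * (e * L * (2 * h) * L * h) by ring.
lra.
Qed.

(** Bisection: [small] is scaled by the area, so a square that is not small has a quarter that is
    not small, and differentiability at the common point of the nested squares is contradicted. The
    square lives in the parameter plane and only its image under the Lipschitz map [Phi] meets
    [g]. *)
Lemma goursat (L : R) : 0 <= L ->
  (forall x, in_square 0 1 x -> cdiff g (Phi x)) ->
  (forall x y, in_square 0 1 x -> in_square 0 1 y ->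
    cnorm (Phi y - Phi x) <= L * cnorm (y - x)) ->
  forall e : R, 0 < e ->
    exists N, forall n, (N <= n)%N -> cnorm (boundary_sum n 0 1) <= e.
Proof.
move=> L0 gd lip e e0.
pose small (p : C) (h : R) := exists N, forall n, (N <= n)%N ->
  cnorm (boundary_sum n p h%:C%C) <= e * h ^+ 2.
suff : small 0 1 by rewrite /small rmorph1 expr1n mulr1.
apply: contrapT => nsmall.
pose child (p q : C) (k : R) := exists s t : bool,
  q = p + (s%:R * k)%:C%C + 'i%C * (t%:R * k)%:C%C.
have step p h : ~ small p h -> exists q, child p q (h / 2) /\ ~ small q (h / 2).
  move=> ns; apply: contrapT => /forallNP nex; apply: ns.
  have sm q : child p q (h / 2) -> small q (h / 2).
    by move=> cq; apply: contrapT => nq; apply: (nex q); split.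
  have k2 : h%:C%C / 2 = (h / 2)%:C%C :> C by rewrite rmorphM fmorphV rmorph_nat.
  have ch (s t : bool) : child p (p + (s%:R * (h / 2))%:C%C + 'i%C * (t%:R * (h / 2))%:C%C) (h / 2).
    by exists s, t.
  have [N1 h1] := sm _ (ch false false); have [N2 h2] := sm _ (ch true false).
  have [N3 h3] := sm _ (ch false true); have [N4 h4] := sm _ (ch true true).
  rewrite !(mul0r, mul1r, mulr0, addr0) in h1 h2 h3 h4.
  (* The successor pays for the level of depth consumed by [boundary_sum_split]. *)
  exists (maxn (maxn N1 N2) (maxn N3 N4)).+1 => -[//|n]; rewrite ltnS !geq_max.
  move=> /andP[/andP[/h1 n1 /h2 n2] /andP[/h3 n3 /h4 n4]].
  rewrite boundary_sum_split k2.
  set X1 := boundary_sum _ _ _ in n1 *; set X2 := boundary_sum _ _ _ in n2 *.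
  set X3 := boundary_sum _ _ _ in n3 *; set X4 := boundary_sum _ _ _ in n4 *.
  have := ler_rnormD (X1 + X2 + X3) X4; have := ler_rnormD (X1 + X2) X3.
  have := ler_rnormD X1 X2.
  have -> : e * h ^+ 2 = 4 * (e * (h / 2) ^+ 2) by field.
  lra.
(* Total in [ph] so that [choice] applies; the value [0] is never met, since failure of [small] is
   inherited along [sq]. *)
have step' (ph : C * R) : exists q, ~ small ph.1 ph.2 ->
    child ph.1 q (ph.2 / 2) /\ ~ small q (ph.2 / 2).
  have [ns|s] := pselect (small ph.1 ph.2); first by exists 0.
  by have [q hq] := step _ _ s; exists q.
have [f fP] := choice step'.
pose sq := fix sq k := if k is k'.+1 then (f (sq k'), (sq k').2 / 2) else (0 : C, 1 : R).
have sqP k : ~ small (sq k).1 (sq k).2.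
  by elim: k => //= k ih; have [] := fP _ ih.
have sqc k : child (sq k).1 (sq k.+1).1 ((sq k).2 / 2) by have [] := fP _ (sqP k).
have sq0 k : 0 < (sq k).2 by elim: k => //= k ih; rewrite divr_gt0.
have [x xP] : exists x, forall k, complex.Re (sq k).1 <= x <= complex.Re (sq k).1 + (sq k).2.
  apply: nested_intervals => // k; rewrite [(sq k.+1).2]/=; have [s [t ->]] := sqc k.
  have := sq0 k; move: (sq k) => [[a b] h] /= hh; move: s t => [] []; apply/andP => /=; lra.
have [y yP] : exists y, forall k, complex.Im (sq k).1 <= y <= complex.Im (sq k).1 + (sq k).2.
  apply: nested_intervals => // k; rewrite [(sq k.+1).2]/=; have [s [t ->]] := sqc k.
  have := sq0 k; move: (sq k) => [[a b] h] /= hh; move: s t => [] []; apply/andP => /=; lra.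
pose z : C := (x +i* y)%C.
have zsq k : in_square (sq k).1 (sq k).2 z.
  have := xP k; have := yP k; rewrite /in_square /=.
  by move=> /andP[? ?] /andP[? ?]; apply/andP; split; apply/andP; lra.
have sub k w : in_square (sq k).1 (sq k).2 w -> in_square 0 1 w.
  elim: k => [//|k ih] hw; apply: ih; move: hw.
  rewrite [(sq k.+1).2]/=; have [s [t ->]] := sqc k; have := sq0 k.
  move: (sq k) w => [[a b] h] [u v] /= hh; rewrite /in_square /=.
  move: s t => [] [] /= /andP[/andP[? ?] /andP[? ?]]; apply/andP; split; apply/andP; lra.
have [a ga] := gd _ (zsq 0%N).
(* Makes the bound [8 * e1 * L ^+ 2 * h ^+ 2] of [boundary_sum_small] at most [e * h ^+ 2], also
   when [L = 0]. *)
pose e1 := e / (8 * (L ^+ 2 + 1)).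
have L21 : 0 < L ^+ 2 + 1 by rewrite ltr_wpDl// sqr_ge0.
have e10 : 0 < e1 by rewrite divr_gt0// mulr_gt0.
have [d d0 gd'] := ga _ e10.
have [k hk] : exists k, 2 * L * (sq k).2 < d.
  have sqE k : (sq k).2 = 2^-1 ^+ k by elim: k => //= k ->; rewrite exprSr.
  have [|k hk] := @half_expr_lt (d / (2 * L + 1)).
    by rewrite divr_gt0// ltr_wpDl// mulr_ge0.
  exists k; rewrite sqE; move: hk.
  rewrite ltr_pdivlMr ?ltr_wpDl ?mulr_ge0// mulrC => hd; apply: le_lt_trans hd.
  by rewrite ler_wpM2r ?exprn_ge0 ?invr_ge0// lerDl.
apply: (sqP k); exists 0%N => n _.
apply: le_trans (@boundary_sum_small _ _ L e1 z n (ltW (sq0 k)) (ltW e10) L0 (zsq k) _ _) _.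
- by move=> u v /sub hu /sub hv; exact: lip.
- exists a => u hu.
  have := gd' (Phi u - Phi z); rewrite subrKC; apply.
  apply: le_lt_trans hk; apply: le_trans (lip _ _ (zsq 0%N) (sub _ _ hu)) _.
  rewrite mulrAC (mulrC _ L) mulrA -mulrA ler_wpM2l//.
  exact: in_square_dist hu (zsq k).
- rewrite ler_wpM2r ?sqr_ge0// /e1.
  rewrite (_ : 8 * _ * _ = e * (L ^+ 2 / (L ^+ 2 + 1))); last by field; rewrite gt_eqF.
  by rewrite ler_piMr ?(ltW e0)// ler_pdivrMr// mul1r lerDl.
Qed.

End Trapezoid.
End Goursat.

(** * Cauchy's formula and power series expansions *)

Section Cauchy.
Context {R : realType}.
Local Notation C := (complex R : numFieldType).
Local Notation cnorm := (@rnorm R C).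

Lemma rnorm_i : cnorm 'i%C = 1.
Proof.
by apply: (complexI (R:=R)); rewrite -rnormE normc_def /= expr0n expr1n add0r sqrtr1.
Qed.

Lemma rnorm_natr n : cnorm n%:R = n%:R.
Proof. by rewrite (_ : n%:R = (n%:R)%:C%C) ?rnorm_real ?ger0_norm// rmorph_nat. Qed.

Definition cis (x : R) : C := (cos x +i* sin x)%C.

Lemma cisD x y : cis (x + y) = cis x * cis y.
Proof. by rewrite /cis cosD sinD; apply/eqP; rewrite eq_complex /= addrC eqxx [cos x * _ + _]addrC eqxx. Qed.

Lemma cis0 : cis 0 = 1.
Proof. by rewrite /cis cos0 sin0. Qed.

Lemma cisMn x n : cis (n%:R * x) = cis x ^+ n.
Proof.
elim: n => [|n ih]; first by rewrite mul0r cis0.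
by rewrite exprS -ih -cisD; congr cis; rewrite -natr1; ring.
Qed.

Lemma rnorm_cis x : cnorm (cis x) = 1.
Proof.
by apply: (complexI (R:=R)); rewrite -rnormE normc_def /= cos2Dsin2 sqrtr1.
Qed.

Lemma cis_neq0 x : cis x != 0.
Proof.
by apply/eqP => h; have := rnorm_cis x; rewrite h rnorm0 => /esym/eqP; rewrite oner_eq0.
Qed.

Lemma lipschitz_of_derive (f df : R -> R) (x y : R) : (forall z : R, is_derive z (1 : R) f (df z)) ->
  (forall x, `|df x| <= 1) -> `|f x - f y| <= `|x - y|.
Proof.
move=> fdf df1; wlog xy : x y / x < y => [h|].
  case: (ltgtP x y) => [/h//|/h|->]; last by rewrite !subrr.
  by rewrite distrC (distrC y).
have cf : {within `[x, y], continuous f}.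
  apply: continuous_subspaceT => z; apply: differentiable_continuous.
  by apply/derivable1_diffP.
have [c _ fc] := MVT xy (fun z _ => fdf z) cf.
by rewrite distrC fc normrM (distrC x) ler_piMl.
Qed.

Lemma cis_lipschitz x y : cnorm (cis x - cis y) <= 2 * `|x - y|.
Proof.
apply: le_trans (rnorm_ReIm _) _ => /=.
have h1 : `|cos x - cos y| <= `|x - y|.
  by apply: (@lipschitz_of_derive cos (fun x => - sin x)) => z; rewrite normrN sin_max.
have h2 : `|sin x - sin y| <= `|x - y|.
  by apply: (@lipschitz_of_derive sin cos) => z; exact: cos_max.
lra.
Qed.

(** The order is a power of 2 because [trapezoid] of depth [n] cuts its segment into [2 ^ n] equal
    parts. *)
Definition root2 n : C := cis (2 * pi / 2 ^+ n).

Lemma root2_expN n : root2 n ^+ (2 ^ n) = 1.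
Proof.
rewrite /root2 -cisMn natrX mulrC divfK ?expf_neq0 ?pnatr_eq0//.
by rewrite /cis mulrC mulr_natr cos2pi sin2pi.
Qed.

Lemma root2_exp_neq1 n k : (0 < k < 2 ^ n)%N -> root2 n ^+ k != 1.
Proof.
move=> /andP[k0 kn]; rewrite /root2 -cisMn; apply/eqP => -[] h _.
pose x : R := k%:R * (pi / 2 ^+ n).
have hx : k%:R * (2 * pi / 2 ^+ n) = x *+ 2 by rewrite /x -mulr_natr; ring.
have x0 : 0 < x < pi.
  rewrite /x mulr_gt0 ?ltr0n// ?divr_gt0 ?pi_gt0 ?exprn_gt0//=.
  by rewrite mulrCA gtr_pMr ?pi_gt0// ltr_pdivrMr ?exprn_gt0// mul1r -natrX ltr_nat.
have := sin_gt0_pi x0; move: h; rewrite hx cos_mulr2n cos2sin2 => h s0.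
have : sin x ^+ 2 = 0 by lra.
by move/eqP; rewrite sqrf_eq0 gt_eqF.
Qed.

Lemma sum_root2 n k : (0 < k < 2 ^ n)%N ->
  \sum_(0 <= l < 2 ^ n) (root2 n ^+ l)^-1 ^+ k = 0.
Proof.
move=> kn; have h := root2_exp_neq1 kn.
set z := (root2 n)^-1 ^+ k.
have z1 : z != 1 by rewrite /z exprVn invr_eq1.
have -> : \sum_(0 <= l < 2 ^ n) (root2 n ^+ l)^-1 ^+ k = \sum_(0 <= l < 2 ^ n) z ^+ l.
  by apply: eq_bigr => l _; rewrite /z -exprVn -!exprM mulnC.
apply/(@mulfI _ (z - 1)); first by rewrite subr_eq0.
rewrite mulr0 big_mkord -subrX1 /z -exprM mulnC exprM exprVn root2_expN invr1 expr1n.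
by rewrite subrr.
Qed.

(** The factor is [i] times [2 ^ n * sin (2 pi / 2 ^ n)], which equals 4 at [n = 2] and does not
    decrease, as [sin (2 x) <= 2 sin x] in the range concerned. The lower bound allows dividing a
    small boundary sum by this factor. *)
Lemma root2_im_ge n : (2 <= n)%N ->
  4 <= cnorm ((2 ^ n)%:R * (root2 n - (root2 n)^-1) / 2).
Proof.
have -> : (root2 n)^-1 = cis (- (2 * pi / 2 ^+ n)).
  apply: (mulfI (cis_neq0 (2 * pi / 2 ^+ n))); rewrite mulfV ?cis_neq0//.
  by rewrite -cisD subrr cis0.
rewrite /root2 /cis cosN sinN => n2.
rewrite -mulrA rnormM rnorm_natr.
have s4 : 4 <= 2 ^+ n * sin (2 * pi / 2 ^+ n) :> R.
  elim: n n2 => // n ih; rewrite leq_eqVlt => /orP[/eqP <-|/ih {}ih].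
    rewrite (_ : 2 * pi / 2 ^+ 2 = pi / 2); last by field.
    by rewrite sin_pihalf; lra.
  apply: le_trans ih _.
  rewrite (_ : 2 * pi / 2 ^+ n = (2 * pi / 2 ^+ n.+1) *+ 2); last first.
    by rewrite exprS -mulr_natr; field; rewrite expf_neq0.
  set x := 2 * pi / 2 ^+ n.+1.
  rewrite sin_mulr2n exprS.
  have s0 : 0 <= sin x.
    apply: sin_ge0_pi; rewrite divr_ge0 ?mulr_ge0 ?pi_ge0 ?exprn_ge0//=.
    rewrite ler_pdivrMr ?exprn_gt0// mulrC ler_wpM2l ?pi_ge0//.
    by rewrite exprS ler_peMr// exprn_ege1// ler1n.
  have cs : cos x * sin x <= sin x by rewrite ler_piMl// cos_le1.
  have := @ler_wpM2l _ (2 ^+ n : R) (exprn_ge0 n (ler0n _ 2)) _ _ cs; rewrite -mulr_natr; lra.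
rewrite natrX; apply: le_trans s4 _; rewrite ler_wpM2l ?exprn_ge0//.
set a := cos _; set s := sin _.
have -> : ((a +i* s)%C - (a +i* - s)%C) / 2 = 'i%C * s%:C%C :> C.
  have e2 : (a +i* s)%C - (a +i* - s)%C = 2 * ('i%C * s%:C%C) :> C.
    rewrite (_ : 2 = (2%:R)%:C%C) ?rmorph_nat//.
    by apply/eqP; rewrite eq_complex /=; apply/andP; split; apply/eqP; ring.
  by rewrite e2 mulrC mulKf ?pnatr_eq0.
by rewrite rnormM rnorm_i mul1r rnorm_real ler_norm.
Qed.

(** A Riemann sum for the integral of [F(z) dz / (2 i pi z)]; this is why the Cauchy kernel appears
    below as [z / (z - w)]. *)
Definition circle_avg (r : R) n (F : C -> C) : C :=
  ((2 ^ n)%:R)^-1 * \sum_(0 <= l < 2 ^ n) F (r%:C%C * root2 n ^+ l).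

Lemma circle_pt_norm (r : R) n l : 0 <= r -> cnorm (r%:C%C * root2 n ^+ l) = r.
Proof. by move=> r0; rewrite rnormM rnormX rnorm_cis expr1n mulr1 rnorm_real ger0_norm. Qed.

Lemma circle_avg_bound r n F B : 0 <= r ->
  (forall z, cnorm z = r -> cnorm (F z) <= B) -> cnorm (circle_avg r n F) <= B.
Proof.
move=> r0 FB; rewrite /circle_avg rnormM rnormV rnorm_natr.
rewrite ler_pdivrMl ?ltr0n ?expn_gt0//.
apply: le_trans (ler_rnorm_sum _ _ _) _.
apply: (@le_trans _ _ (\sum_(0 <= l < 2 ^ n) B)).
  by apply: ler_sum => l _; apply: FB; exact: circle_pt_norm.
by rewrite sumr_const_nat subn0 mulr_natl.
Qed.

Lemma circle_avgD r n F G :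
  circle_avg r n (fun z => F z + G z) = circle_avg r n F + circle_avg r n G.
Proof. by rewrite /circle_avg big_split mulrDr. Qed.

Lemma circle_avgZ r n a F :
  circle_avg r n (fun z => a * F z) = a * circle_avg r n F.
Proof. by rewrite /circle_avg -mulr_sumr mulrCA. Qed.

Lemma circle_avgB r n F G :
  circle_avg r n (fun z => F z - G z) = circle_avg r n F - circle_avg r n G.
Proof.
rewrite -mulN1r -circle_avgZ -circle_avgD.
by congr circle_avg; apply/funext => z; rewrite mulN1r.
Qed.

Lemma eq_circle_avg r n F G : 0 <= r -> (forall z, cnorm z = r -> F z = G z) ->
  circle_avg r n F = circle_avg r n G.
Proof.
move=> r0 FG; rewrite /circle_avg; congr (_ * _); apply: eq_bigr => l _.
by apply: FG; exact: circle_pt_norm.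
Qed.

(** In the geometric expansion of the kernel in [w / z], the powers [k] with [0 < k < 2 ^ n] average
    to exactly 0 over the roots of unity. Only the remainder from the power [2 ^ n] on is
    estimated. *)
Lemma circle_avg_kernel (r : R) n w : 0 < r -> cnorm w < r ->
  cnorm (circle_avg r n (fun z => z / (z - w)) - 1) <=
    (cnorm w / r) ^+ (2 ^ n) * (r / (r - cnorm w)).
Proof.
move=> r0 wr.
have nz z : cnorm z = r -> z != 0.
  by move=> zr; apply/eqP => z0; move: zr r0; rewrite z0 rnorm0 => ->; rewrite ltxx.
have nzw z : cnorm z = r -> z - w != 0.
  by move=> zr; apply/eqP => /subr0_eq z0; move: zr wr; rewrite z0 => ->; rewrite ltxx.
have zw z : cnorm z = r -> r - cnorm w <= cnorm (z - w).
  by move=> zr; have := ler_rnormD (z - w) w; rewrite subrK zr; lra.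
have e1 : circle_avg r n (fun z => \sum_(0 <= k < 2 ^ n) (w / z) ^+ k) = 1.
  rewrite /circle_avg exchange_big_nat /= big_ltn ?expn_gt0//.
  rewrite [X in _ + X](_ : _ = 0) ?addr0.
    under eq_bigr do rewrite expr0.
    by rewrite sumr_const_nat subn0 mulVf// pnatr_eq0 expn_eq0.
  rewrite big_nat big1// => k kn; under eq_bigr do rewrite invfM mulrA exprMn.
  by rewrite -mulr_sumr sum_root2 ?mulr0.
rewrite -e1 -circle_avgB; apply: circle_avg_bound => [|z zr]; first exact: ltW.
have -> : z / (z - w) - \sum_(0 <= k < 2 ^ n) (w / z) ^+ k = (w / z) ^+ (2 ^ n) * (z / (z - w)).
  have h : (1 - w / z) != 0.
    rewrite subr_eq0 eq_sym; apply/eqP => h; have := divfK (nz _ zr) w.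
    by rewrite h mul1r => zE; have := nzw _ zr; rewrite zE subrr eqxx.
  apply: (mulfI h); rewrite mulrBr big_mkord.
  rewrite (_ : _ * (\sum_(i < _) _) = 1 - (w / z) ^+ (2 ^ n)); last first.
    by rewrite -[1 - w / z]opprB mulNr -subrX1 opprB.
  by set Q := _ ^+ _; field; rewrite nzw// nz.
rewrite rnormM rnormX rnormM rnormV zr; apply: ler_wpM2l.
  by rewrite exprn_ge0// divr_ge0 ?rnorm_ge0// ltW.
rewrite rnormM rnormV zr ler_wpM2l ?(ltW r0)// lef_pV2 ?zw// posrE ?subr_gt0//.
by apply: lt_le_trans (zw _ zr); rewrite subr_gt0.
Qed.

Lemma trapezoid_sum (g Phi : C -> C) n P Q :
  trapezoid g Phi n P Q =
  \sum_(0 <= l < 2 ^ n) trapezoid g Phi 0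
    (P + l%:R / (2 ^ n)%:R * (Q - P)) (P + l.+1%:R / (2 ^ n)%:R * (Q - P)).
Proof.
elim: n P Q => [|n ih] P Q.
  by rewrite expn0 big_nat1 !divr1 mul0r mul1r addr0 subrKC.
rewrite [LHS]/= !ih.
have N0 : (2 ^ n)%:R != 0 :> C by rewrite pnatr_eq0 expn_eq0.
rewrite [RHS](big_cat_nat (n := 2 ^ n))//=; last by rewrite leq_exp2l.
congr (_ + _).
  apply: eq_bigr => l _.
  have e k : P + k%:R / (2 ^ n)%:R * ((P + Q) / 2 - P) = P + k%:R / (2 ^ n.+1)%:R * (Q - P).
    by rewrite expnS natrM; field.
  by rewrite !e.
rewrite (_ : (2 ^ n.+1)%N = (2 ^ n + 2 ^ n)%N); last by rewrite expnS mul2n addnn.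
have shift (F : nat -> C) : \sum_(2 ^ n <= i < 2 ^ n + 2 ^ n) F i =
    \sum_(0 <= i < 2 ^ n) F (i + 2 ^ n)%N.
  by rewrite -{1}[(2 ^ n)%N]add0n big_addn addnK.
rewrite shift.
apply: eq_bigr => l _.
have e k : (P + Q) / 2 + k%:R / (2 ^ n)%:R * (Q - (P + Q) / 2) =
    P + (k + 2 ^ n)%:R / (2 ^ n + 2 ^ n)%:R * (Q - P).
  by rewrite !natrD; field; rewrite ?N0 ?andbT// -mulr2n mulrn_eq0.
by rewrite !e addSn.
Qed.

(** Summation by parts on a cycle: the diagonal products cancel after a shift of the index, and the
    crossed ones leave the factors [w] and [w^-1]. *)
Lemma cyclic_trapezoid_sum n (G : nat -> C) : G (2 ^ n)%N = G 0%N ->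
  \sum_(0 <= l < 2 ^ n) (G l + G l.+1) / 2 * (root2 n ^+ l.+1 - root2 n ^+ l) =
  (root2 n - (root2 n)^-1) / 2 * \sum_(0 <= l < 2 ^ n) G l * root2 n ^+ l.
Proof.
move=> GN; set w := root2 n.
have w0 : w != 0 by exact: cis_neq0.
have shift : \sum_(0 <= l < 2 ^ n) G l.+1 * w ^+ l.+1 = \sum_(0 <= l < 2 ^ n) G l * w ^+ l.
  apply: (addrI (G 0%N * w ^+ 0)).
  rewrite -(big_nat_recl _ _ (fun l => G l * w ^+ l))// big_nat_recr//= addrC.
  by rewrite GN root2_expN expr0.
set S := (X in _ = _ * X).
rewrite (_ : _ * S = w / 2 * S - w^-1 / 2 * S + 2^-1 * (S - S)); last by ring.
rewrite -[X in _ / 2 * _ - _ / 2 * X]shift -[X in _ + _ * (X - _)]shift.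
rewrite /S mulrBr !mulr_sumr -!sumrB -big_split /=.
by apply: eq_bigr => l _; rewrite exprS; field.
Qed.

Section Cone.
Variables (f : C -> C) (r s0 : R) (w : C).
Hypotheses (r0 : 0 < r) (wr : cnorm w < r) (s00 : 0 < s0) (s01 : s0 <= 1).
Hypothesis df : forall z, cnorm z <= r -> differentiable f z.

Let sigma (P : C) : R := s0 + (1 - s0) * complex.Re P.
(* Contracts the circle of radius [r] towards [w]: the abscissa of [P] determines
   the ratio, its ordinate the angle. *)
Let Phi (P : C) : C :=
  w + (sigma P)%:C%C * (r%:C%C * cis (2 * pi * complex.Im P) - w).
Let g (z : C) : C := f z / (z - w).

Let sigmaP P : in_square 0 1 P -> s0 <= sigma P <= 1.
Proof.
rewrite /in_square /= !subr0 /sigma => /andP[/andP[h1 h2] _].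
have s1 : 0 <= 1 - s0 by rewrite subr_ge0.
apply/andP; split; first by rewrite lerDl mulr_ge0.
by rewrite -lerBrDl ler_piMr.
Qed.

Let circle_w_neq0 t : r%:C%C * cis t - w != 0.
Proof.
apply/eqP => /subr0_eq h; move: wr.
by rewrite -h rnormM rnorm_cis rnorm_real mulr1 gtr0_norm// ltxx.
Qed.

(** The ratio stays above [s0 > 0], which avoids the pole [w]; convexity keeps the image in the
    closed disc. *)
Let cone_differentiable P : in_square 0 1 P -> cdiff g (Phi P).
Proof.
move=> /sigmaP /andP[s1 s2].
have Pw : Phi P - w != 0.
  rewrite /Phi addrC addKr mulf_neq0// -[0]/(0%:C%C) (inj_eq (@complexI R)).
  by rewrite gt_eqF// (lt_le_trans s00).
have Pr : cnorm (Phi P) <= r.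
  rewrite (_ : Phi P = (1 - sigma P)%:C%C * w + (sigma P)%:C%C * (r%:C%C * cis (2 * pi * complex.Im P))); last first.
    by rewrite /Phi rmorphB rmorph1; ring.
  apply: le_trans (ler_rnormD _ _) _; rewrite !rnormM rnorm_cis !rnorm_real.
  rewrite !ger0_norm ?subr_ge0 ?(ltW r0)// ?(le_trans (ltW s00))//.
  have : 0 <= (1 - sigma P) * (r - cnorm w) by rewrite mulr_ge0 ?subr_ge0// ltW.
  rewrite mulrBr !mulrBl !mul1r; lra.
have dg : differentiable g (Phi P).
  apply: (@differentiableM _ _ f (fun z => (z - w)^-1)); first exact: df.
  have dl : differentiable ((id : C -> C) - cst w) (Phi P).
    by apply: differentiableB; [exact: ex_diff|exact: differentiable_cst].
  exact: (differentiableV dl Pw).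
have [D [_ DP]] := differentiable_rnorm dg.
exists (D 1) => e e0; have [d d0 h] := DP e e0.
exists d => // k kd; rewrite (_ : D 1 * k = D k); first exact: h.
by rewrite -[in RHS](mulr1 k) -[k * 1]/(k *: (1 : C)) linearZ /= mulrC.
Qed.

(** [2 * r] comes from the change of ratio, as points of the circle are within [2 * r] of [w];
    [r * (2 * (2 * pi))] comes from the angle, [cis] being shown 2-Lipschitz. *)
Let cone_lipschitz P Q : in_square 0 1 P -> in_square 0 1 Q ->
  cnorm (Phi Q - Phi P) <= (2 * r + r * (2 * (2 * pi))) * cnorm (Q - P).
Proof.
move=> sP sQ; have /andP[sQ1 sQ2] := sigmaP sQ.
rewrite (_ : _ - _ = ((1 - s0) * (complex.Re (Q - P)))%:C%C * (r%:C%C * cis (2 * pi * complex.Im P) - w)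
   + (sigma Q)%:C%C * (r%:C%C * (cis (2 * pi * complex.Im Q) - cis (2 * pi * complex.Im P)))); last first.
  have -> : (1 - s0) * complex.Re (Q - P) = sigma Q - sigma P.
    by rewrite /sigma; case: (Q) (P) => [? ?] [? ?] /=; ring.
  by rewrite /Phi rmorphB; ring.
apply: le_trans (ler_rnormD _ _) _; rewrite [leRHS]mulrDl; apply: lerD.
  rewrite rnormM rnorm_real normrM mulrC; apply: ler_pM; rewrite ?rnorm_ge0 ?mulr_ge0//.
    apply: le_trans (ler_rnormB _ _) _.
    by rewrite rnormM rnorm_cis mulr1 rnorm_real gtr0_norm// mulr_natl mulr2n lerD2l ltW.
  rewrite -[leRHS]mul1r; apply: ler_pM => //; last exact: Re_rnorm.
  by rewrite ger0_norm ?subr_ge0// lerBlDr lerDl ltW.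
rewrite !rnormM !rnorm_real (gtr0_norm r0) (gtr0_norm (lt_le_trans s00 sQ1)).
rewrite -[leRHS]mul1r; apply: ler_pM; rewrite ?mulr_ge0 ?rnorm_ge0 ?(ltW r0)//.
  by rewrite (le_trans (ltW s00)).
rewrite -[leRHS]mulrA ler_wpM2l ?(ltW r0)//.
apply: le_trans (cis_lipschitz _ _) _; rewrite -mulrBr normrM -!mulrA ler_wpM2l//.
rewrite gtr0_norm ?mulr_gt0 ?pi_gt0// -mulrA ler_wpM2l// ler_wpM2l ?pi_ge0//.
by apply: le_trans (Im_rnorm (Q - P)); case: (Q) (P) => [? ?] [? ?].
Qed.

Let frac_real (l n : nat) : l%:R / (2 ^ n)%:R = (l%:R / 2 ^+ n)%:C%C :> C.
Proof. by rewrite rmorphM fmorphV !rmorph_nat -natrX rmorph_nat. Qed.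

(** A vertical edge runs once round a circle. The ratio [t] cancels between the increments of [Phi]
    and the denominator of [g], so both edges give averages against the same kernel. *)
Let cone_edge (n : nat) (s : bool) : let t := if s then 1 else s0 in
  trapezoid g Phi n s%:R (s%:R + 'i%C) =
  (2 ^ n)%:R * (root2 n - (root2 n)^-1) / 2 *
   circle_avg r n (fun z => f (w + t%:C%C * (z - w)) * (z / (z - w))).
Proof.
move=> t; have t0 : t%:C%C != 0 :> C.
  by rewrite -[0]/(0%:C%C) (inj_eq (@complexI R)) /t; case: (s); rewrite ?oner_neq0 ?gt_eqF.
have PhiE l : Phi (s%:R + l%:R / (2 ^ n)%:R * (s%:R + 'i%C - s%:R)) =
    w + t%:C%C * (r%:C%C * root2 n ^+ l - w).
  rewrite (_ : s%:R + 'i%C - s%:R = 'i%C); last by rewrite addrAC subrr add0r.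
  rewrite /Phi frac_real.
  have -> : cis (2 * pi * complex.Im (s%:R + (l%:R / 2 ^+ n)%:C%C * 'i%C)) = root2 n ^+ l.
    by rewrite /root2 -cisMn; congr cis; case: (s) => /=; ring.
  by congr (_ + _%:C%C * _); rewrite /sigma /t; case: (s) => /=; ring.
rewrite trapezoid_sum /=.
under eq_bigr do rewrite !PhiE.
pose G l := g (w + t%:C%C * (r%:C%C * root2 n ^+ l - w)).
rewrite (_ : \sum_(0 <= i < 2 ^ n) _ = t%:C%C * r%:C%C *
   \sum_(0 <= l < 2 ^ n) (G l + G l.+1) / 2 * (root2 n ^+ l.+1 - root2 n ^+ l)); last first.
  by rewrite mulr_sumr; apply: eq_bigr => l _; rewrite /G; ring.
rewrite cyclic_trapezoid_sum; last by rewrite /G root2_expN expr0.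
rewrite /circle_avg.
have N0 : (2 ^ n)%:R != 0 :> C by rewrite pnatr_eq0 expn_eq0.
rewrite -!mulrA [RHS]mulrCA [RHS]mulrC -!mulrA.
rewrite (_ : \sum_(0 <= l < 2 ^ n) _ * (_ / _) = t%:C%C * r%:C%C *
    \sum_(0 <= l < 2 ^ n) G l * root2 n ^+ l); last first.
  rewrite mulr_sumr; apply: eq_bigr => l _; rewrite /G /g.
  rewrite (_ : w + _ - w = t%:C%C * (r%:C%C * root2 n ^+ l - w)); last by ring.
  have := circle_w_neq0 (l%:R * (2 * pi / 2 ^+ n)); rewrite cisMn -/(root2 n) => h.
  by field; rewrite h t0.
by field; rewrite N0 cis_neq0.
Qed.

Lemma cauchy_cone (e : R) : 0 < e -> exists N, forall n, (N <= n)%N ->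
  cnorm (circle_avg r n (fun z => f z * (z / (z - w))) -
         circle_avg r n (fun z => f (w + s0%:C%C * (z - w)) * (z / (z - w)))) <= e.
Proof.
move=> e0; have L0 : 0 <= 2 * r + r * (2 * (2 * pi)).
  by rewrite addr_ge0 ?mulr_ge0 ?pi_ge0// ltW.
have [N NP] := goursat L0 cone_differentiable cone_lipschitz e0.
exists (maxn N 2) => n; rewrite geq_max => /andP[/NP h n2].
move: h; rewrite /boundary_sum mulr1 !add0r.
(* The horizontal edges have angles [0] and [2 * pi], hence the same image, and cancel. *)
have -> : trapezoid g Phi n (1 + 'i%C) 'i%C = - trapezoid g Phi n 0 1.
  rewrite trapezoid_rev; congr (- _); rewrite !trapezoid_sum.
  have PhiE (l : nat) : Phi ('i%C + l%:R / (2 ^ n)%:R * (1 + 'i%C - 'i%C)) =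
      Phi (0 + l%:R / (2 ^ n)%:R * (1 - 0)).
    rewrite addrK subr0 mulr1 add0r frac_real /Phi.
    congr (_ + _%:C%C * (_ * _ - _)); first by rewrite /sigma /= add0r.
    by rewrite /= addr0 mulr1 mulr0 cis0 mulrC mulr_natr /cis cos2pi sin2pi.
  by apply: eq_bigr => l _ /=; rewrite !PhiE.
have := cone_edge n true; have := cone_edge n false => /=.
rewrite mulr0n mulr1n add0r => e1 e2.
rewrite (trapezoid_rev _ _ n 0 'i%C) e1 e2.
set a := circle_avg _ _ _; set b := circle_avg _ _ _; set k := _ / 2.
rewrite (_ : _ + _ = k * (a - b)); last by ring.
rewrite rnormM => h.
have -> : circle_avg r n (fun z => f z * (z / (z - w))) = a.
  rewrite /a; congr circle_avg; apply/funext => z.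
  by rewrite mul1r subrKC.
have := root2_im_ge n2; rewrite -/k => k4.
have := rnorm_ge0 (a - b); nra.
Qed.

End Cone.

Lemma exists_expr_lt (x d : R) : 0 <= x < 1 -> 0 < d ->
  exists N, forall n, (N <= n)%N -> x ^+ n < d.
Proof.
move=> /andP[x0 x1] d0.
have /cvgr_lt /(_ d d0) [N _ hN] : x ^+ n @[n --> \oo] --> 0.
  by apply: cvg_expr; rewrite ger0_norm.
by exists N => n Nn; exact: hN.
Qed.

(** By [cauchy_cone] the circle can be shrunk towards [w] until [f] is nearly constant on it;
    [circle_avg_kernel] then evaluates the average of the kernel. [K] bounds the kernel on the
    circle. *)
Lemma cauchy_formula (f : C -> C) (r : R) (w : C) (e : R) :
  0 < r -> cnorm w < r -> (forall z, cnorm z <= r -> differentiable f z) -> 0 < e ->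
  exists N, forall n, (N <= n)%N ->
    cnorm (circle_avg r n (fun z => f z * (z / (z - w))) - f w) <= e.
Proof.
move=> r0 wr df e0.
pose K := r / (r - cnorm w).
have K0 : 0 < K by rewrite divr_gt0 ?subr_gt0.
pose e1 := e / 3 / K.
have e10 : 0 < e1 by apply: (divr_gt0 (divr_gt0 e0 _) K0); rewrite ltr0n.
have [d d0 hd] : exists2 d : R, 0 < d & forall x, cnorm (x - w) < d -> cnorm (f x - f w) < e1.
  have fc := differentiable_continuous (df _ (ltW wr)).
  apply/(@near_rnormP R C w (fun x => cnorm (f x - f w) < e1)).
  by apply: (fc [set y | cnorm (y - f w) < e1]); apply: (@near_rnormP R C (f w) (fun y => cnorm (y - f w) < e1)).2; exists e1.
(* On the circle [|z - w| < 3 * r], so the shrunk circle lies within [d] of [w]. *)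
pose s0 := Num.min 1 (d / (3 * r)).
have s00 : 0 < s0 by rewrite lt_min ltr01 divr_gt0// mulr_gt0.
have s01 : s0 <= 1 by rewrite ge_min lexx.
have e30 : 0 < e / 3 by rewrite divr_gt0.
have [N1 h1] := cauchy_cone r0 wr s00 s01 df e30.
have [N2 h2] : exists N, forall n, (N <= n)%N ->
    cnorm (f w) * ((cnorm w / r) ^+ (2 ^ n) * K) <= e / 3.
  have x01 : 0 <= cnorm w / r < 1.
    by rewrite divr_ge0 ?rnorm_ge0 ?ltr_pdivrMr ?mul1r// ltW.
  have q0 : 0 < e / 3 / ((cnorm (f w) + 1) * K).
    by apply: divr_gt0 => //; apply: mulr_gt0 => //; rewrite ltr_wpDl ?rnorm_ge0.
  have [N hN] := exists_expr_lt x01 q0.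
  exists N => n Nn; have := hN (2 ^ n)%N (leq_trans Nn (ltnW (ltn_expl n (isT : (1 < 2)%N)))).
  rewrite ltr_pdivlMr; last by apply: mulr_gt0 => //; rewrite ltr_wpDl ?rnorm_ge0.
  move=> /ltW; apply: le_trans.
  rewrite mulrCA ler_wpM2l ?exprn_ge0 ?divr_ge0 ?rnorm_ge0 ?(ltW r0)//.
  by rewrite ler_wpM2r ?(ltW K0)// lerDl.
exists (maxn N1 N2) => n; rewrite geq_max => /andP[/h1 {}h1 /h2 {}h2].
set X := circle_avg _ _ _ in h1 *; set Y := circle_avg _ _ _ in h1.
have := ler_rdistD Y X (f w).
suff : cnorm (Y - f w) <= 2 * (e / 3) by lra.
have := ler_rdistD (f w * circle_avg r n (fun z => z / (z - w))) Y (f w).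
set Z := _ * circle_avg _ _ _.
have : cnorm (Z - f w) <= e / 3.
  rewrite (_ : Z - f w = f w * (circle_avg r n (fun z => z / (z - w)) - 1)); last by rewrite /Z; ring.
  rewrite rnormM; apply: le_trans h2; rewrite ler_wpM2l ?rnorm_ge0//.
  exact: circle_avg_kernel.
suff : cnorm (Y - Z) <= e / 3 by lra.
rewrite /Y /Z -circle_avgZ -circle_avgB; apply: circle_avg_bound => [|z zr]; first exact: ltW.
rewrite -mulrBl rnormM (_ : e / 3 = e1 * K); last by rewrite /e1 divfK// gt_eqF.
apply: ler_pM; rewrite ?rnorm_ge0//.
  apply: ltW; apply: hd; rewrite addrC addKr rnormM rnorm_real gtr0_norm//.
  have zw2 : cnorm (z - w) < 3 * r by have := ler_rnormB z w; rewrite zr; lra.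
  have sd : s0 * (3 * r) <= d by rewrite -ler_pdivlMr ?mulr_gt0// ge_min lexx orbT.
  by apply: lt_le_trans sd; rewrite ltr_pM2l.
rewrite rnormM rnormV zr ler_wpM2l ?(ltW r0)//.
have zw : r - cnorm w <= cnorm (z - w).
  by have := ler_rnormD (z - w) w; rewrite subrK zr; lra.
by rewrite lef_pV2 ?posrE ?subr_gt0// (lt_le_trans _ zw)// subr_gt0.
Qed.

End Cauchy.

(** * Ultralimits of bounded complex sequences *)

Section Ultralimit.
Context {R : realType}.
Local Notation C := (complex R : numFieldType).
Local Notation cnorm := (@rnorm R C).

Definition bounded_seq (u : nat -> C) := exists B : R, forall n, cnorm (u n) <= B.

(** The limit is the supremum of the levels exceeded on a set of [U]. As [U] contains every set or
    its complement, a level above the supremum fails on a set of [U]. *)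
Lemma ultralimit_real (U : set_system nat) (v : nat -> R) (B : R) :
  UltraFilter U -> (forall n, `|v n| <= B) ->
  exists l : R, forall e : R, 0 < e -> U [set n | `|v n - l| <= e].
Proof.
move=> FU vB.
pose S := [set a : R | U [set n | a < v n]].
have Sne : S !=set0.
  exists (- B - 1); rewrite /S /=.
  rewrite (_ : [set n | _] = setT); first exact: filterT.
  by apply/seteqP; split=> // n _ /=; have := vB n; rewrite ler_norml => /andP[? _]; lra.
have Sub : has_ubound S.
  exists B => a Sa; have [n /= an] := filter_ex Sa.
  by have := vB n; rewrite ler_norml => /andP[_ ?]; lra.
exists (sup S) => e e0.
have [a Sa ae] : exists2 a, S a & sup S - e < a.
  by apply: sup_adherent => //; split.
have nSb : ~ S (sup S + e).
  by move=> /(ub_le_sup Sub); lra.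
have [//|Ub] := in_ultra_setVsetC [set n | sup S + e < v n] FU.
apply: filterS (filterI Sa Ub) => n [/= h1 /negP]; rewrite -leNgt => h2.
by rewrite ler_norml; apply/andP; split; lra.
Qed.

Lemma exists_ultralimit : exists LIM : (nat -> C) -> C,
  [/\ forall u v, bounded_seq u -> bounded_seq v ->
        LIM (fun n => u n + v n) = LIM u + LIM v,
      forall a u, bounded_seq u -> LIM (fun n => a * u n) = a * LIM u,
      forall u B, (forall n, cnorm (u n) <= B) -> cnorm (LIM u) <= B
    & forall u l, bounded_seq u ->
        (forall e, 0 < e -> exists N, forall n, (N <= n)%N -> cnorm (u n - l) <= e) ->
        LIM u = l].
Proof.
have [U [FU Uoo]] := @ultraFilterLemma nat \oo _.
pose ulim (u : nat -> C) (l : C) := forall e : R, 0 < e -> U [set n | cnorm (u n - l) <= e].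
have ulim_ex u : bounded_seq u -> exists l, ulim u l.
  move=> [B uB].
  have [a aP] := @ultralimit_real U (fun n => complex.Re (u n)) B FU
    (fun n => le_trans (Re_rnorm _) (uB n)).
  have [b bP] := @ultralimit_real U (fun n => complex.Im (u n)) B FU
    (fun n => le_trans (Im_rnorm _) (uB n)).
  exists (a +i* b)%C => e e0.
  have e20 : 0 < e / 2 by rewrite divr_gt0.
  apply: filterS (filterI (aP _ e20) (bP _ e20)) => n [/= h1 h2].
  apply: le_trans (rnorm_ReIm _) _; move: h1 h2; case: (u n) => x y /=; lra.
have ulim_uniq u l l' : ulim u l -> ulim u l' -> l = l'.
  move=> h h'; apply/subr0_eq/rnorm_le0; apply/ler_addgt0Pr => e e0; rewrite add0r.
  have e20 : 0 < e / 2 by rewrite divr_gt0.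
  have [n [/= h1 h2]] := filter_ex (filterI (h _ e20) (h' _ e20)).
  have := ler_rdistD (u n) l l'; rewrite rnormB in h1; lra.
pose LIM u := get (ulim u).
have LIMP u : bounded_seq u -> ulim u (LIM u).
  by move=> /ulim_ex[l ul]; exact: (@getI _ (ulim u) l).
have LIM_eq u l : bounded_seq u -> ulim u l -> LIM u = l.
  by move=> bu; apply: ulim_uniq; exact: LIMP.
exists LIM; split.
- move=> u v bu bv; apply: LIM_eq.
    move: bu bv => [B1 h1] [B2 h2]; exists (B1 + B2) => n.
    exact: le_trans (ler_rnormD _ _) (lerD _ _).
  move=> e e0; have e20 : 0 < e / 2 by rewrite divr_gt0.
  apply: filterS (filterI (LIMP _ bu _ e20) (LIMP _ bv _ e20)) => n [/= h1 h2].
  rewrite (_ : _ - _ = (u n - LIM u) + (v n - LIM v)); last by ring.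
  apply: le_trans (ler_rnormD _ _) _; lra.
- move=> a u bu; apply: LIM_eq.
    move: bu => [B1 h1]; exists (cnorm a * B1) => n.
    by rewrite rnormM ler_wpM2l ?rnorm_ge0.
  move=> e e0.
  have a1 : 0 < cnorm a + 1 by rewrite ltr_wpDl ?rnorm_ge0.
  apply: filterS (LIMP _ bu (e / (cnorm a + 1)) _) => [n /= h1|]; last exact: divr_gt0.
  rewrite -mulrBr rnormM; move: h1; rewrite ler_pdivlMr// mulrC; apply: le_trans.
  by rewrite ler_wpM2r ?rnorm_ge0// lerDl.
- move=> u B uB; have bu : bounded_seq u by exists B.
  apply/ler_addgt0Pr => e e0.
  have [n /= h] := filter_ex (LIMP _ bu _ e0).
  have := ler_rnormD (u n) (LIM u - u n); rewrite subrKC.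
  by rewrite rnormB in h; have := uB n; lra.
- move=> u l bu ul; apply: LIM_eq => // e e0; apply: Uoo.
  by have [N hN] := ul e e0; exists N.
Qed.

(** Rows carry the sup norm, so norm balls are polydiscs. The strict version comes from the
    description of balls, and the large one by letting the radius decrease; [0 <= e] is what the
    case of no coordinates requires. *)
Lemma row_rnormP m (z : 'rV[C]_m) (e : R) : 0 <= e ->
  (rnorm z <= e) <-> (forall k, cnorm (z ord0 k) <= e).
Proof.
move=> e0.
have lt (d : R) : 0 < d -> (rnorm z < d) <-> (forall k, cnorm (z ord0 k) < d).
  move=> d0.
  have -> : (rnorm z < d) <-> ball (0 : 'rV[C]_m) (d%:C%C) z.
    by rewrite mx_norm_ball /ball_ /= sub0r normrN rnormrlt.
  split.
    move=> [_ h] k; have := h ord0 k; rewrite mxE -ball_normE /= sub0r normrN.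
    by rewrite rnormrlt.
  move=> h; split=> [|i k]; first by rewrite ltr0c.
  rewrite ord1 mxE -ball_normE /= sub0r normrN rnormrlt; exact: h.
split=> h.
  move=> k; apply/ler_addgt0Pr => d d0; apply/ltW.
  have ed : 0 < e + d by rewrite ltr_wpDl.
  by apply: (lt _ ed).1; lra.
apply/ler_addgt0Pr => d d0; apply/ltW.
have ed : 0 < e + d by rewrite ltr_wpDl.
by apply/(lt _ ed) => k; have := h k; lra.
Qed.

Lemma row_coord_le m (z : 'rV[C]_m) k : cnorm (z ord0 k) <= rnorm z.
Proof. by move: k; apply/row_rnormP => //; exact: rnorm_ge0. Qed.

End Ultralimit.

(** * Iterated circle means and Cauchy's formula in several variables *)

Section IteratedMean.
Context {R : realType}.
Local Notation C := (complex R : numFieldType).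
Local Notation cnorm := (@rnorm R C).
Variables (LIM : (nat -> C) -> C).
Hypothesis LIMD : forall u v, bounded_seq u -> bounded_seq v ->
  LIM (fun n => u n + v n) = LIM u + LIM v.
Hypothesis LIMZ : forall a u, bounded_seq u -> LIM (fun n => a * u n) = a * LIM u.
Hypothesis LIM_bound : forall u B, (forall n, cnorm (u n) <= B) -> cnorm (LIM u) <= B.
Hypothesis LIM_lim : forall u l, bounded_seq u ->
  (forall e, 0 < e -> exists N, forall n, (N <= n)%N -> cnorm (u n - l) <= e) ->
  LIM u = l.
Variables (r : R).
Hypothesis r0 : 0 < r.

(* An ultralimit of averages exists for every bounded function, so the means can
   be iterated over the variables with no integrability to check. *)
Definition circle_mean (F : C -> C) : C := LIM (fun n => circle_avg r n F).

Definition bounded_circle (F : C -> C) :=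
  exists B : R, forall z, cnorm z = r -> cnorm (F z) <= B.

Lemma bounded_circle_avg F : bounded_circle F -> bounded_seq (fun n => circle_avg r n F).
Proof. by move=> [B FB]; exists B => n; apply: circle_avg_bound => //; exact: ltW. Qed.

Lemma circle_meanD F G : bounded_circle F -> bounded_circle G ->
  circle_mean (fun z => F z + G z) = circle_mean F + circle_mean G.
Proof.
move=> bF bG; rewrite /circle_mean -LIMD; try exact: bounded_circle_avg.
by congr LIM; apply/funext => n; rewrite circle_avgD.
Qed.

Lemma circle_meanZ a F : bounded_circle F ->
  circle_mean (fun z => a * F z) = a * circle_mean F.
Proof.
move=> bF; rewrite /circle_mean -LIMZ; try exact: bounded_circle_avg.
by congr LIM; apply/funext => n; rewrite circle_avgZ.
Qed.

Lemma circle_mean_bound F B : (forall z, cnorm z = r -> cnorm (F z) <= B) ->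
  cnorm (circle_mean F) <= B.
Proof. by move=> FB; apply: LIM_bound => n; apply: circle_avg_bound => //; exact: ltW. Qed.

Lemma eq_circle_mean F G : (forall z, cnorm z = r -> F z = G z) ->
  circle_mean F = circle_mean G.
Proof.
move=> FG; congr LIM; apply/funext => n; apply: eq_circle_avg => //; exact: ltW.
Qed.

Lemma circle_mean_cauchy (f : C -> C) (w : C) : cnorm w < r ->
  (forall z, cnorm z <= r -> differentiable f z) -> bounded_circle f ->
  circle_mean (fun z => f z * (z / (z - w))) = f w.
Proof.
move=> wr df [B fB]; apply: LIM_lim; last by move=> e e0; exact: cauchy_formula.
apply: bounded_circle_avg; exists (B * (r / (r - cnorm w))) => z zr.
rewrite rnormM; apply: ler_pM; rewrite ?rnorm_ge0 ?fB// rnormM rnormV zr.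
rewrite ler_wpM2l ?(ltW r0)//.
have zw : r - cnorm w <= cnorm (z - w).
  by have := ler_rnormD (z - w) w; rewrite subrK zr; lra.
by rewrite lef_pV2 ?posrE ?subr_gt0// (lt_le_trans _ zw)// subr_gt0.
Qed.

Section Torus.
Variable m : nat.
Implicit Types (s : seq 'I_m) (F G : 'rV[C]_m -> C) (w z : 'rV[C]_m).

Definition row_upd z (j : 'I_m) (t : C) : 'rV[C]_m :=
  \row_k (if k == j then t else z ord0 k).

Fixpoint torus_mean s F w : C :=
  if s is j :: s' then circle_mean (fun t => torus_mean s' F (row_upd w j t))
  else F w.

Definition on_torus s w z := forall k,
  if k \in s then cnorm (z ord0 k) = r else z ord0 k = w ord0 k.

Lemma on_torus_upd s w z j t : cnorm t = r ->
  on_torus s (row_upd w j t) z -> on_torus (j :: s) w z.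
Proof.
move=> tr h k; have := h k; rewrite inE mxE.
by case: (k \in s); case: eqP => //= _ ->.
Qed.

Lemma torus_mean_bound s F w B : (forall z, on_torus s w z -> cnorm (F z) <= B) ->
  cnorm (torus_mean s F w) <= B.
Proof.
elim: s w => [|j s ih] w FB /=; first by apply: FB.
apply: circle_mean_bound => t tr; apply: ih => z zT; apply: FB.
exact: on_torus_upd zT.
Qed.

Lemma eq_torus_mean s F G w : (forall z, on_torus s w z -> F z = G z) ->
  torus_mean s F w = torus_mean s G w.
Proof.
elim: s w => [|j s ih] w FG /=; first by apply: FG.
apply: eq_circle_mean => t tr; apply: ih => z zT; apply: FG.
exact: on_torus_upd zT.
Qed.

Definition bounded_torus s w F := exists B : R, forall z, on_torus s w z -> cnorm (F z) <= B.

Lemma bounded_torus_circle j s w F : bounded_torus (j :: s) w F ->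
  bounded_circle (fun t => torus_mean s F (row_upd w j t)).
Proof.
move=> [B FB]; exists B => t tr; apply: torus_mean_bound => z zT; apply: FB.
exact: on_torus_upd zT.
Qed.

Lemma bounded_torus_upd j s w F t : cnorm t = r -> bounded_torus (j :: s) w F ->
  bounded_torus s (row_upd w j t) F.
Proof. by move=> tr [B FB]; exists B => z zT; apply: FB; exact: on_torus_upd zT. Qed.

Lemma torus_meanD s F G w : bounded_torus s w F -> bounded_torus s w G ->
  torus_mean s (fun z => F z + G z) w = torus_mean s F w + torus_mean s G w.
Proof.
elim: s w => [//|j s ih] w bF bG /=.
rewrite -circle_meanD; try exact: bounded_torus_circle.
by apply: eq_circle_mean => t tr; apply: ih; exact: bounded_torus_upd.
Qed.

Lemma torus_meanZ s a F w : bounded_torus s w F ->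
  torus_mean s (fun z => a * F z) w = a * torus_mean s F w.
Proof.
elim: s w => [//|j s ih] w bF /=.
rewrite -circle_meanZ; try exact: bounded_torus_circle.
by apply: eq_circle_mean => t tr; apply: ih; exact: bounded_torus_upd.
Qed.

(** A mean over all variables is independent of the base point; coefficients defined at [0] can thus
    be compared with the value of [f] at any [w]. *)
Lemma torus_mean_base s F w w' : (forall k, k \notin s -> w ord0 k = w' ord0 k) ->
  torus_mean s F w = torus_mean s F w'.
Proof.
elim: s w w' => [|j s ih] w w' h /=; first by congr F; apply/rowP => k; exact: h.
apply: eq_circle_mean => t tr; apply: ih => k ks; rewrite !mxE.
by case: eqP => // /eqP kj; apply: h; rewrite inE negb_or kj.
Qed.

(** The Cauchy kernel itself in the variables of [s], not an estimate of it. *)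
Definition kernel_bound s w z : C := \prod_(j <- s) (z ord0 j / (z ord0 j - w ord0 j)).

Lemma differentiable_row_upd w j (t : C) :
  differentiable (row_upd w j : C -> 'rV[C]_m) t.
Proof.
have -> : row_upd w j = cst (row_upd w j 0) + (fun t : C => t *: delta_mx ord0 j).
  apply/funext => x; apply/rowP => k; rewrite !fctE !mxE.
  by case: (k == j); rewrite /= ?mulr1 ?mulr0 ?add0r ?addr0.
apply: differentiableD; first exact: differentiable_cst.
exact: (@differentiableZl _ _ _ (id : C -> C)).
Qed.

(** [w] fixes the kernel while the base point [w'] moves: the induction hypothesis is used at [w']
    with its coordinate [j] replaced by a point of the circle, and the formula in one variable then
    brings that coordinate back to the one of [w]. *)
Lemma torus_mean_cauchy s (f : 'rV[C]_m -> C) w w' (B : R) : uniq s ->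
  rnorm w < r -> rnorm w' <= r -> (forall k, k \in s -> w ord0 k = w' ord0 k) ->
  (forall z, rnorm z <= r -> differentiable f z) ->
  (forall z, rnorm z <= r -> cnorm (f z) <= B) ->
  torus_mean s (fun z => f z * kernel_bound s w z) w' = f w'.
Proof.
move=> + wr + + df fB; elim: s w' => [|j s ih] w' /= us wr' ww'.
  by rewrite /kernel_bound big_nil mulr1.
case/andP: us => js us.
have upd_r t : cnorm t <= r -> rnorm (row_upd w' j t) <= r.
  move=> tr; apply/row_rnormP => [|k]; first exact: ltW.
  rewrite mxE; case: eqP => // _; apply: le_trans wr'; exact: row_coord_le.
rewrite -[in RHS](_ : row_upd w' j (w ord0 j) = w'); last first.
  apply/rowP => k; rewrite mxE; case: eqP => // ->; apply: ww'.
  by rewrite inE eqxx.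
rewrite -(@circle_mean_cauchy (fun t => f (row_upd w' j t))); last 3 first.
- exact: le_lt_trans (row_coord_le _ _) wr.
- move=> t tr; apply: (@differentiable_comp _ _ _ _ (row_upd w' j)).
    exact: differentiable_row_upd.
  by apply: df; exact: upd_r.
- by exists B => t tr; apply: fB; apply: upd_r; rewrite tr.
apply: eq_circle_mean => t tr.
rewrite -[in RHS](ih (row_upd w' j t)) ?upd_r ?tr//; last first.
  move=> k ks; rewrite mxE; case: eqP => [kj|_]; first by rewrite -kj ks in js.
  by apply: ww'; rewrite inE ks orbT.
rewrite mulrC -torus_meanZ; last first.
  exists (B * \prod_(k <- s) (r / (r - cnorm (w ord0 k)))) => z zT.
  have zr : rnorm z <= r.
    apply/row_rnormP => [|k]; first exact: ltW.
    have := zT k; case: (k \in s) => -> //.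
    by rewrite mxE; case: eqP => _; rewrite ?tr// (le_trans _ wr')// row_coord_le.
  rewrite rnormM; apply: ler_pM; rewrite ?rnorm_ge0 ?fB// /kernel_bound rnorm_prod.
  rewrite !big_seq; apply: ler_prod => k ks; rewrite rnorm_ge0 rnormM rnormV /=.
  have := zT k; rewrite ks => ->; rewrite ler_wpM2l ?(ltW r0)//.
  have wk : cnorm (w ord0 k) < r by apply: le_lt_trans wr; exact: row_coord_le.
  have zw : r - cnorm (w ord0 k) <= cnorm (z ord0 k - w ord0 k).
    have := zT k; rewrite ks => zk.
    by have := ler_rnormD (z ord0 k - w ord0 k) (w ord0 k); rewrite subrK zk; lra.
  by rewrite lef_pV2 ?posrE ?subr_gt0// (lt_le_trans _ zw)// subr_gt0.
apply: eq_torus_mean => z zT.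
have zj : z ord0 j = t by have := zT j; rewrite (negbTE js) mxE eqxx.
by rewrite /kernel_bound big_cons zj; ring.
Qed.

End Torus.
End IteratedMean.

(** * Monomials and expansions on polydiscs *)

Section Monomials.
Context {R : realType}.
Local Notation C := (complex R : numFieldType).
Local Notation cnorm := (@rnorm R C).
Variable m : nat.
Local Notation mon := (multinom m).
Implicit Types (a b : mon) (z w : 'rV[C]_m).

Definition mons N : seq mon := [seq bmnm x | x <- enum {: bmultinom m N}].

Lemma mons_uniq N : uniq (mons N).
Proof. by rewrite map_inj_uniq ?enum_uniq//; exact: val_inj. Qed.

Lemma mem_mons N a : (a \in mons N) = (mdeg a < N)%N.
Proof.
apply/mapP/idP => [[x _ ->]|h]; first exact: bmdeg.
by exists (BMultinom h) => //; rewrite mem_enum.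
Qed.

Definition zmon z a : C := \prod_(j < m) z ord0 j ^+ a j.

Lemma zmonD z a b : zmon z (mnm_add a b) = zmon z a * zmon z b.
Proof.
rewrite /zmon -big_split; apply: eq_bigr => j _ /=.
by rewrite mnmDE exprD.
Qed.

Lemma rnorm_zmon_le z a (d : R) : 0 <= d -> rnorm z <= d -> cnorm (zmon z a) <= d ^+ mdeg a.
Proof.
move=> d0 zd; rewrite /zmon rnorm_prod mdegE -prodrXr.
apply: ler_prod => j _; rewrite rnorm_ge0 rnormX /=.
by apply: lerXn2r; rewrite ?nnegrE ?rnorm_ge0// (le_trans (row_coord_le z j)).
Qed.

Lemma rnorm_zmon_torus z a (d : R) : (forall j, cnorm (z ord0 j) = d) ->
  cnorm (zmon z a) = d ^+ mdeg a.
Proof.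
move=> zd; rewrite /zmon rnorm_prod mdegE -prodrXr.
by apply: eq_bigr => j _; rewrite rnormX zd.
Qed.

(** The exponents are bounded separately because a product of truncated geometric series, one for
    each variable, expands over such a box. *)
Definition boxmon N (x : {ffun 'I_m -> 'I_N}) : mon := Multinom [tuple (x i : nat) | i < m].

Lemma boxmonE N (x : {ffun 'I_m -> 'I_N}) i : boxmon x i = x i.
Proof. by rewrite /boxmon mnmE. Qed.

Lemma boxmon_inj N : injective (@boxmon N).
Proof.
by move=> x y /mnmP h; apply/ffunP => i; apply: val_inj; have := h i; rewrite !boxmonE.
Qed.

Lemma boxmon_ex N a : (mdeg a < N)%N -> exists x : {ffun 'I_m -> 'I_N}, a = boxmon x.
Proof.
move=> aN; have h i : (a i < N)%N.
  by apply: leq_ltn_trans aN; rewrite mdegE (bigD1 i)//= leq_addr.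
by exists [ffun i => Ordinal (h i)]; apply/mnmP => i; rewrite boxmonE ffunE.
Qed.

Lemma sum_mons_box (V : nmodType) N (F : mon -> V) :
  \sum_(a <- mons N) F a = \sum_(x : {ffun 'I_m -> 'I_N} | (mdeg (boxmon x) < N)%N) F (boxmon x).
Proof.
rewrite -[RHS]big_filter -[RHS](big_map (@boxmon N) predT F).
apply: perm_big; apply: uniq_perm; first exact: mons_uniq.
  by rewrite map_inj_uniq ?filter_uniq ?index_enum_uniq//; exact: boxmon_inj.
move=> a; rewrite mem_mons; apply/idP/mapP => [aN|[x]].
  have [x ax] := boxmon_ex aN; exists x => //.
  by rewrite mem_filter -ax aN mem_index_enum.
by rewrite mem_filter => /andP[+ _] ->.
Qed.

Lemma sum_box_half N :
  \sum_(x : {ffun 'I_m -> 'I_N}) (2^-1 : R) ^+ mdeg (boxmon x) <= 2 ^+ m.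
Proof.
have -> : \sum_(x : {ffun 'I_m -> 'I_N}) (2^-1 : R) ^+ mdeg (boxmon x) =
    \prod_(i < m) \sum_(k < N) (2^-1 : R) ^+ k.
  rewrite bigA_distr_bigA; apply: eq_bigr => x _.
  by rewrite mdegE -prodrXr; apply: eq_bigr => i _; rewrite boxmonE.
apply: (@le_trans _ _ (\prod_(i < m) (2 : R))); last by rewrite prodr_const card_ord.
apply: ler_prod => i _; rewrite sumr_ge0 => [|k _]; last by rewrite exprn_ge0 ?invr_ge0.
have := subrX1 (2^-1 : R) N; have : 0 <= (2^-1 : R) ^+ N by rewrite exprn_ge0 ?invr_ge0.
move=> h0 h1 /=; lra.
Qed.

Lemma prod_diff_le (I : Type) (s : seq I) (F G : I -> C) (e : R) :
  0 <= e -> (forall i, cnorm (F i) <= 2) -> (forall i, cnorm (G i) <= 2) ->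
  (forall i, cnorm (F i - G i) <= e) ->
  cnorm (\prod_(i <- s) F i - \prod_(i <- s) G i) <= (size s)%:R * 2 ^+ size s * e.
Proof.
move=> e0 F2 G2 FG; elim: s => [|i s ih].
  by rewrite !big_nil subrr rnorm0 !mul0r.
rewrite !big_cons (_ : _ - _ = (F i - G i) * (\prod_(j <- s) F j) +
   G i * (\prod_(j <- s) F j - \prod_(j <- s) G j)); last by ring.
apply: le_trans (ler_rnormD _ _) _; rewrite !rnormM.
have P2 : cnorm (\prod_(j <- s) F j) <= 2 ^+ size s.
  elim: (s) => [|j s' ih']; first by rewrite big_nil rnorm1.
  by rewrite big_cons /= exprS rnormM; apply: ler_pM; rewrite ?rnorm_ge0.
have h1 := ler_pM (rnorm_ge0 _) (rnorm_ge0 _) (FG i) P2.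
have h2 := ler_pM (rnorm_ge0 _) (rnorm_ge0 _) (G2 i) ih.
apply: le_trans (lerD h1 h2) _ => /=; rewrite exprS -natr1.
set q := 2 ^+ size s; have q0 : 0 <= q * e by rewrite mulr_ge0// exprn_ge0.
lra.
Qed.

Lemma geometric_remainder (x : C) (t : R) N : cnorm x <= t -> t <= 2^-1 ->
  cnorm ((1 - x)^-1 - \sum_(k < N) x ^+ k) <= 2 * t ^+ N.
Proof.
move=> xt t2.
have x1 : 2^-1 <= cnorm (1 - x).
  by have := ler_rnormD (1 - x) x; rewrite subrK rnorm1; lra.
have n0 : 1 - x != 0.
  by apply/eqP => h; move: x1; rewrite h rnorm0; lra.
have -> : (1 - x)^-1 - \sum_(k < N) x ^+ k = x ^+ N / (1 - x).
  apply: (mulfI n0); rewrite mulrBr mulfV// [RHS]mulrCA mulfV// mulr1.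
  by rewrite -[X in X * \sum_(_ < _) _]opprB mulNr -subrX1; ring.
rewrite rnormM rnormV rnormX mulrC; apply: ler_pM.
- by rewrite invr_ge0 rnorm_ge0.
- by rewrite exprn_ge0// rnorm_ge0.
- rewrite -[leRHS]invrK lef_pV2 ?posrE ?invr_gt0//.
  by apply: lt_le_trans x1; rewrite invr_gt0.
- by apply: lerXn2r; rewrite ?nnegrE ?rnorm_ge0// (le_trans (rnorm_ge0 x)).
Qed.

Lemma geometric_sum_le (x : C) N : cnorm x <= 2^-1 -> cnorm (\sum_(k < N) x ^+ k) <= 2.
Proof.
move=> x2; apply: le_trans (ler_rnorm_sum _ _ _) _.
apply: (@le_trans _ _ (\sum_(k < N) (2^-1 : R) ^+ k)).
  by apply: ler_sum => k _; rewrite rnormX; apply: lerXn2r; rewrite ?nnegrE ?rnorm_ge0 ?invr_ge0.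
have := subrX1 (2^-1 : R) N; have : 0 <= (2^-1 : R) ^+ N by rewrite exprn_ge0 ?invr_ge0.
move=> h0 h1 /=; lra.
Qed.

(** The coefficients are the torus means of [f(z) / z ^ a], which gives Cauchy's estimates. The
    remainder is the mean of [f] times the kernel minus its truncation. For [|w| <= r / 2] each
    quotient [w_j / z_j] has norm at most [1 / 2], so the factors of both products are at most 2, as
    [prod_diff_le] requires. *)
Lemma polydisc_expansion (f : 'rV[C]_m -> C) (r B : R) : 0 < r ->
  (forall z, rnorm z <= r -> differentiable f z) ->
  (forall z, rnorm z <= r -> cnorm (f z) <= B) ->
  exists c : mon -> C, (forall a, cnorm (c a) <= B / r ^+ mdeg a) /\
    forall N w, rnorm w <= r / 2 ->
      cnorm (f w - \sum_(x : {ffun 'I_m -> 'I_N}) zmon w (boxmon x) * c (boxmon x)) <=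
      B * (m%:R * 2 ^+ m * (2 * (rnorm w / r) ^+ N)).
Proof.
move=> r0 df fB.
have [LIM [LD LZ LB LL]] := @exists_ultralimit R.
pose s := enum 'I_m.
have B0 : 0 <= B by apply: le_trans (fB 0 _); rewrite ?rnorm_ge0// rnorm0 ltW.
pose T (F : 'rV[C]_m -> C) w := torus_mean LIM r s F w.
have onT w z : on_torus r s w z -> forall j, cnorm (z ord0 j) = r.
  by move=> h j; have := h j; rewrite mem_enum.
have onTr w z : on_torus r s w z -> rnorm z <= r.
  by move=> /onT h; apply/row_rnormP => [|j]; rewrite ?h// ltW.
pose c a := T (fun z => f z * (zmon z a)^-1) 0.
have zb a w : forall z, on_torus r s w z -> cnorm (f z * (zmon z a)^-1) <= B / r ^+ mdeg a.
  move=> z zT; rewrite rnormM rnormV (rnorm_zmon_torus a (onT _ _ zT)).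
  by rewrite ler_wpM2r ?invr_ge0 ?exprn_ge0 ?(ltW r0)// fB// (onTr _ _ zT).
exists c; split=> [a|N w wr].
  by apply: torus_mean_bound => // z; exact: zb.
have wr' : rnorm w < r by lra.
have cE a : c a = T (fun z => f z * (zmon z a)^-1) w.
  by apply: torus_mean_base => // k; rewrite mem_enum.
pose S (z : 'rV[C]_m) : C := \sum_(x : {ffun 'I_m -> 'I_N}) zmon w (boxmon x) * (zmon z (boxmon x))^-1.
have -> : \sum_(x : {ffun 'I_m -> 'I_N}) zmon w (boxmon x) * c (boxmon x) = T (fun z => f z * S z) w.
  rewrite (_ : (fun z => f z * S z) = fun z => \sum_(x : {ffun 'I_m -> 'I_N})
     zmon w (boxmon x) * (f z * (zmon z (boxmon x))^-1)); last first.
    by apply/funext => z; rewrite /S mulr_sumr; apply: eq_bigr => x _; rewrite mulrCA.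
  set I := index_enum _; elim: I => [|x I ih].
    rewrite big_nil; apply/esym/rnorm_le0/torus_mean_bound => // z _.
    by rewrite big_nil rnorm0.
  rewrite big_cons ih cE /T -(torus_meanZ LZ LB r0)//; last by exists (B / r ^+ mdeg (boxmon x)); exact: zb.
  rewrite -(torus_meanD LD LB r0)//.
  - by congr torus_mean; apply/funext => z; rewrite big_cons.
  - exists (cnorm (zmon w (boxmon x)) * (B / r ^+ mdeg (boxmon x))) => z zT.
    by rewrite rnormM ler_wpM2l ?rnorm_ge0 ?(zb _ w).
  - exists (\sum_(y <- I) cnorm (zmon w (boxmon y)) * (B / r ^+ mdeg (boxmon y))) => z zT.
    apply: le_trans (ler_rnorm_sum _ _ _) _; apply: ler_sum => y _.
    by rewrite rnormM ler_wpM2l ?rnorm_ge0 ?(zb _ w).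
have ker z : on_torus r s w z -> cnorm (kernel_bound s w z - S z) <= m%:R * 2 ^+ m * (2 * (rnorm w / r) ^+ N).
  move=> zT; have zr := onT _ _ zT.
  have zn0 j : z ord0 j != 0.
    by apply/eqP => h; have := zr j; rewrite h rnorm0 => h0; move: r0; rewrite h0 ltxx.
  have t2 : rnorm w / r <= 2^-1 by rewrite ler_pdivrMr// mulrC.
  have xt j : cnorm (w ord0 j / z ord0 j) <= rnorm w / r.
    by rewrite rnormM rnormV zr ler_wpM2r ?invr_ge0 ?(ltW r0)// row_coord_le.
  have kE : kernel_bound s w z = \prod_(j <- s) (1 - w ord0 j / z ord0 j)^-1.
    apply: eq_bigr => j _; rewrite -[in RHS](mulfV (zn0 j)) -mulrBl invfM invrK mulrC.
    by [].
  have SE : S z = \prod_(j <- s) \sum_(k < N) (w ord0 j / z ord0 j) ^+ k.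
    rewrite big_enum /= bigA_distr_bigA; apply: eq_bigr => x _.
    rewrite /zmon -prodfV -big_split; apply: eq_bigr => j _ /=.
    by rewrite boxmonE exprMn exprVn.
  rewrite kE SE.
  have ss : size s = m by rewrite size_enum_ord.
  rewrite (_ : m%:R * 2 ^+ m = (size s)%:R * 2 ^+ size s); last by rewrite ss.
  apply: prod_diff_le.
  - by rewrite mulr_ge0// exprn_ge0// divr_ge0 ?rnorm_ge0// ltW.
  - move=> j; rewrite rnormV -[leRHS]invrK lef_pV2 ?posrE ?invr_gt0//.
      by have := ler_rnormD (1 - w ord0 j / z ord0 j) (w ord0 j / z ord0 j); rewrite subrK rnorm1; have := xt j; lra.
    by have := ler_rnormD (1 - w ord0 j / z ord0 j) (w ord0 j / z ord0 j); rewrite subrK rnorm1; have := xt j; lra.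
  - by move=> j; apply: geometric_sum_le; exact: le_trans (xt j) t2.
  - by move=> j; exact: geometric_remainder.
have <- : T (fun z => f z * kernel_bound s w z) w = f w.
  by apply: (torus_mean_cauchy LZ LB LL r0 (B := B)) => //; [exact: enum_uniq|exact: ltW].
have bK : bounded_torus r s w (fun z => f z * (kernel_bound s w z - S z)).
  exists (B * (m%:R * 2 ^+ m * (2 * (rnorm w / r) ^+ N))) => z zT.
  by rewrite rnormM; apply: ler_pM; rewrite ?rnorm_ge0 ?ker// fB// (onTr _ _ zT).
have bS : bounded_torus r s w (fun z => f z * S z).
  exists (B * \sum_(x : {ffun 'I_m -> 'I_N}) cnorm (zmon w (boxmon x)) * (r ^+ mdeg (boxmon x))^-1) => z zT.
  rewrite rnormM; apply: ler_pM; rewrite ?rnorm_ge0 ?fB ?(onTr _ _ zT)//.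
  apply: le_trans (ler_rnorm_sum _ _ _) _; apply: ler_sum => y _.
  by rewrite rnormM rnormV (rnorm_zmon_torus _ (onT _ _ zT)).
have -> : T (fun z => f z * kernel_bound s w z) w =
   T (fun z => f z * (kernel_bound s w z - S z)) w + T (fun z => f z * S z) w.
  rewrite /T -(torus_meanD LD LB r0)//.
  by congr torus_mean; apply/funext => z; rewrite mulrBr subrK.
rewrite addrK; apply: torus_mean_bound => // z zT.
by rewrite rnormM; apply: ler_pM; rewrite ?rnorm_ge0 ?ker// fB// (onTr _ _ zT).
Qed.

End Monomials.

Lemma ge_minl (R : realDomainType) (x y : R) : Num.min x y <= x.
Proof. by rewrite ge_min lexx. Qed.

Lemma ge_minr (R : realDomainType) (x y : R) : Num.min x y <= y.
Proof. by rewrite ge_min lexx orbT. Qed.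

Section MonomialSums.
Variable m : nat.
Local Notation mon := (multinom m).
Implicit Types (a b : mon).

Lemma perm_mons_filter N N' (P : pred mon) :
  (forall a, P a -> (mdeg a < N)%N = (mdeg a < N')%N) ->
  perm_eq [seq a <- mons m N | P a] [seq a <- mons m N' | P a].
Proof.
move=> h; apply: uniq_perm; rewrite ?filter_uniq ?mons_uniq// => a.
by rewrite !mem_filter !mem_mons; case Pa: (P a) => //=; exact: h.
Qed.

Lemma eq_sum_mons (V : nmodType) N N' (P : pred mon) (F : mon -> V) :
  (forall a, P a -> (mdeg a < N)%N = (mdeg a < N')%N) ->
  \sum_(a <- mons m N | P a) F a = \sum_(a <- mons m N' | P a) F a.
Proof.
by move=> h; rewrite -!(big_filter _ P); apply: perm_big; exact: perm_mons_filter.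
Qed.

Lemma sum_mons_split (V : nmodType) N N' (F : mon -> V) : (N <= N')%N ->
  \sum_(a <- mons m N') F a =
  \sum_(a <- mons m N) F a + \sum_(a <- mons m N' | (N <= mdeg a)%N) F a.
Proof.
move=> NN'; rewrite (bigID (fun a => (mdeg a < N)%N)) /=; congr (_ + _).
  rewrite (@eq_sum_mons _ N' N); last by move=> a aN; rewrite aN (leq_trans aN).
  by rewrite big_seq_cond [RHS]big_seq; apply: eq_bigl => a; rewrite mem_mons andbb.
by apply: eq_bigl => a; rewrite -leqNgt.
Qed.

Lemma lem_mdeg a b : lem a b -> (mdeg a <= mdeg b)%N.
Proof. by move=> /submK <-; rewrite mdegD leq_addl. Qed.

(** The rearrangement behind Cauchy products, through [g = b + a]. The list of degree bound
    [(mdeg g).+1] contains all divisors of [g]. *)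
Lemma sum_mons_conv (V : zmodType) N (F : mon -> mon -> V) :
  \sum_(g <- mons m N) \sum_(a <- mons m (mdeg g).+1 | lem a g) F a (mnm_sub g a) =
  \sum_(a <- mons m N) \sum_(b <- mons m (N - mdeg a)) F a b.
Proof.
transitivity (\sum_(g <- mons m N) \sum_(a <- mons m N | lem a g) F a (mnm_sub g a)).
  rewrite big_seq [RHS]big_seq; apply: eq_bigr => g; rewrite mem_mons => gN.
  apply: eq_sum_mons => a ag; have := lem_mdeg ag => h.
  by rewrite ltnS h (leq_ltn_trans h gN).
rewrite (exchange_big_dep predT)//= big_seq [RHS]big_seq.
apply: eq_bigr => a; rewrite mem_mons => aN.
rewrite -(big_filter _ (fun g => lem a g)).
transitivity (\sum_(g <- [seq mnm_add b a | b <- mons m (N - mdeg a)]) F a (mnm_sub g a)).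
  apply: perm_big; apply: uniq_perm; first by rewrite filter_uniq ?mons_uniq.
    by rewrite map_inj_uniq ?mons_uniq//; move=> b b' /(congr1 (fun g => mnm_sub g a)); rewrite !addmK.
  move=> g; rewrite mem_filter mem_mons; apply/andP/mapP => [[ag gN]|[b]].
    exists (mnm_sub g a); last by rewrite submK.
    by rewrite mem_mons ltn_subRL -mdegD addmC submK.
  by rewrite mem_mons => bN ->; rewrite lem_addl mdegD addnC -ltn_subRL.
by rewrite big_map; apply: eq_bigr => b _; rewrite addmK.
Qed.

End MonomialSums.

(** * Taylor expansions with a remainder uniform in the order *)

Section Taylor.
Context {R : realType}.
Local Notation C := (complex R : numFieldType).
Local Notation cnorm := (@rnorm R C).
Variable m : nat.
Local Notation mon := (multinom m).
Variable zeta : 'rV[C]_m.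
Implicit Types (a b : mon) (z w : 'rV[C]_m).

Section Defs.
Variable W : normedModType C.

Definition psum (c : mon -> W) N z : W := \sum_(a <- mons m N) zmon z a *: c a.

Definition growth (r B : R) (c : mon -> W) :=
  forall N, \sum_(a <- mons m N) rnorm (c a) * r ^+ mdeg a <= B.

(** A single [B] serves all orders [N]. Letting [N] grow at fixed [z] gives convergence and hence
    [taylor_eq]; letting [z] tend to [0] at fixed [N] gives uniqueness of the coefficients. *)
Definition expands (r B : R) (f : 'rV[C]_m -> W) (c : mon -> W) :=
  growth r B c /\ forall N z, rnorm z <= r ->
    rnorm (f (zeta + z) - psum c N z) <= B * (rnorm z / r) ^+ N.

Definition taylor (f : 'rV[C]_m -> W) (c : mon -> W) :=
  exists r B : R, 0 < r /\ expands r B f c.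

Lemma growth_ge0 r B c : growth r B c -> 0 <= B.
Proof.
move=> /(_ 0%N); rewrite big_seq big1// => a; by rewrite mem_mons.
Qed.

Lemma growth_shrink r r' B B' c : 0 <= r' -> r' <= r -> B <= B' ->
  growth r B c -> growth r' B' c.
Proof.
move=> r0 rr BB h N; apply: le_trans (le_trans (h N) BB); apply: ler_sum => a _.
by apply: ler_wpM2l; [exact: rnorm_ge0|apply: lerXn2r; rewrite ?nnegrE// (le_trans r0)].
Qed.

Lemma expands_shrink r r' B B' f c : 0 < r' -> r' <= r -> B <= B' ->
  expands r B f c -> expands r' B' f c.
Proof.
move=> r0 rr BB [gc h]; split; first exact: growth_shrink (ltW r0) rr BB gc.
move=> N z zr; apply: le_trans (h N z (le_trans zr rr)) _; apply: ler_pM => //.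
- exact: growth_ge0 gc.
- by rewrite exprn_ge0// divr_ge0 ?rnorm_ge0// (le_trans (ltW r0)).
- apply: lerXn2r; rewrite ?nnegrE ?divr_ge0 ?rnorm_ge0 ?(ltW r0) ?(le_trans (ltW r0))//.
  by rewrite ler_wpM2l ?rnorm_ge0// lef_pV2// posrE (lt_le_trans r0).
Qed.

Lemma taylorD f g c d : taylor f c -> taylor g d ->
  taylor (fun x => f x + g x) (fun a => c a + d a).
Proof.
move=> [r1 [B1 [r10 h1]]] [r2 [B2 [r20 h2]]].
have r0 : 0 < Num.min r1 r2 by rewrite lt_min r10.
have [g1 {}h1] := expands_shrink r0 (ge_minl _ _) (lexx _) h1.
have [g2 {}h2] := expands_shrink r0 (ge_minr _ _) (lexx _) h2.
exists (Num.min r1 r2), (B1 + B2); split=> //; split=> [N|N z zr].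
  apply: le_trans (lerD (g1 N) (g2 N)); rewrite -big_split; apply: ler_sum => a _ /=.
  by rewrite -mulrDl ler_wpM2r ?exprn_ge0 ?(ltW r0)// ler_rnormD.
have -> : psum (fun a => c a + d a) N z = psum c N z + psum d N z.
  by rewrite /psum -big_split; apply: eq_bigr => a _; rewrite scalerDr.
rewrite opprD addrACA mulrDl; apply: le_trans (ler_rnormD _ _) _.
by apply: lerD; [exact: h1|exact: h2].
Qed.

Lemma taylor_eq f g c : taylor f c -> taylor g c -> \forall x \near zeta, f x = g x.
Proof.
move=> [r1 [B1 [r10 h1]]] [r2 [B2 [r20 h2]]].
have r0 : 0 < Num.min r1 r2 by rewrite lt_min r10.
have [g1 {}h1] := expands_shrink r0 (ge_minl _ _) (lexx _) h1.
have [g2 {}h2] := expands_shrink r0 (ge_minr _ _) (lexx _) h2.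
set r := Num.min r1 r2 in r0 g1 h1 g2 h2.
apply/near_rnormP; exists (r / 2); first by rewrite divr_gt0.
move=> x xr; apply/subr0_eq/rnorm_le0; apply/ler_addgt0Pr => e e0; rewrite add0r.
have B10 := growth_ge0 g1; have B20 := growth_ge0 g2.
have B0 : 0 < B1 + B2 + 1 by lra.
have [N hN] := half_expr_lt (divr_gt0 e0 B0).
have xr' : rnorm (x - zeta) <= r by lra.
have := h1 N _ xr'; have := h2 N _ xr'; rewrite subrKC.
set P := psum _ _ _; move=> k2 k1.
have := ler_rdistD P (f x) (g x); rewrite (rnormB P).
have tN : (rnorm (x - zeta) / r) ^+ N <= 2^-1 ^+ N.
  apply: lerXn2r; rewrite ?nnegrE ?divr_ge0 ?invr_ge0 ?rnorm_ge0 ?(ltW r0)//.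
  by rewrite ler_pdivrMr// mulrC ltW.
have q1 := ler_wpM2l B10 tN; have q2 := ler_wpM2l B20 tN.
move: hN; rewrite ltr_pdivlMr//.
have : 0 <= 2^-1 ^+ N :> R by rewrite exprn_ge0// invr_ge0.
lra.
Qed.

Lemma taylor_near f g c : (\forall x \near zeta, f x = g x) -> taylor f c -> taylor g c.
Proof.
move=> /near_rnormP[d d0 fg] [r [B [r0 h]]].
have r'0 : 0 < Num.min r (d / 2) by rewrite lt_min r0 divr_gt0.
have [gc {}h] := expands_shrink r'0 (ge_minl _ _) (lexx _) h.
exists (Num.min r (d / 2)), B; split=> //; split=> // N z zr.
rewrite -fg; first exact: h.
rewrite addrC addKr; apply: le_lt_trans zr _; rewrite gt_min; apply/orP; right; lra.
Qed.

Lemma taylor_cst (v : W) : taylor (cst v) (fun a => if a == @mnm0 m then v else 0).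
Proof.
have s0 N (F : mon -> W) : F (@mnm0 m) = v -> (forall a, a != @mnm0 m -> F a = 0) ->
    \sum_(a <- mons m N.+1) F a = v.
  move=> F0 Fa; rewrite (big_rem (@mnm0 m)) ?mem_mons ?mdeg0//= F0 big_seq big1 ?addr0// => a.
  by rewrite mem_rem_uniq ?mons_uniq// inE => /andP[/Fa].
have m0 N : (0 < N)%N -> @mnm0 m \in mons m N by rewrite mem_mons mdeg0.
exists 1, (rnorm v); split=> //; split=> [[|N]|[|N] z zr].
- by rewrite big_seq big1 ?rnorm_ge0// => a; rewrite mem_mons.
- rewrite (big_rem (@mnm0 m)) ?mem_mons ?mdeg0//= eqxx mulr1 big_seq big1 ?addr0// => a.
  by rewrite mem_rem_uniq ?mons_uniq// inE => /andP[/negbTE -> _]; rewrite rnorm0 mul0r.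
- rewrite /psum big_seq big1; last by move=> a; rewrite mem_mons.
  by rewrite subr0 expr0 mulr1.
- rewrite /psum s0 ?subrr ?rnorm0 ?mulr_ge0 ?exprn_ge0 ?divr_ge0 ?rnorm_ge0//.
    rewrite eqxx /zmon big1 ?scale1r// => j _; by rewrite mnm0E expr0.
  by move=> a /negbTE ->; rewrite scaler0.
Qed.

End Defs.

Definition conv (W : normedModType C) (A : mon -> C) (c : mon -> W) (g : mon) : W :=
  \sum_(a <- mons m (mdeg g).+1 | lem a g) A a *: c (mnm_sub g a).

Lemma taylorM (W : normedModType C) (f : 'rV[C]_m -> C) (g : 'rV[C]_m -> W) A c :
  taylor f A -> taylor g c -> taylor (fun x => f x *: g x) (conv A c).
Proof.
move=> [r1 [B1 [r10 h1]]] [r2 [B2 [r20 h2]]].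
have r0 : 0 < Num.min r1 r2 by rewrite lt_min r10.
have [g1 {}h1] := expands_shrink r0 (ge_minl _ _) (lexx _) h1.
have [g2 {}h2] := expands_shrink r0 (ge_minr _ _) (lexx _) h2.
set r := Num.min r1 r2 in r0 g1 h1 g2 h2.
have B10 := growth_ge0 g1; have B20 := growth_ge0 g2.
exists r, (2 * (B1 * B2)); split=> //; split=> [N|N z zr].
  apply: (@le_trans _ _ (\sum_(a <- mons m N) \sum_(b <- mons m (N - mdeg a))
      (cnorm (A a) * r ^+ mdeg a) * (rnorm (c b) * r ^+ mdeg b))).
    rewrite -(sum_mons_conv N (fun a b => (cnorm (A a) * r ^+ mdeg a) * (rnorm (c b) * r ^+ mdeg b))).
    apply: ler_sum => gm _; rewrite /conv.
    apply: (@le_trans _ _ ((\sum_(a <- mons m (mdeg gm).+1 | lem a gm)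
        rnorm (A a *: c (mnm_sub gm a))) * r ^+ mdeg gm)).
      by rewrite ler_wpM2r ?exprn_ge0 ?(ltW r0)// ler_rnorm_sum.
    rewrite mulr_suml; apply: ler_sum => a ag.
    have e : r ^+ mdeg gm = r ^+ mdeg (mnm_sub gm a) * r ^+ mdeg a by rewrite -exprD -mdegD submK.
    by rewrite rnormZ e le_eqVlt; apply/orP; left; apply/eqP; ring.
  apply: (@le_trans _ _ (\sum_(a <- mons m N) (cnorm (A a) * r ^+ mdeg a) * B2)).
    apply: ler_sum => a _; rewrite -mulr_sumr ler_wpM2l//.
    by rewrite mulr_ge0 ?rnorm_ge0 ?exprn_ge0 ?(ltW r0).
  rewrite -mulr_suml; apply: (@le_trans _ _ (B1 * B2)); first exact: (ler_wpM2r B20 (g1 N)).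
  by have := mulr_ge0 B10 B20; lra.
have rn0 : r != 0 by rewrite gt_eqF.
set t := rnorm z / r.
have t0 : 0 <= t by rewrite divr_ge0 ?rnorm_ge0 ?(ltW r0).
have -> : psum (conv A c) N z =
   \sum_(a <- mons m N) (zmon z a * A a) *: psum c (N - mdeg a) z.
  rewrite /psum; under [RHS]eq_bigr do rewrite scaler_sumr.
  rewrite -(sum_mons_conv N (fun a b => (zmon z a * A a) *: (zmon z b *: c b))).
  apply: eq_bigr => gm _; rewrite /conv scaler_sumr; apply: eq_bigr => a ag.
  have e : zmon z gm = zmon z (mnm_sub gm a) * zmon z a by rewrite -zmonD submK.
  by rewrite e !scalerA; congr (_ *: _); ring.
(* The truncation order of [g] depends on [a]: the monomial contributes [t ^ mdeg a] and the
   remainder [t ^ (N - mdeg a)]. The two summands are each at most [B1 * B2 * t ^ N], whence the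
   constant 2. *)
have -> : f (zeta + z) *: g (zeta + z) -
    \sum_(a <- mons m N) (zmon z a * A a) *: psum c (N - mdeg a) z =
  (f (zeta + z) - psum A N z) *: g (zeta + z) +
  \sum_(a <- mons m N) (zmon z a * A a) *: (g (zeta + z) - psum c (N - mdeg a) z).
  under [X in _ = _ + X]eq_bigr do rewrite scalerBr.
  rewrite sumrB addrA; congr (_ - _); rewrite -scaler_suml -scalerDl.
  by congr (_ *: _); rewrite /psum /GRing.scale /= subrK.
apply: le_trans (ler_rnormD _ _) _; rewrite -mulrA mulr_natl mulr2n; apply: lerD.
  rewrite rnormZ mulrAC; apply: ler_pM; rewrite ?rnorm_ge0//; first exact: h1.
  by have := h2 0%N z zr; rewrite expr0 mulr1 /psum big_seq big1 ?subr0// => a; rewrite mem_mons.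
apply: le_trans (ler_rnorm_sum _ _ _) _.
apply: (@le_trans _ _ (\sum_(a <- mons m N) (cnorm (A a) * r ^+ mdeg a) * (B2 * t ^+ N))).
  rewrite big_seq [leRHS]big_seq; apply: ler_sum => a; rewrite mem_mons => aN.
  rewrite rnormZ rnormM (mulrC (cnorm (zmon z a))).
  have zt : cnorm (zmon z a) <= r ^+ mdeg a * t ^+ mdeg a.
    have rt : r * t = rnorm z by rewrite /t mulrC divfK.
    by rewrite -exprMn; apply: rnorm_zmon_le; rewrite rt// rnorm_ge0.
  have := h2 (N - mdeg a)%N z zr; rewrite -/t => k2.
  rewrite -(subnKC (ltnW aN)) exprD -!mulrA ler_wpM2l ?rnorm_ge0//.
  have := ler_pM (rnorm_ge0 _) (rnorm_ge0 _) zt k2; rewrite subnKC ?(ltnW aN)// => k3.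
  by apply: le_trans k3 _; rewrite le_eqVlt; apply/orP; left; apply/eqP; ring.
rewrite -mulr_suml mulrA ler_wpM2r ?exprn_ge0//; exact: (ler_wpM2r B20 (g1 N)).
Qed.

End Taylor.

(** * Integer weights and uniqueness of the coefficients *)

Section Weight.
Variable m : nat.
Local Notation mon := (multinom m).
Implicit Types (a d : mon).

(* A weight vector compatible with the degree lexicographic order in degrees less
   than [b]. *)
Definition weight (b : nat) a : nat := (b ^ m.+1 * mdeg a + \sum_(j < m) b ^ (m - j) * a j)%N.

Lemma weightD b a d : weight b (mnm_add a d) = (weight b a + weight b d)%N.
Proof.
rewrite /weight mdegD mulnDr addnACA; congr (_ + _)%N.
by rewrite -big_split; apply: eq_bigr => j _; rewrite mnmDE mulnDr.
Qed.

Lemma weight_ge b a : (0 < b)%N -> (mdeg a <= weight b a)%N.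
Proof.
move=> b0; apply: leq_trans (leq_addr _ _); rewrite leq_pmull// expn_gt0 b0//.
Qed.

Lemma weight_le b a : (0 < b)%N -> (weight b a <= 2 * b ^ m.+1 * mdeg a)%N.
Proof.
move=> b0; rewrite /weight mul2n -addnn mulnDl leq_add2l mdegE big_distrr /=.
apply: leq_sum => j _; rewrite leq_mul2r; apply/orP; right.
by rewrite leq_pexp2l// (leq_trans (leq_subr _ _)).
Qed.

(** The exponents act as digits in base [b], below the degree as highest digit. Only [a] is bounded:
    by [tail], its places after the deciding one are worth less than one unit there. *)
Lemma weight_lt b a d : (mdeg a < b)%N -> (a < d)%O -> (weight b a < weight b d)%N.
Proof.
move=> ab ad; have b0 : (0 < b)%N by apply: leq_ltn_trans ab.
have tail (P : pred 'I_m) k : (forall j : 'I_m, P j -> (m - j <= k)%N) ->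
    (\sum_(j < m | P j) b ^ (m - j) * a j < b ^ k.+1)%N.
  move=> hk; apply: (@leq_ltn_trans (b ^ k * mdeg a)).
    rewrite mdegE big_distrr [leqRHS](bigID P) /=.
    apply: leq_trans (leq_addr _ _); apply: leq_sum => j /hk jk.
    by rewrite leq_mul2r leq_pexp2l ?orbT.
  by rewrite expnSr ltn_mul2l expn_gt0 b0.
have := lemc_mdeg (ltW ad); rewrite leq_eqVlt => /orP[/eqP e|lt]; last first.
  apply: (@leq_trans (b ^ m.+1 * mdeg d)); last exact: leq_addr.
  apply: (@leq_trans (b ^ m.+1 * (mdeg a).+1)); last by rewrite leq_mul2l lt orbT.
  by rewrite mulnS [X in (_ <= X)%N]addnC ltn_add2l; apply: (tail predT) => j _; exact: leq_subr.
rewrite /weight e ltn_add2l.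
have /ltmcP := ad => /(_ e)[i ij ai].
have head (x : mon) : (\sum_(j < m) b ^ (m - j) * x j)%N =
    (\sum_(j < m | (j < i)%N) b ^ (m - j) * x j + (b ^ (m - i) * x i +
     \sum_(j < m | (i < j)%N) b ^ (m - j) * x j))%N.
  rewrite (bigID (fun j : 'I_m => (j < i)%N)) /=; congr addn.
  rewrite (bigD1 i) ?ltnn//=; congr addn; apply: eq_bigl => j.
  by rewrite -leqNgt [RHS]ltn_neqAle andbC eq_sym.
rewrite !head (eq_bigr (fun j : 'I_m => b ^ (m - j) * d j)%N); last by move=> j /ij ->.
rewrite ltn_add2l; apply: (@leq_trans (b ^ (m - i) * (a i).+1)); last first.
  by apply: leq_trans (leq_addr _ _); rewrite leq_mul2l ai orbT.
rewrite mulnS [X in (_ <= X)%N]addnC ltn_add2l.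
have -> : (m - i = (m - i.+1).+1)%N by rewrite subnSK.
by apply: tail => j ij'; exact: leq_sub2l.
Qed.

End Weight.

Section Uniqueness.
Context {R : realType}.
Local Notation C := (complex R : numFieldType).
Variable m : nat.
Local Notation mon := (multinom m).
Variable zeta : 'rV[C]_m.
Implicit Types (a b : mon) (z w : 'rV[C]_m).

(* Along this curve the monomials become distinct powers of [s], so that the first
   nonzero coefficient dominates as [s] tends to [0]. *)
Definition curve (b : nat) (s : R) : 'rV[C]_m :=
  \row_j (s ^+ (b ^ m.+1 + b ^ (m - j)))%:C%C.

Lemma zmon_curve (b : nat) (s : R) a : zmon (curve b s) a = (s ^+ weight b a)%:C%C.
Proof.
rewrite /zmon /weight mdegE big_distrr -big_split /= -prodrXr.
rewrite rmorph_prod; apply: eq_bigr => j _.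
by rewrite mxE -mulnDl mulnC exprM exprAC !rmorphXn.
Qed.

Lemma curve_norm (b : nat) (s : R) : (0 < b)%N -> 0 <= s -> s <= 1 -> rnorm (curve b s) <= s.
Proof.
move=> b0 s0 s1; apply/row_rnormP => // j; rewrite mxE rnorm_real ger0_norm ?exprn_ge0//.
have : (0 < b ^ m.+1 + b ^ (m - j))%N by rewrite addn_gt0 expn_gt0 b0.
by case: (_ + _)%N => // k _; rewrite exprS ler_piMr// exprn_ile1.
Qed.

Lemma taylor0_uniq (W : normedModType C) (c : mon -> W) :
  taylor zeta (cst 0) c -> forall a, c a = 0.
Proof.
move=> [r [B [r0 [gc h]]]].
apply: contrapT => /existsNP[a0 /eqP ca0].
have [a ca amin] : exists2 a : mon, c a != 0 & forall b, (b < a)%O -> c b = 0.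
  move: ca0; elim/(well_founded_induction (@ltom_wf m)): a0 => a ih ca.
  have [[b ba cb]|nb] := pselect (exists2 b : mon, (b < a)%O & c b != 0).
    exact: ih ba cb.
  exists a => // b ba; apply: contrapT => /eqP cb; apply: nb; by exists b.
(* Along the curve, the monomials after [a] and the remainder of order [N] are both [O(s ^ N)], one
   power of [s] better than the term of [a]. *)
pose b := (mdeg a).+1; pose N := (weight b a).+1.
pose S := \sum_(d <- mons m N) rnorm (c d).
have S0 : 0 <= S by apply: sumr_ge0 => d _; exact: rnorm_ge0.
have B0 := growth_ge0 gc.
pose K := S + B / r ^+ N.
have K0 : 0 <= K by rewrite addr_ge0// divr_ge0// exprn_ge0// ltW.
have aN : a \in mons m N by rewrite mem_mons ltnS weight_ge.
have key s : 0 < s -> s <= 1 -> s <= r -> rnorm (c a) <= s * K.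
  move=> s0 s1 sr.
  have zr := curve_norm (ltn0Sn (mdeg a)) (ltW s0) s1.
  have := h N (curve b s) (le_trans zr sr); rewrite sub0r rnormN.
  rewrite /psum (big_rem a)//= zmon_curve.
  set X := _ *: c a; set Y := \sum_(_ <- _) _ => XY.
  have YS : rnorm Y <= s ^+ N * S.
    apply: le_trans (ler_rnorm_sum _ _ _) _.
    have SE : S = rnorm (c a) + \sum_(y <- rem a (mons m N)) rnorm (c y) by rewrite /S (big_rem a).
    rewrite SE mulrDr.
    apply: (@le_trans _ _ (s ^+ N * \sum_(y <- rem a (mons m N)) rnorm (c y))); last first.
      by rewrite lerDr mulr_ge0 ?exprn_ge0 ?rnorm_ge0// ltW.
    rewrite mulr_sumr big_seq [leRHS]big_seq; apply: ler_sum => d.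
    rewrite mem_rem_uniq ?mons_uniq// inE => /andP[da _].
    rewrite rnormZ zmon_curve rnorm_real ger0_norm ?exprn_ge0 ?(ltW s0)//.
    have [ad|ad|e] := ltgtP a d; last by rewrite e eqxx in da.
      by rewrite ler_wpM2r ?rnorm_ge0// ler_wiXn2l ?(ltW s0)// weight_lt.
    by rewrite amin// rnorm0 !mulr0.
  have Xs : rnorm X = s ^+ weight b a * rnorm (c a).
    by rewrite /X rnormZ rnorm_real ger0_norm// exprn_ge0// ltW.
  have rB : B * (rnorm (curve b s) / r) ^+ N <= s ^+ N * (B / r ^+ N).
    rewrite mulrCA exprMn exprVn ler_wpM2l// ler_wpM2r ?invr_ge0 ?exprn_ge0 ?(ltW r0)//.
    by apply: lerXn2r; rewrite ?nnegrE ?rnorm_ge0// ltW.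
  have sN : 0 < s ^+ weight b a by rewrite exprn_gt0.
  have : s ^+ weight b a * rnorm (c a) <= s ^+ weight b a * (s * K).
    have := ler_rnormD (X + Y) (- Y); rewrite addrK rnormN Xs.
    have -> : s ^+ weight b a * (s * K) = s ^+ N * S + s ^+ N * (B / r ^+ N).
      by rewrite /N exprS /K; ring.
    lra.
  by rewrite ler_pM2l.
have : rnorm (c a) <= 0.
  apply/ler_addgt0Pr => e e0; rewrite add0r.
  have K1 : 0 < K + 1 by rewrite ltr_wpDl.
  pose s := Num.min (Num.min 1 r) (e / (K + 1)).
  have s0 : 0 < s by rewrite !lt_min ltr01 r0 divr_gt0.
  have s1 : s <= 1 by rewrite !ge_min lexx.
  have sr : s <= r by rewrite !ge_min lexx !orbT.
  apply: le_trans (key s s0 s1 sr) _.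
  have : s <= e / (K + 1) by rewrite !ge_min lexx !orbT.
  rewrite ler_pdivlMr// => h'; apply: le_trans h'.
  by rewrite ler_wpM2l ?(ltW s0)// lerDl.
by move=> /rnorm_le0 ca'; rewrite ca' eqxx in ca.
Qed.

Lemma taylorN (W : normedModType C) (f : 'rV[C]_m -> W) c :
  taylor zeta f c -> taylor zeta (fun x => - f x) (fun a => - c a).
Proof.
move=> [r [B [r0 [gc h]]]]; exists r, B; split=> //; split=> [N|N z zr].
  by under eq_bigr do rewrite rnormN.
rewrite (_ : psum _ N z = - psum c N z) -?opprD ?rnormN; first exact: h.
by rewrite /psum -sumrN; apply: eq_bigr => a _; rewrite scalerN.
Qed.

Lemma taylor_uniq (W : normedModType C) (f : 'rV[C]_m -> W) c d :
  taylor zeta f c -> taylor zeta f d -> c = d.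
Proof.
move=> fc fd; apply/funext => a; apply/subr0_eq.
apply: (taylor0_uniq (c := fun a => c a - d a)).
have := taylorD fc (taylorN fd).
by rewrite (_ : (fun x => f x - f x) = cst 0)//; apply/funext => x; rewrite subrr.
Qed.

End Uniqueness.

(** * Completeness and series indexed by monomials *)

Section Complete.
Context {R : realType}.
Local Notation C := (complex R : numFieldType).
Local Notation cnorm := (@rnorm R C).

Definition seq_lim (W : normedModType C) (u : nat -> W) (l : W) :=
  forall e : R, 0 < e -> exists N, forall n, (N <= n)%N -> rnorm (u n - l) <= e.

Definition seq_complete (W : normedModType C) := forall u : nat -> W,
  (forall e : R, 0 < e -> exists N, forall n, (N <= n)%N -> rnorm (u n - u N) <= e) ->
  exists l, seq_lim u l.

Lemma complete_seq_complete (W : completeNormedModType C) : seq_complete W.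
Proof.
move=> u cu.
have cvu : cvg (u @ \oo).
  apply: cauchy_cvg; apply: cauchy_exP => e e0.
  have [d d0 ->] := pos_complex e0.
  have [N hN] := cu _ (divr_gt0 d0 (ltr0n R 2)).
  exists (u N); exists N => // n Nn /=; rewrite -ball_normE /= distrC rnormrlt.
  by have := hN _ Nn; lra.
exists (lim (u @ \oo)) => e e0.
have := cvu; rewrite /= => /cvgrPdist_le /(_ (e%:C%C)).
rewrite ltr0c => /(_ e0) [N _ hN]; exists N => n Nn.
by rewrite -rnormrle distrC; exact: hN.
Qed.

(** A Cauchy sequence is bounded, and its ultralimit is its limit. *)
Lemma scalar_seq_complete : @seq_complete C.
Proof.
move=> u cu.
have [U [FU Uoo]] := @ultraFilterLemma nat \oo _.
have [B uB] : exists B : R, forall n, cnorm (u n) <= B.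
  have [N hN] := cu 1 ltr01.
  exists (\sum_(i < N) cnorm (u i) + (cnorm (u N) + 1)) => n.
  have s0 : 0 <= \sum_(i < N) cnorm (u i) by apply: sumr_ge0 => i _; exact: rnorm_ge0.
  have [nN|/hN h] := ltnP n N.
    rewrite (bigD1 (Ordinal nN)) //= -addrA lerDl addr_ge0//; last by rewrite addr_ge0 ?rnorm_ge0.
    by apply: sumr_ge0 => i _; exact: rnorm_ge0.
  by have := ler_rnormD (u n - u N) (u N); rewrite subrK; lra.
have [a aP] := @ultralimit_real R U (fun n => complex.Re (u n)) B FU
  (fun n => le_trans (Re_rnorm _) (uB n)).
have [b bP] := @ultralimit_real R U (fun n => complex.Im (u n)) B FU
  (fun n => le_trans (Im_rnorm _) (uB n)).
exists (a +i* b)%C => e e0.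
have e40 : 0 < e / 4 by rewrite divr_gt0.
have [N hN] := cu _ e40.
have UN : U [set n | (N <= n)%N] by apply: Uoo; exists N.
have [k [/= Nk [h1 h2]]] := filter_ex (filterI UN (filterI (aP _ e40) (bP _ e40))).
exists N => n Nn.
have := ler_rdistD (u N) (u n) (a +i* b)%C; have := ler_rdistD (u k) (u N) (a +i* b)%C.
have := hN _ Nn; have := hN _ Nk; rewrite (rnormB (u k)).
have : cnorm (u k - (a +i* b)%C) <= e / 2.
  apply: le_trans (rnorm_ReIm _) _; move: h1 h2; case: (u k) => x y /=; lra.
lra.
Qed.

Lemma row_seq_complete n : @seq_complete 'rV[C]_n.
Proof.
move=> u cu.
have ul (k : 'I_n) : exists l, seq_lim (fun i => u i ord0 k : C) l.
  apply: scalar_seq_complete => e e0; have [N hN] := cu e e0; exists N => i Ni.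
  by apply: le_trans (hN i Ni); have := row_coord_le (u i - u N) k; rewrite !mxE.
have [l lP] := choice ul.
exists (\row_k l k) => e e0.
have [N hN] := choice (fun k => lP k e e0).
exists (\max_k N k) => i Ni; apply/row_rnormP => [|k]; first exact: ltW.
rewrite !mxE; apply: hN; apply: leq_trans Ni; exact: leq_bigmax.
Qed.

End Complete.

Section MonSeries.
Context {R : realType}.
Local Notation C := (complex R : numFieldType).
Local Notation cnorm := (@rnorm R C).
Variable m : nat.
Local Notation mon := (multinom m).
Variable W : normedModType C.
Implicit Types (v : mon -> W).

Definition mon_sum v l := seq_lim (fun N => \sum_(a <- mons m N) v a) l.

Lemma mon_sum_bound v l (B : R) : mon_sum v l ->
  (forall N, rnorm (\sum_(a <- mons m N) v a) <= B) -> rnorm l <= B.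
Proof.
move=> vl vB; apply/ler_addgt0Pr => e e0; have [N hN] := vl e e0.
have := hN N (leqnn N); have := vB N; rewrite rnormB.
set S := \sum_(_ <- _) _ => h1 h2.
by have := ler_rnormD (l - S) S; rewrite subrK; lra.
Qed.

Lemma mon_sumD v v' l l' : mon_sum v l -> mon_sum v' l' ->
  mon_sum (fun a => v a + v' a) (l + l').
Proof.
move=> h h' e e0; have e20 : 0 < e / 2 by rewrite divr_gt0.
have [N hN] := h _ e20; have [N' hN'] := h' _ e20.
exists (maxn N N') => n; rewrite geq_max => /andP[/hN k /hN' k'].
rewrite big_split opprD addrACA; apply: le_trans (ler_rnormD _ _) _; lra.
Qed.

Lemma mon_sumZ v l (t : C) : mon_sum v l -> mon_sum (fun a => t *: v a) (t *: l).
Proof.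
move=> h e e0; have t1 : 0 < cnorm t + 1 by rewrite ltr_wpDl ?rnorm_ge0.
have [N hN] := h _ (divr_gt0 e0 t1); exists N => n /hN.
rewrite ler_pdivlMr// => k; rewrite -scaler_sumr -scalerBr rnormZ mulrC.
by apply: le_trans k; rewrite ler_wpM2l ?rnorm_ge0// lerDl.
Qed.

Lemma mon_sumB v v' l l' : mon_sum v l -> mon_sum v' l' ->
  mon_sum (fun a => v a - v' a) (l - l').
Proof.
move=> h h'; have := mon_sumD h (mon_sumZ (-1) h'); rewrite scaleN1r.
by under eq_fun do rewrite scaleN1r.
Qed.

Lemma mon_sum_uniq v l l' : mon_sum v l -> mon_sum v l' -> l = l'.
Proof.
move=> h h'; apply/subr0_eq/rnorm_le0; apply: (mon_sum_bound (mon_sumB h h')) => N.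
by rewrite big1 ?rnorm0// => a _; rewrite subrr.
Qed.

Lemma mon_sum_finite v N :
  mon_sum (fun a => if (mdeg a < N)%N then v a else 0) (\sum_(a <- mons m N) v a).
Proof.
move=> e e0; exists N => n Nn; rewrite -big_mkcond /=.
rewrite (@eq_sum_mons _ _ n N); last by move=> a aN; rewrite aN (leq_trans aN).
rewrite [X in X - _](_ : _ = \sum_(a <- mons m N) v a) ?subrr ?rnorm0 ?ltW//.
by rewrite big_seq_cond [RHS]big_seq; apply: eq_bigl => a; rewrite mem_mons andbb.
Qed.

(** The tail beyond [N] is at most the supremum of the partial sums of [g] minus the [N]-th one. *)
Lemma mon_sum_ex v (g : mon -> R) (B : R) : seq_complete W ->
  (forall a, rnorm (v a) <= g a) -> (forall N, \sum_(a <- mons m N) g a <= B) ->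
  exists l, mon_sum v l.
Proof.
move=> cW vg gB; apply: cW => e e0.
have g0 a : 0 <= g a by apply: le_trans (vg a); exact: rnorm_ge0.
pose S N := \sum_(a <- mons m N) g a.
have bS : has_sup (range S).
  by split; [exists (S 0%N), 0%N|exists B => _ [N _ <-]; exact: gB].
have [_ [N _ <-] hN] := sup_adherent e0 bS.
exists N => n Nn; rewrite (sum_mons_split _ Nn) addrAC subrr add0r.
apply: le_trans (ler_rnorm_sum _ _ _) _.
apply: (@le_trans _ _ (\sum_(a <- mons m n | (N <= mdeg a)%N) g a)); first exact: ler_sum.
have : S n <= sup (range S) by apply: ub_le_sup; [exact: bS.2|exists n].
by rewrite /S (sum_mons_split _ Nn) -/(S N); lra.
Qed.

End MonSeries.

(** * Convergent power series define holomorphic germs *)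

Section Realize.
Context {R : realType}.
Local Notation C := (complex R : numFieldType).
Local Notation cnorm := (@rnorm R C).
Variable m : nat.
Local Notation mon := (multinom m).
Implicit Types (a b : mon) (z h : 'rV[C]_m).

(** The passage from [p] to the radius [p + q] absorbs the powers of the degree that differentiation
    costs, so the estimates are uniform in [a] and can be summed against [growth]. Induction removes
    one variable at a time by Leibniz's rule. *)
Lemma zmon_differential z a : exists D : 'rV[C]_m -> C,
  (forall t h h', D (t *: h + h') = t * D h + D h') /\
  forall p q : R, rnorm z <= p -> 0 < q ->
    (forall h, cnorm (D h) <= rnorm h / q * (p + q) ^+ mdeg a) /\
    forall h, rnorm h <= q ->
      cnorm (zmon (z + h) a - zmon z a) <= rnorm h / q * (p + q) ^+ mdeg a /\
      cnorm (zmon (z + h) a - zmon z a - D h) <= (rnorm h / q) ^+ 2 * (p + q) ^+ mdeg a.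
Proof.
move: {2}(mdeg a) (erefl (mdeg a)) => d; elim: d a => [|d ih] a ad.
  have -> : a = @mnm0 m by apply/eqP; rewrite -mdeg_eq0 ad.
  exists (fun=> 0); split=> [t h h'|p q zp q0]; first by rewrite mulr0 addr0.
  have z1 w : zmon w (@mnm0 m) = 1 by rewrite /zmon big1// => j _; rewrite mnm0E expr0.
  rewrite mdeg0 expr0; split=> [h|h hq].
    by rewrite rnorm0 mulr1 divr_ge0 ?rnorm_ge0// ltW.
  rewrite !z1 !subrr ?subr0 !rnorm0 !mulr1; split; last exact: sqr_ge0.
  by rewrite divr_ge0 ?rnorm_ge0// ltW.
have [i ai] : exists i, a i != 0%N.
  apply: contrapT => /forallNP na; move: ad; rewrite mdegE big1// => i _.
  by apply/eqP/negPn/negP; exact: na.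
have aE : a = mnm_add (mnm_sub a (mnm1 i)) (mnm1 i).
  by rewrite submK//; apply/mnm_lepP => j; rewrite mnm1E; case: eqP => // <-; rewrite lt0n.
set a' := mnm_sub a (mnm1 i) in aE.
have ad' : mdeg a' = d by move: ad; rewrite aE mdegD mdeg1 addn1 => -[].
have [D [Dlin DP]] := ih a' ad'.
have zaE w : zmon w a = w ord0 i * zmon w a'.
  rewrite aE zmonD mulrC; congr (_ * _); rewrite /zmon (bigD1 i)//= mnm1E eqxx expr1.
  by rewrite big1 ?mulr1// => j ji; rewrite mnm1E eq_sym (negbTE ji) expr0.
exists (fun h => h ord0 i * zmon z a' + z ord0 i * D h); split=> [t h h'|p q zp q0].
  by rewrite Dlin !mxE; ring.
have [D1 D2] := DP p q zp q0.
have p0 : 0 <= p by apply: le_trans zp; exact: rnorm_ge0.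
rewrite ad exprS; rewrite ad' in D1 D2.
set P := (p + q) ^+ d in D1 D2 *.
have P0 : 0 <= P by rewrite exprn_ge0// addr_ge0// ltW.
have zi : cnorm (z ord0 i) <= p by apply: le_trans (row_coord_le _ _) zp.
have hi h : cnorm (h ord0 i) <= rnorm h / q * q by rewrite divfK ?gt_eqF// row_coord_le.
have sq h : 0 <= rnorm h / q by rewrite divr_ge0 ?rnorm_ge0// ltW.
split=> h.
  apply: le_trans (ler_rnormD _ _) _; rewrite !rnormM.
  have zP : cnorm (zmon z a') <= P.
    apply: le_trans (rnorm_zmon_le _ p0 zp) _; rewrite ad'.
    by apply: lerXn2r; rewrite ?nnegrE ?addr_ge0 ?(ltW q0)// lerDl ltW.
  have h1 := ler_pM (rnorm_ge0 _) (rnorm_ge0 _) (hi h) zP.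
  have h2 := ler_pM (rnorm_ge0 _) (rnorm_ge0 _) zi (D1 h).
  lra.
move=> hq; have [k1 k2] := D2 h hq.
have zP : cnorm (zmon (z + h) a') <= P.
  rewrite /P -ad'; apply: rnorm_zmon_le; first by rewrite addr_ge0// ltW.
  by apply: le_trans (ler_rnormD _ _) _; exact: lerD.
rewrite !zaE; split.
  rewrite (_ : _ - _ = h ord0 i * zmon (z + h) a' + z ord0 i * (zmon (z + h) a' - zmon z a')); last first.
    by rewrite !mxE; ring.
  apply: le_trans (ler_rnormD _ _) _; rewrite !rnormM.
  have h1 := ler_pM (rnorm_ge0 _) (rnorm_ge0 _) (hi h) zP.
  have h2 := ler_pM (rnorm_ge0 _) (rnorm_ge0 _) zi k1.
  lra.
rewrite (_ : _ - _ - _ = z ord0 i * (zmon (z + h) a' - zmon z a' - D h) +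
   h ord0 i * (zmon (z + h) a' - zmon z a')); last first.
  by rewrite !mxE; ring.
apply: le_trans (ler_rnormD _ _) _; rewrite !rnormM.
have h1 := ler_pM (rnorm_ge0 _) (rnorm_ge0 _) (hi h) k1.
have h2 := ler_pM (rnorm_ge0 _) (rnorm_ge0 _) zi k2.
rewrite expr2 in h2 *; lra.
Qed.

Variable zeta : 'rV[C]_m.

Lemma growth_realize (W : normedModType C) (c : mon -> W) (r B : R) :
  seq_complete W -> 0 < r -> growth r B c ->
  exists f : 'rV[C]_m -> W, holo_at zeta f /\ taylor zeta f c.
Proof.
move=> cW r0 gc; have B0 := growth_ge0 gc.
have Fex z : exists l, rnorm z <= r -> mon_sum (fun a => zmon z a *: c a) l.
  have [zr|] := pselect (rnorm z <= r); last by exists 0.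
  have [|l lP] := @mon_sum_ex R m W (fun a => zmon z a *: c a) (fun a => rnorm (c a) * r ^+ mdeg a) B cW _ gc.
    by move=> a; rewrite rnormZ mulrC ler_wpM2l ?rnorm_ge0// rnorm_zmon_le// ltW.
  by exists l.
have [F FP] := choice Fex.
exists (fun x => F (x - zeta)); split; last first.
  exists r, B; split=> //; split=> // N z zr; rewrite (_ : zeta + z - zeta = z); last by rewrite addrAC subrr add0r.
  have t0 : 0 <= rnorm z / r by rewrite divr_ge0 ?rnorm_ge0// ltW.
  have t1 : rnorm z / r <= 1 by rewrite ler_pdivrMr// mul1r.
  apply: (mon_sum_bound (mon_sumB (FP z zr) (@mon_sum_finite R m W (fun a => zmon z a *: c a) N))) => k.
  apply: le_trans (ler_rnorm_sum _ _ _) _.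
  apply: (@le_trans _ _ (\sum_(a <- mons m k) rnorm (c a) * r ^+ mdeg a * (rnorm z / r) ^+ N)); last first.
    by rewrite -mulr_suml ler_wpM2r ?exprn_ge0.
  apply: ler_sum => a _; case: ltnP => [aN|Na].
    by rewrite subrr rnorm0 !mulr_ge0 ?rnorm_ge0 ?exprn_ge0// ltW.
  rewrite subr0 rnormZ mulrC -mulrA ler_wpM2l ?rnorm_ge0//.
  apply: le_trans (rnorm_zmon_le _ (rnorm_ge0 z) (lexx _)) _.
  have zE : rnorm z = r * (rnorm z / r) by rewrite mulrC divfK// gt_eqF.
  rewrite [in leLHS]zE exprMn ler_wpM2l ?exprn_ge0 ?(ltW r0)//.
  exact: ler_wiXn2l.
have q0 : 0 < r / 2 by rewrite divr_gt0.
apply/near_rnormP; exists (r / 2) => // x xr; set z := x - zeta in xr.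
(* Used with [p = q = r / 2], so that [p + q] is the radius [r] of the growth bound. *)
have [D DP] := choice (zmon_differential z).
have rr : r / 2 + r / 2 = r by field.
have D1 a h : cnorm (D a h) <= rnorm h / (r / 2) * r ^+ mdeg a.
  by have [_ /(_ _ _ (ltW xr) q0)[+ _]] := DP a; rewrite rr; exact.
have D2 a h : rnorm h <= r / 2 ->
    cnorm (zmon (z + h) a - zmon z a - D a h) <= (rnorm h / (r / 2)) ^+ 2 * r ^+ mdeg a.
  by move=> hr; have [_ /(_ _ _ (ltW xr) q0)[_ /(_ _ hr)[_]]] := DP a; rewrite rr.
have cg (v : mon -> C) (K : R) : 0 <= K -> (forall a, cnorm (v a) <= K * r ^+ mdeg a) ->
    forall a, rnorm (v a *: c a) <= K * (rnorm (c a) * r ^+ mdeg a).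
  by move=> K0 vK a; rewrite rnormZ mulrC mulrCA ler_wpM2l ?rnorm_ge0.
have cgB (K : R) : 0 <= K -> forall N, \sum_(a <- mons m N) K * (rnorm (c a) * r ^+ mdeg a) <= K * B.
  by move=> K0 N; rewrite -mulr_sumr ler_wpM2l.
have hq h : 0 <= rnorm h / (r / 2) by rewrite divr_ge0 ?rnorm_ge0// ltW.
have Lex h : exists l, mon_sum (fun a => D a h *: c a) l.
  apply: (mon_sum_ex cW (cg _ _ (hq h) (fun a => D1 a h))); exact: cgB.
have [L LP] := choice Lex.
have Llin : linear L.
  move=> t h h'; apply: (mon_sum_uniq (LP _)).
  have := mon_sumD (mon_sumZ t (LP h)) (LP h'); congr mon_sum; apply/funext => a.
  by have [-> _] := DP a; rewrite scalerDl scalerA.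
pose L' : {linear 'rV[C]_m -> W} :=
  HB.pack L (GRing.isLinear.Build C 'rV[C]_m W _ L Llin).
apply: (@rnorm_differentiable R _ W _ x L' (B / (r / 2)) (B / (r / 2) ^+ 2) (r / 2) q0).
  move=> h; apply: (mon_sum_bound (LP h)) => N.
  apply: le_trans (ler_rnorm_sum _ _ _) _.
  apply: (@le_trans _ _ (rnorm h / (r / 2) * B)); last by rewrite le_eqVlt; apply/orP; left; apply/eqP; ring.
  by apply: le_trans (cgB _ (hq h) N); apply: ler_sum => a _; exact: (cg (fun a => D a h) _ (hq h) (fun b => D1 b h)).
move=> h hr; rewrite /= (_ : x + h - zeta = z + h); last by rewrite /z addrAC.
have zr : rnorm z <= r by lra.
have zhr : rnorm (z + h) <= r by apply: le_trans (ler_rnormD _ _) _; lra.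
apply: (mon_sum_bound (mon_sumB (mon_sumB (FP _ zhr) (FP _ zr)) (LP h))) => N.
apply: le_trans (ler_rnorm_sum _ _ _) _.
apply: (@le_trans _ _ ((rnorm h / (r / 2)) ^+ 2 * B)); last first.
  by rewrite le_eqVlt; apply/orP; left; apply/eqP; field; rewrite gt_eqF.
have hq2 := sqr_ge0 (rnorm h / (r / 2)).
apply: le_trans (cgB _ hq2 N); apply: ler_sum => a _.
rewrite -!scalerBl; apply: (cg (fun a => zmon (z + h) a - zmon z a - D a h)) => // b.
by apply: D2; exact: ltW.
Qed.

End Realize.

(** * Taylor expansion of holomorphic functions *)

Section HoloTaylor.
Context {R : realType}.
Local Notation C := (complex R : numFieldType).
Local Notation cnorm := (@rnorm R C).
Variables (m : nat) (zeta : 'rV[C]_m).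

Lemma holo_taylor_scalar (f : 'rV[C]_m -> C) : holo_at zeta f -> exists c, taylor zeta f c.
Proof.
move=> /near_rnormP[d d0 df].
have [e e0 fe] : exists2 e : R, 0 < e & forall x, rnorm (x - zeta) < e -> cnorm (f x - f zeta) < 1.
  have fc : {for zeta, continuous f}.
    by apply: differentiable_continuous; apply: df; rewrite subrr rnorm0.
  apply/(@near_rnormP R _ zeta (fun x => cnorm (f x - f zeta) < 1)).
  by apply: (fc [set y | cnorm (y - f zeta) < 1]);
    apply: (@near_rnormP R C (f zeta) (fun y => cnorm (y - f zeta) < 1)).2; exists 1.
pose r := Num.min d e / 2.
have r0 : 0 < r by rewrite divr_gt0// lt_min d0.
have rd : r < d by rewrite /r; have := ge_minl d e; lra.
have re : r < e by rewrite /r; have := ge_minr d e; lra.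
pose B := cnorm (f zeta) + 1.
have B0 : 0 <= B by rewrite addr_ge0 ?rnorm_ge0.
have sh z : zeta + z - zeta = z by rewrite addrAC subrr add0r.
have [||c [cB cE]] := @polydisc_expansion R m (fun z => f (zeta + z)) r B r0.
- move=> z zr.
  have dsh : differentiable (cst zeta + (id : 'rV[C]_m -> 'rV[C]_m)) z.
    by apply: differentiableD; [exact: differentiable_cst|exact: ex_diff].
  apply: (differentiable_comp dsh); apply: df.
  by rewrite (sh z); apply: le_lt_trans rd.
- move=> z zr; have := fe (zeta + z); rewrite sh => /(_ (le_lt_trans zr re)) h.
  by have := ler_rnormD (f (zeta + z) - f zeta) (f zeta); rewrite subrK /B; lra.
have r20 : 0 < r / 2 by rewrite divr_gt0.
have box N : \sum_(x : {ffun 'I_m -> 'I_N}) cnorm (c (boxmon x)) * (r / 2) ^+ mdeg (boxmon x) <= B * 2 ^+ m.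
  apply: (@le_trans _ _ (\sum_(x : {ffun 'I_m -> 'I_N}) B * 2^-1 ^+ mdeg (boxmon x))).
    apply: ler_sum => x _; apply: (@le_trans _ _ (B / r ^+ mdeg (boxmon x) * (r / 2) ^+ mdeg (boxmon x))).
      by rewrite ler_wpM2r ?exprn_ge0 ?(ltW r20)// cB.
    by rewrite [(r / 2) ^+ _]exprMn [leLHS]mulrA divfK// expf_neq0// gt_eqF.
  by rewrite -mulr_sumr ler_wpM2l// sum_box_half.
exists c, (r / 2), (B * (m%:R * 2 ^+ m * 2) + B * 2 ^+ m); split=> //; split=> [N|N z zr].
  rewrite sum_mons_box; apply: (@le_trans _ _ (B * 2 ^+ m)); last first.
    by rewrite lerDr !mulr_ge0// exprn_ge0.
  apply: le_trans (box N); rewrite [leRHS](bigID (fun x => mdeg (boxmon x) < N)%N) /=.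
  by rewrite lerDl sumr_ge0// => x _; rewrite mulr_ge0 ?rnorm_ge0 ?exprn_ge0// ltW.
rewrite /psum sum_mons_box.
have := cE N z zr; rewrite (bigID (fun x => mdeg (boxmon x) < N)%N) /=.
(* The box is wider than the truncation by degree: [X] is the partial sum wanted, and [Y] has only
   terms of degree at least [N], so it is absorbed in the remainder. *)
set X := \sum_(x | _) _; set Y := \sum_(x | _) _ => h.
have t0 : 0 <= rnorm z / (r / 2) by rewrite divr_ge0 ?rnorm_ge0// ltW.
have t1 : rnorm z / (r / 2) <= 1 by rewrite ler_pdivrMr// mul1r.
have YB : cnorm Y <= B * 2 ^+ m * (rnorm z / (r / 2)) ^+ N.
  apply: le_trans (ler_rnorm_sum _ _ _) _.
  apply: (@le_trans _ _ ((\sum_(x : {ffun 'I_m -> 'I_N}) cnorm (c (boxmon x)) * (r / 2) ^+ mdeg (boxmon x))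
      * (rnorm z / (r / 2)) ^+ N)); last by rewrite ler_wpM2r ?exprn_ge0.
  rewrite mulr_suml [leRHS](bigID (fun x => mdeg (boxmon x) < N)%N) /=.
  apply: (@le_trans _ _ (\sum_(x : {ffun 'I_m -> 'I_N} | ~~ (mdeg (boxmon x) < N)%N)
     cnorm (c (boxmon x)) * (r / 2) ^+ mdeg (boxmon x) * (rnorm z / (r / 2)) ^+ N)); last first.
    by rewrite lerDr sumr_ge0// => x _; rewrite !mulr_ge0 ?rnorm_ge0 ?exprn_ge0// ltW.
  apply: ler_sum => x; rewrite -leqNgt => Nx.
  rewrite rnormM mulrC -mulrA ler_wpM2l ?rnorm_ge0//.
  apply: le_trans (rnorm_zmon_le _ (rnorm_ge0 z) (lexx _)) _.
  have zE : rnorm z = r / 2 * (rnorm z / (r / 2)) by rewrite [RHS]mulrC divfK// gt_eqF.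
  rewrite [in leLHS]zE exprMn ler_wpM2l ?exprn_ge0 ?(ltW r20)//.
  exact: ler_wiXn2l.
have tt : (rnorm z / r) ^+ N <= (rnorm z / (r / 2)) ^+ N.
  have le : rnorm z / r <= rnorm z / (r / 2).
    by rewrite ler_wpM2l ?rnorm_ge0// lef_pV2 ?posrE//; lra.
  by apply: lerXn2r; rewrite ?nnegrE// divr_ge0 ?rnorm_ge0// ltW.
have q : 0 <= B * (m%:R * 2 ^+ m * 2) by rewrite !mulr_ge0// exprn_ge0.
have qt := ler_wpM2l q tt.
change (rnorm (f (zeta + z) - X) <= (B * (m%:R * 2 ^+ m * 2) + B * 2 ^+ m) * (rnorm z / (r / 2)) ^+ N).
have := ler_rnormD (f (zeta + z) - (X + Y)) Y.
rewrite (_ : f (zeta + z) - (X + Y) + Y = f (zeta + z) - X); last by rewrite opprD addrA subrK.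
lra.
Qed.

Lemma taylor_sum (W : normedModType C) (I : Type) (s : seq I) (f : I -> 'rV[C]_m -> W) :
  (forall i, exists c, taylor zeta (f i) c) ->
  exists c, taylor zeta (fun x => \sum_(i <- s) f i x) c.
Proof.
move=> h; elim: s => [|i s [c cP]].
  exists (fun=> 0); have := taylor_cst zeta (0 : W).
  rewrite (_ : (fun x => \sum_(i <- [::]) f i x) = cst 0); last by apply/funext => x; rewrite big_nil.
  by congr taylor; apply/funext => a; case: ifP.
have [d dP] := h i; exists (fun a => d a + c a).
by under eq_fun do rewrite big_cons; exact: taylorD.
Qed.

Lemma holo_taylor n (f : 'rV[C]_m -> 'rV[C]_n) : holo_at zeta f -> exists c, taylor zeta f c.
Proof.
move=> hf.
have -> : f = fun x => \sum_(k <- enum 'I_n) (f x ord0 k *: delta_mx ord0 k : 'rV[C]_n).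
  by apply/funext => x; rewrite big_enum /=; exact: row_sum_delta.
apply: taylor_sum => k.
have [|c cP] := @holo_taylor_scalar (fun x => f x ord0 k).
  apply: filterS hf => x dx.
  apply: (@differentiable_comp _ _ _ _ f (fun M : 'rV[C]_n => M ord0 k)) => //.
  exact: differentiable_coord.
exists (conv c (fun a => if a == @mnm0 m then delta_mx ord0 k else 0)).
exact: (taylorM cP (taylor_cst zeta (delta_mx ord0 k : 'rV[C]_n))).
Qed.

End HoloTaylor.

(** * Division of convergent power series *)

Section WfRec.
Variables (T A : Type) (lt : T -> T -> Prop) (a0 : A).
Hypothesis wf : well_founded lt.

(** [E] takes a total function; [a0] fills in the values that are not below [y], on which [E y] does
    not depend. *)
Lemma wf_fixpoint (E : T -> (T -> A) -> A) :
  (forall y w w', (forall x, lt x y -> w x = w' x) -> E y w = E y w') ->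
  exists w, forall y, w y = E y w.
Proof.
move=> EP.
pose F y (rec : forall x, lt x y -> A) : A :=
  E y (fun x => match pselect (lt x y) with left h => rec x h | right _ => a0 end).
exists (Fix wf (fun=> A) F) => y; rewrite Fix_eq; last first.
  move=> x f g fg; apply: EP => z zx; case: pselect => // h; exact: fg.
by apply: EP => x xy; case: pselect.
Qed.

End WfRec.

Lemma sum_sub_seq (R : realDomainType) (I : eqType) (s t : seq I) (f : I -> R) :
  uniq s -> uniq t -> {subset s <= t} -> (forall x, 0 <= f x) ->
  \sum_(x <- s) f x <= \sum_(x <- t) f x.
Proof.
move=> us ut st f0; rewrite [leRHS](bigID (fun x => x \in s)) /=.
rewrite -[X in _ <= X + _]big_filter.
have pst : perm_eq [seq x <- t | x \in s] s.
  apply: uniq_perm; [exact: filter_uniq|by []|move=> x].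
  by rewrite mem_filter; case: (boolP (x \in s)) => // /st ->.
rewrite (perm_big _ pst) /=.
by rewrite lerDl sumr_ge0.
Qed.

(** * The order on terms of free modules *)

Section TermOrder.
Variables m n : nat.
Local Notation mon := (multinom m).
Local Notation term := (mon * 'I_n)%type.
Implicit Types (x y z : term) (a b : mon).

Definition ltT x y : bool := (x.1 < y.1)%O || (x.1 == y.1) && (x.2 < y.2)%N.

Definition tshift a x : term := (mnm_add a x.1, x.2).

Lemma ltT_irr x : ltT x x = false.
Proof. by rewrite /ltT ltxx eqxx ltnn. Qed.

Lemma ltT_trans y x z : ltT x y -> ltT y z -> ltT x z.
Proof.
rewrite /ltT => /orP[h|/andP[/eqP h h']] /orP[k|/andP[/eqP k k']].
- by rewrite (lt_trans h k).
- by rewrite -k h.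
- by rewrite h k.
- by rewrite h k eqxx (ltn_trans h' k') orbT.
Qed.

Lemma ltT_total x y : [|| ltT x y, x == y | ltT y x].
Proof.
rewrite /ltT; case: x y => [a i] [b j] /=.
have [ab|ab|ab] := ltgtP a b; rewrite ?orbT//= xpair_eqE ab eqxx /=.
by have [ij|ij|/val_inj ->] := ltngtP i j; rewrite ?eqxx ?orbT.
Qed.

Lemma ltT_wf : well_founded (fun x y => ltT x y).
Proof.
move=> [a i]; elim/(well_founded_induction (@ltom_wf m)): a i => a iha i.
move: {2}(nat_of_ord i) (leqnn i) => k; elim: k i => [|k ihk] i ik; constructor => -[b j].
  rewrite /ltT /= => /orP[/iha//|/andP[/eqP -> ji]].
  by move: ik; rewrite leqn0 => /eqP i0; rewrite i0 in ji.
rewrite /ltT /= => /orP[/iha//|/andP[/eqP -> ji]]; apply: ihk.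
by rewrite -ltnS; apply: leq_trans ik.
Qed.

Lemma ltT_shift a x y : ltT (tshift a x) (tshift a y) = ltT x y.
Proof. by rewrite /ltT /= ltmc_add2r eqm_add2l. Qed.

Lemma ltT_mdeg x y : ltT x y -> (mdeg x.1 <= mdeg y.1)%N.
Proof. by move=> /orP[/ltW/lemc_mdeg//|/andP[/eqP -> _]]. Qed.

Definition terms N : seq term := [seq (a, i) | a <- mons m N, i <- enum 'I_n].

Lemma terms_uniq N : uniq (terms N).
Proof. by apply: allpairs_uniq; rewrite ?mons_uniq ?enum_uniq// => -[? ?] [? ?] _ _ [-> ->]. Qed.

Lemma mem_terms N x : (x \in terms N) = (mdeg x.1 < N)%N.
Proof.
rewrite -mem_mons; apply/allpairsP/idP => [[[a i] [/= am _ ->//]]|xm].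
by exists x; rewrite mem_enum; split=> //; case: x xm.
Qed.

Lemma sum_terms (V : nmodType) N (f : term -> V) :
  \sum_(x <- terms N) f x = \sum_(a <- mons m N) \sum_(i < n) f (a, i).
Proof. by rewrite big_allpairs; apply: eq_bigr => a _; rewrite big_enum. Qed.

(** The factor [n] leaves room for the component, which is less than [n], so that ties between
    monomials are broken as in [ltT]. *)
Definition wterm (d : nat) x : nat := (n * weight d x.1 + x.2)%N.

Lemma wterm_shift d a x : wterm d (tshift a x) = (n * weight d a + wterm d x)%N.
Proof. by rewrite /wterm /= weightD mulnDr addnA. Qed.

Lemma wterm_ge d x : (0 < d)%N -> (mdeg x.1 <= wterm d x)%N.
Proof.
move=> d0; apply: leq_trans (leq_addr _ _); apply: leq_trans (weight_ge _ d0) _.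
by rewrite leq_pmull// (leq_ltn_trans (leq0n x.2)).
Qed.

Lemma wterm_lt d x y : (mdeg x.1 < d)%N -> ltT x y -> (wterm d x < wterm d y)%N.
Proof.
move=> xd /orP[xy|/andP[/eqP xy h]]; last by rewrite /wterm xy ltn_add2l.
apply: (@leq_trans (n * weight d y.1)%N); last exact: leq_addr.
apply: (@leq_trans (n * (weight d x.1).+1)%N); last by rewrite leq_mul2l weight_lt ?orbT.
by rewrite mulnS addnC /wterm ltn_add2l.
Qed.

End TermOrder.

(** * The division theorem *)

Section Division.
Context {R : realType}.
Local Notation C := (complex R : numFieldType).
Local Notation cnorm := (@rnorm R C).
Variables (m n s : nat).
Local Notation mon := (multinom m).
Local Notation term := (mon * 'I_n)%type.
Implicit Types (x y z : term) (a b : mon).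

Definition tcoef (c : mon -> 'rV[C]_n) x : C := c x.1 ord0 x.2.

Definition is_lead (c : mon -> 'rV[C]_n) x :=
  tcoef c x != 0 /\ forall y, ltT y x -> tcoef c y = 0.

Variables (F : 'I_s -> mon -> 'rV[C]_n) (lead : 'I_s -> term).
Hypothesis F_lead : forall k, is_lead (F k) (lead k).
Hypothesis F_monic : forall k, tcoef (F k) (lead k) = 1.

Definition divides x y := (x.2 == y.2) && lem x.1 y.1.

(** Fixing one divisor for each divisible term leaves one unknown per term, hence a square
    triangular system. *)
Let sigma x : option 'I_s := [pick k | divides (lead k) x].

(* the coefficient at [y] of the multiple of some [F k] whose leading term is
   [x], or of the monomial [x] itself when no leading term divides [x] *)
Let ker x y : C :=
  if sigma x is Some k then
    let a := mnm_sub x.1 (lead k).1 in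
    if lem a y.1 then tcoef (F k) (mnm_sub y.1 a, y.2) else 0
  else (x == y)%:R.

Let sigmaP x k : sigma x = Some k -> x = tshift (mnm_sub x.1 (lead k).1) (lead k).
Proof.
rewrite /sigma; case: pickP => // k' /andP[/eqP e l] [<-].
by rewrite /tshift submK// e; case: x {e l}.
Qed.

Let ker_shift a y k x : sigma x = Some k -> a = mnm_sub x.1 (lead k).1 ->
  ker x (tshift a y) = tcoef (F k) y.
Proof.
move=> sx ->; rewrite /ker sx /= lem_addr addmC addmK; by case: y.
Qed.

Let ker_diag x : ker x x = 1.
Proof.
case sx : (sigma x) => [k|]; last by rewrite /ker sx eqxx.
by rewrite {2}(sigmaP sx) (ker_shift _ sx erefl) F_monic.
Qed.

Let ker_tri x y : ~~ ltT x y -> x != y -> ker x y = 0.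
Proof.
move=> xy xny; have yx : ltT y x by have := ltT_total x y; rewrite (negbTE xy) (negbTE xny).
case sx : (sigma x) => [k|]; last by rewrite /ker sx (negbTE xny).
pose a := mnm_sub x.1 (lead k).1.
have [ay|ay] := boolP (lem a y.1); last by rewrite /ker sx -/a (negbTE ay).
have yE : y = tshift a (mnm_sub y.1 a, y.2).
  by rewrite /tshift /= addmC submK//; case: (y).
rewrite yE (ker_shift _ sx erefl); apply: (F_lead k).2.
by move: yx; rewrite [X in ltT X _]yE [X in ltT _ X](sigmaP sx) -/a ltT_shift.
Qed.

(** The system is triangular for the well-founded [ltT], with diagonal 1 by [F_monic]. All [x] below
    [y] occur in the finite list because the order is degree compatible. *)
Lemma triangular_solution (G : term -> C) : exists w : term -> C, forall y,
  G y = \sum_(x <- terms m n (mdeg y.1).+1) w x * ker x y.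
Proof.
have [|w wP] := @wf_fixpoint term C (fun x y => ltT x y) 0 (@ltT_wf m n)
  (fun y w => G y - \sum_(x <- terms m n (mdeg y.1).+1 | ltT x y) w x * ker x y).
  by move=> y w w' ww'; congr (_ - _); apply: eq_bigr => x xy; rewrite ww'.
exists w => y; rewrite (bigID (fun x => ltT x y)) /=.
rewrite [X in _ = _ + X](_ : _ = w y); first by rewrite wP addrC subrK.
rewrite big_mkcond (big_rem y) ?mem_terms//= ltT_irr ker_diag mulr1.
rewrite big_seq big1 ?addr0// => x; rewrite mem_rem_uniq ?terms_uniq// inE => /andP[xy _].
by case: ifP => // h; rewrite (ker_tri h xy) mulr0.
Qed.

Section Bound.
Variables (u : R) (d : nat).
Hypotheses (u0 : 0 < u) (u1 : u <= 1).
(* For a small radius [u] the leading term of each [F k] dominates the others, and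
   the triangular operator [ker] is invertible for the weighted l^1 norm. *)
Hypothesis F_small : forall k N,
  \sum_(x <- terms m n N | ltT (lead k) x) cnorm (tcoef (F k) x) * u ^+ wterm d x <=
  2^-1 * u ^+ wterm d (lead k).

(** [F_small] multiplied by the monomial that carries the leading term to [x], weights being
    additive. *)
Let ker_row_bound x N :
  \sum_(y <- terms m n N | ltT x y) cnorm (ker x y) * u ^+ wterm d y <= 2^-1 * u ^+ wterm d x.
Proof.
have ux0 z : 0 <= u ^+ wterm d z by rewrite exprn_ge0// ltW.
case sx : (sigma x) => [k|]; last first.
  rewrite big1 ?mulr_ge0 ?invr_ge0// => y xy; rewrite /ker sx.
  by case: eqP xy => [->|_]; rewrite ?ltT_irr// rnorm0 mul0r.
pose a := mnm_sub x.1 (lead k).1.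
have xE : x = tshift a (lead k) by exact: sigmaP.
rewrite (bigID (fun y => lem a y.1)) /= [X in _ + X]big1 ?addr0; last first.
  by move=> y /andP[_ /negbTE ay]; rewrite /ker sx -/a ay rnorm0 mul0r.
pose g (y : term) : term := (mnm_sub y.1 a, y.2).
have gE y : lem a y.1 -> y = tshift a (g y).
  by move=> ay; rewrite /tshift /= addmC submK//; case: (y).
rewrite -big_filter; set l := seq.filter _ _.
have lP y : y \in l -> [/\ ltT x y, lem a y.1 & (mdeg y.1 < N)%N].
  by rewrite mem_filter mem_terms => /andP[/andP[-> ->] ->].
rewrite [leLHS](_ : _ = u ^+ (n * weight d a) *
    \sum_(z <- map g l) cnorm (tcoef (F k) z) * u ^+ wterm d z); last first.
  rewrite big_map mulr_sumr big_seq [RHS]big_seq; apply: eq_bigr => y /lP[_ ay _].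
  rewrite {1 2}(gE y ay) (ker_shift _ sx erefl) wterm_shift exprD.
  by rewrite mulrCA.
rewrite [X in _ * u ^+ wterm d X]xE wterm_shift exprD [leRHS]mulrCA.
rewrite ler_wpM2l ?exprn_ge0 ?(ltW u0)//; apply: le_trans (F_small k N).
rewrite -[leRHS]big_filter; apply: sum_sub_seq.
- rewrite map_inj_in_uniq ?filter_uniq ?terms_uniq// => y y' /lP[_ h _] /lP[_ h' _] e.
  by rewrite (gE _ h) e -(gE _ h').
- by rewrite filter_uniq ?terms_uniq.
- move=> _ /mapP[y /lP[xy ay yN] ->]; rewrite mem_filter mem_terms.
  have -> /= : ltT (lead k) (g y).
    by move: xy; rewrite [X in ltT X _]xE [X in ltT _ X](gE _ ay) ltT_shift.
  by rewrite /g /= (leq_ltn_trans (mdegB _ _)).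
- by move=> z; rewrite mulr_ge0 ?rnorm_ge0.
Qed.

(** Solving for the diagonal gives [S <= B + S / 2] for the partial sum [S]. This sum is finite and
    only smaller terms enter, so [S] may be subtracted with no convergence known beforehand. *)
Lemma solution_bound (G w : term -> C) (B : R) :
  (forall y, G y = \sum_(x <- terms m n (mdeg y.1).+1) w x * ker x y) ->
  (forall N, \sum_(x <- terms m n N) cnorm (G x) * u ^+ wterm d x <= B) ->
  forall N, \sum_(x <- terms m n N) cnorm (w x) * u ^+ wterm d x <= 2 * B.
Proof.
move=> Gw GB N.
have ux0 z : 0 <= u ^+ wterm d z by rewrite exprn_ge0// ltW.
set S := \sum_(x <- _) _.
suff : S <= B + 2^-1 * S by lra.
apply: (@le_trans _ _ (\sum_(y <- terms m n N) (cnorm (G y) * u ^+ wterm d y +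
   \sum_(x <- terms m n N | ltT x y) cnorm (w x) * (cnorm (ker x y) * u ^+ wterm d y)))).
  rewrite /S big_seq [leRHS]big_seq; apply: ler_sum => y; rewrite mem_terms => yN.
  under eq_bigr do rewrite mulrA; rewrite -mulr_suml -mulrDl ler_wpM2r//.
  have wE : w y = G y - \sum_(x <- terms m n N | ltT x y) w x * ker x y.
    apply/eqP; rewrite eq_sym subr_eq Gw; apply/eqP.
    rewrite (bigID (fun x => ltT x y)) /= addrC; congr (_ + _).
      rewrite big_mkcond (big_rem y) ?mem_terms//= ltT_irr ker_diag mulr1.
      rewrite big_seq big1 ?addr0// => x; rewrite mem_rem_uniq ?terms_uniq// inE => /andP[xy _].
      by case: ifP => // h; rewrite (ker_tri h xy) mulr0.
    rewrite -!(big_filter _ (fun x => ltT x y)); apply: perm_big; apply: uniq_perm.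
    - by rewrite filter_uniq ?terms_uniq.
    - by rewrite filter_uniq ?terms_uniq.
    move=> x; rewrite !mem_filter !mem_terms; case xy: (ltT x y) => //=.
    by rewrite ltnS (ltT_mdeg xy) (leq_ltn_trans (ltT_mdeg xy) yN).
  rewrite wE; apply: le_trans (ler_rnormB _ _) _; rewrite lerD2l.
  apply: le_trans (ler_rnorm_sum _ _ _) _; apply: ler_sum => x _.
  by rewrite rnormM.
rewrite big_split lerD//= (exchange_big_dep predT)//= /S mulr_sumr.
by apply: ler_sum => x _; rewrite -mulr_sumr mulrCA ler_wpM2l ?rnorm_ge0 ?ker_row_bound.
Qed.

End Bound.

Let aux (p x y q : R) : 0 <= p -> 0 <= x -> x * (2 * y + 1) <= q ->
  p * x * y <= 2^-1 * p * q.
Proof.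
move=> p0 x0 h; have := ler_wpM2l p0 h; have := mulr_ge0 p0 x0; lra.
Qed.

Lemma exists_small_radius (d : nat) (r B u2 : R) : (forall k, mdeg (lead k).1 < d)%N ->
  0 < r -> 0 < u2 -> (forall k, growth r B (F k)) ->
  exists u : R, [/\ 0 < u, u <= u2, u <= 1 & forall k N,
  \sum_(x <- terms m n N | ltT (lead k) x) cnorm (tcoef (F k) x) * u ^+ wterm d x <=
  2^-1 * u ^+ wterm d (lead k)].
Proof.
move=> ld r0 u20 gF.
pose v := Num.min 1 r; have v0 : 0 < v by rewrite lt_min ltr01.
have B0 (k : 'I_s) : 0 <= B by exact: growth_ge0 (gF k).
pose L := \max_k wterm d (lead k).
(* Terms after a leading term of weight [l] weigh at least [l + 1], so their sum is at most
   [(u / v) ^ (l + 1) * n * B]. The spare factor [u] makes this at most half of [u ^ l]; [L] serves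
   all [k] at once, as [v <= 1]. *)
pose u := Num.min (Num.min u2 v) (v ^+ L.+1 / (2 * (n%:R * `|B|) + 1)).
have D0 : 0 < 2 * (n%:R * `|B|) + 1 by rewrite ltr_wpDl// !mulr_ge0.
have uv0 : 0 < Num.min u2 v by rewrite lt_min u20.
have u0 : 0 < u by rewrite lt_min uv0 divr_gt0// exprn_gt0.
have uv : u <= v by exact: le_trans (ge_minl _ _) (ge_minr _ _).
have v1 : v <= 1 by rewrite ge_minl.
exists u; split=> //; first by exact: le_trans (ge_minl _ _) (ge_minl _ _).
  exact: le_trans uv v1.
move=> k N; have Bk := B0 k; rewrite (ger0_norm Bk) in D0 *.
set l := wterm d (lead k).
pose t := u / v; have t0 : 0 <= t by rewrite divr_ge0 ?ltW.
have t1 : t <= 1 by rewrite ler_pdivrMr// mul1r.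
have uE : u = t * v by rewrite /t divfK// gt_eqF.
have d0 : (0 < d)%N by apply: leq_ltn_trans (ld k).
apply: (@le_trans _ _ (t ^+ l.+1 * \sum_(x <- terms m n N) cnorm (tcoef (F k) x) * r ^+ mdeg x.1)).
  rewrite mulr_sumr big_mkcond; apply: ler_sum => x _.
  have x0 : 0 <= t ^+ l.+1 * (cnorm (tcoef (F k) x) * r ^+ mdeg x.1).
    by rewrite !mulr_ge0 ?rnorm_ge0 ?exprn_ge0// ltW.
  case: ifP => // lx; rewrite mulrCA ler_wpM2l ?rnorm_ge0// uE exprMn.
  apply: ler_pM; rewrite ?exprn_ge0 ?(ltW v0)//.
    by apply: ler_wiXn2l => //; exact: wterm_lt (ld k) lx.
  apply: (@le_trans _ _ (v ^+ mdeg x.1)).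
    by apply: ler_wiXn2l; rewrite ?(ltW v0)//; exact: wterm_ge.
  by apply: lerXn2r; rewrite ?nnegrE ?(ltW v0) ?(ltW r0)// ge_minr.
have h1 : \sum_(x <- terms m n N) cnorm (tcoef (F k) x) * r ^+ mdeg x.1 <= n%:R * B.
  rewrite sum_terms; apply: (@le_trans _ _ (\sum_(a <- mons m N) n%:R * (rnorm (F k a) * r ^+ mdeg a))).
    apply: ler_sum => a _; rewrite mulr_natl -[X in _ *+ X]card_ord -sumr_const.
    by apply: ler_sum => i _; rewrite ler_wpM2r ?exprn_ge0 ?(ltW r0)// row_coord_le.
  by rewrite -mulr_sumr ler_wpM2l// gF.
apply: (le_trans (ler_wpM2l (exprn_ge0 _ t0) h1)).
have lL : (l <= L)%N by exact: leq_bigmax.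
have hu : u * (2 * (n%:R * B) + 1) <= v ^+ l.+1.
  rewrite -ler_pdivlMr//; apply: (@le_trans _ _ (v ^+ L.+1 / (2 * (n%:R * B) + 1))).
    by apply: le_trans (ge_minr _ _) _; rewrite (ger0_norm Bk).
  by rewrite ler_wpM2r ?invr_ge0 ?(ltW D0)// ler_wiXn2l ?(ltW v0).
have tE : t ^+ l.+1 = u ^+ l.+1 / v ^+ l.+1 by rewrite /t exprMn exprVn.
rewrite tE mulrAC ler_pdivrMr ?exprn_gt0// exprSr.
have ul : 0 <= u ^+ l by rewrite exprn_ge0// ltW.
exact: aux ul (ltW u0) hu.
Qed.

Let quo (w : term -> C) (k : 'I_s) (a : mon) : C :=
  if sigma (tshift a (lead k)) == Some k then w (tshift a (lead k)) else 0.

Let rem (w : term -> C) (a : mon) : 'rV[C]_n :=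
  \row_j (if sigma (a, j) is None then w (a, j) else 0).

(** Terms assigned to [k] correspond to their quotients by [lead k], which turns this part of the
    triangular sum into a Cauchy product. Quotients whose product has too large a degree meet zero
    coefficients of [F k]. *)
Let quo_sum (w : term -> C) (k : 'I_s) (a : mon) (j : 'I_n) :
  \sum_(x <- terms m n (mdeg a).+1 | sigma x == Some k) w x * ker x (a, j) =
  \sum_(g <- mons m (mdeg a).+1 | lem g a) quo w k g * tcoef (F k) (mnm_sub a g, j).
Proof.
pose D := (mdeg a).+1; pose q (x : term) := mnm_sub x.1 (lead k).1.
rewrite (bigID (fun x => lem (q x) a)) /= [X in _ + X]big1 ?addr0; last first.
  by move=> x /andP[/eqP sx /negbTE qa]; rewrite /ker sx -/(q x) /= qa mulr0.
rewrite [RHS](bigID (fun g => (sigma (tshift g (lead k)) == Some k) && (mdeg (tshift g (lead k)).1 < D)%N)) /=.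
rewrite [X in _ = _ + X]big1 ?addr0; last first.
  move=> g /andP[ga]; rewrite /quo; case: eqP => sg; last by rewrite mul0r.
  rewrite /= -leqNgt mdegD => h; rewrite (F_lead k).2 ?mulr0// /ltT /= lt_mdeg_ltmc//.
  by rewrite -(ltn_add2l (mdeg g)) -mdegD addmC submK.
rewrite -[LHS]big_filter -[RHS]big_filter.
set l1 := seq.filter _ _; set l2 := seq.filter _ _.
have l2P g : (g \in l2) = [&& lem g a, sigma (tshift g (lead k)) == Some k & (mdeg (tshift g (lead k)).1 < D)%N].
  rewrite mem_filter mem_mons -!andbA; case ga: (lem g a) => //=.
  by rewrite ltnS (lem_mdeg ga) !andbT.
have sh x : sigma x = Some k -> tshift (q x) (lead k) = x by move=> /sigmaP.
have l12 : perm_eq l1 (map (fun g => tshift g (lead k)) l2).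
  apply: uniq_perm; first by rewrite filter_uniq ?terms_uniq.
    rewrite map_inj_uniq ?filter_uniq ?mons_uniq// => g g' /(congr1 (fun x => mnm_sub x.1 (lead k).1)).
    by rewrite /= !addmK.
  move=> x; rewrite mem_filter mem_terms; apply/idP/mapP.
    move=> /andP[/andP[/eqP sx qa] xD]; exists (q x); last by rewrite sh.
    by rewrite l2P qa sh// sx eqxx.
  move=> [g]; rewrite l2P => /and3P[ga sg gD] ->; rewrite sg gD /q /=.
  by rewrite addmK ga.
rewrite (perm_big _ l12) big_map big_seq [RHS]big_seq; apply: eq_bigr => g.
rewrite l2P => /and3P[ga /eqP sg gD]; rewrite /quo sg eqxx.
congr (_ * _); rewrite /ker sg /= addmK ga; by [].
Qed.

Theorem series_division (G : mon -> 'rV[C]_n) :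
  (exists r B : R, 0 < r /\ growth r B G) ->
  (forall k, exists r B : R, 0 < r /\ growth r B (F k)) ->
  exists (q : 'I_s -> mon -> C) (p : mon -> 'rV[C]_n) (r : R),
    [/\ 0 < r,
      forall k, exists B : R, growth (W := C) r B (q k),
      exists B : R, growth r B p,
      forall a, G a = \sum_(k < s) conv (q k) (F k) a + p a &
      forall k y, divides (lead k) y -> tcoef p y = 0].
Proof.
move=> [rG [B [rG0 gG]]] gF.
have [rF rFP] := choice gF; have [BF FP] := choice rFP.
(* One radius and one bound for all generators; the initial [1] covers [s = 0]. *)
pose r1 := \big[Num.min/1]_k rF k; pose B1 := \sum_k `|BF k|.
have r10 : 0 < r1.
  by rewrite /r1; elim/big_ind: _ => // [x y x0 y0|k _]; [rewrite lt_min x0|exact: (FP k).1].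
have gF1 k : growth r1 B1 (F k).
  apply: growth_shrink (FP k).2; first exact: ltW.
    rewrite /r1 (bigD1 k)//=; exact: ge_minl.
  by apply: le_trans (ler_norm _) _; rewrite /B1 (bigD1 k)//= lerDl sumr_ge0.
pose d := (\max_k mdeg (lead k).1).+1.
have ld k : (mdeg (lead k).1 < d)%N by rewrite ltnS (leq_bigmax k).
have [u [u0 urG u1 uF]] := exists_small_radius ld r10 rG0 gF1.
have [w wP] := triangular_solution (tcoef G).
have B0 := growth_ge0 gG.
have GB N : \sum_(x <- terms m n N) cnorm (tcoef G x) * u ^+ wterm d x <= n%:R * B.
  rewrite sum_terms; apply: (@le_trans _ _ (\sum_(a <- mons m N) n%:R * (rnorm (G a) * rG ^+ mdeg a))).
    apply: ler_sum => a _; rewrite mulr_natl -[X in _ *+ X]card_ord -sumr_const.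
    apply: ler_sum => i _; apply: ler_pM; rewrite ?rnorm_ge0 ?exprn_ge0 ?(ltW u0)//.
      exact: row_coord_le.
    apply: (@le_trans _ _ (u ^+ mdeg a)).
      by apply: ler_wiXn2l; rewrite ?(ltW u0)//; exact: (@wterm_ge m n d (a, i)).
    by apply: lerXn2r; rewrite ?nnegrE ?(ltW u0) ?(ltW rG0).
  by rewrite -mulr_sumr ler_wpM2l// gG.
have wB := solution_bound u0 uF wP GB.
(* Weights are at most linear in the degree, so the weighted norm at [u] controls the norm by degree
   at the radius [u ^ kap]. *)
pose kap := (n * (2 * d ^ m.+1))%N.
have kapP a : (n * weight d a <= kap * mdeg a)%N.
  by rewrite /kap -mulnA leq_mul2l weight_le ?orbT.
have ul l : 0 < u ^+ l by rewrite exprn_gt0.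
have term0 x : 0 <= cnorm (w x) * u ^+ wterm d x by rewrite mulr_ge0 ?rnorm_ge0 ?(ltW (ul _)).
exists (quo w), (rem w), (u ^+ kap); split.
- exact: ul.
- move=> k; exists ((u ^+ wterm d (lead k))^-1 * (2 * (n%:R * B))) => N.
  rewrite -ler_pdivrMl ?invr_gt0// invrK.
  apply: le_trans (wB (N + mdeg (lead k).1)%N).
  apply: (@le_trans _ _ (\sum_(x <- [seq tshift g (lead k) | g <- mons m N]) cnorm (w x) * u ^+ wterm d x)).
    rewrite [leRHS]big_map mulr_sumr; apply: ler_sum => g _.
    rewrite mulrCA; apply: ler_pM; rewrite ?rnorm_ge0 ?mulr_ge0 ?exprn_ge0 ?(ltW u0) ?(ltW (ul _))//.
      by rewrite /quo; case: ifP => // _; rewrite rnorm0 rnorm_ge0.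
    by rewrite wterm_shift -exprM mulrC -exprD ler_wiXn2l ?(ltW u0)// leq_add2r.
  apply: sum_sub_seq => //; last 1 first.
  - move=> _ /mapP[g gN ->]; rewrite mem_terms /= mdegD ltn_add2r.
    by rewrite -mem_mons.
  - rewrite map_inj_uniq ?mons_uniq// => g g' /(congr1 (fun x => mnm_sub x.1 (lead k).1)).
    by rewrite /= !addmK.
  - exact: terms_uniq.
- exists ((u ^+ n)^-1 * (2 * (n%:R * B))) => N.
  rewrite -ler_pdivrMl ?invr_gt0// invrK.
  apply: le_trans (wB N); rewrite sum_terms mulr_sumr; apply: ler_sum => a _.
  apply: (@le_trans _ _ (u ^+ n * (\sum_(i < n) cnorm (w (a, i)) * u ^+ kap ^+ mdeg a))).
    rewrite ler_wpM2l ?(ltW (ul _))// -mulr_suml ler_wpM2r ?exprn_ge0 ?(ltW u0)//.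
    apply/row_rnormP => [|j]; first by rewrite sumr_ge0// => i _; exact: rnorm_ge0.
    rewrite mxE (bigD1 j)//=; apply: (@le_trans _ _ (cnorm (w (a, j)))).
      by case: (sigma _) => [_|]; rewrite ?rnorm0 ?rnorm_ge0.
    by rewrite lerDl sumr_ge0// => i _; exact: rnorm_ge0.
  rewrite mulr_sumr; apply: ler_sum => i _; rewrite mulrCA ler_wpM2l ?rnorm_ge0//.
  rewrite -exprM -exprD ler_wiXn2l ?(ltW u0)// /wterm /= addnC.
  by apply: leq_add => //; exact: ltnW.
- move=> a; apply/rowP => j; rewrite -[LHS]/(tcoef G (a, j)) wP /= !mxE summxE.
  have split x : w x * ker x (a, j) =
      (if sigma x is None then w x * ker x (a, j) else 0) +
      \sum_(k < s) (if sigma x == Some k then w x * ker x (a, j) else 0).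
    case sx : (sigma x) => [k|]; last by rewrite big1 ?addr0.
    rewrite add0r (bigD1 k)//= eqxx big1 ?addr0// => k' kk'.
    by case: eqP => // -[e]; rewrite e eqxx in kk'.
  under eq_bigr do rewrite split; rewrite big_split /= addrC; congr (_ + _).
    rewrite exchange_big; apply: eq_bigr => k _; rewrite -big_mkcond /= quo_sum.
    rewrite /conv summxE; apply: eq_bigr => g _; by rewrite mxE.
  rewrite (big_rem (a, j)) ?mem_terms//= [X in _ + X]big_seq big1 ?addr0.
    by case: (sigma (a, j)) => // ; rewrite ker_diag mulr1.
  move=> x; rewrite mem_rem_uniq ?terms_uniq// inE => /andP[xa _].
  by case sx: (sigma x) => //; rewrite /ker sx (negbTE xa) mulr0.
- move=> k [b j] kb; rewrite /tcoef /= mxE /sigma.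
  by case: pickP => // /(_ k); rewrite kb.
Qed.

End Division.

(** * Noetherian modules and the socle *)

Lemma iterated_choice (T : Type) (P : T -> T -> Prop) (x0 : T) :
  (forall x, exists y, P x y) -> exists f : nat -> T, f 0%N = x0 /\ forall k, P (f k) (f k.+1).
Proof.
move=> h; have [g gP] := choice h.
by exists (fun k => iter k g x0); split=> // k; exact: gP.
Qed.

Section Noetherian.
Variables (A : comNzRingType) (M : lmodType A).

Definition is_submod (N : set M) := N 0 /\ forall a x y, N x -> N y -> N (a *: x + y).

Definition noetherian := forall N : nat -> set M,
  (forall k, is_submod (N k)) -> (forall k, N k `<=` N k.+1) ->
  exists k, forall l, N l `<=` N k.

Fixpoint in_span (ys : seq M) (x : M) : Prop :=
  if ys is y :: ys' then exists a x', in_span ys' x' /\ x = a *: y + x' else x = 0.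

Lemma in_span_submod ys : is_submod (in_span ys).
Proof.
elim: ys => [|y ys [z0 zl]] /=.
  by split=> // a x x' -> ->; rewrite scaler0 addr0.
split; first by exists 0, 0; rewrite scale0r addr0.
move=> a _ _ [b [x [sx ->]]] [b' [x' [sx' ->]]].
exists (a * b + b'), (a *: x + x'); split; first exact: zl.
by rewrite scalerDr scalerA addrACA scalerDl.
Qed.

Lemma in_span_cons y ys : in_span ys `<=` in_span (y :: ys).
Proof. by move=> x sx; exists 0, x; rewrite scale0r add0r. Qed.

Lemma in_span_head y ys : in_span (y :: ys) y.
Proof. by exists 1, 0; split; [exact: (in_span_submod ys).1|rewrite scale1r addr0]. Qed.

Lemma in_span_kill ys a x : (forall y, y \in ys -> a *: y = 0) -> in_span ys x -> a *: x = 0.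
Proof.
elim: ys x => [|y ys ih] x h /=; first by move=> ->; rewrite scaler0.
move=> [b [x' [sx' ->]]]; rewrite scalerDr scalerA mulrC -scalerA h ?mem_head// scaler0 add0r.
by apply: ih => // z zys; apply: h; rewrite inE zys orbT.
Qed.

End Noetherian.

Section Socle.
Variables (A : comNzRingType) (M : lmodType A) (I : set A).
Hypotheses (accA : @noetherian A A^o) (accM : noetherian M).
Hypothesis I_ideal : forall a b c, I b -> I c -> I (a * b + c).
Hypothesis I_zerodiv : forall r, I r -> exists x : M, x <> 0 /\ r *: x = 0.

Definition annihilator (x : M) : set A := [set a | a *: x = 0].

(* The annihilators in question are associated primes of [M]. *)
Definition maximal_ann (x : M) := x <> 0 /\
  forall y, y <> 0 -> annihilator x `<=` annihilator y -> annihilator y `<=` annihilator x.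

Lemma maximal_ann_ex x : x <> 0 -> exists y, maximal_ann y /\ annihilator x `<=` annihilator y.
Proof.
move=> x0; apply: contrapT => nex.
pose T := {y : M | y <> 0 /\ annihilator x `<=` annihilator y}.
have step (t : T) : exists t' : T, annihilator (sval t) `<=` annihilator (sval t') /\
    ~ (annihilator (sval t') `<=` annihilator (sval t)).
  case: t => y [y0 xy] /=; apply: contrapT => nstep; apply: nex; exists y; split=> //.
  split=> // z z0 yz; apply: contrapT => nzy; apply: nstep.
  have xz : annihilator x `<=` annihilator z by move=> a /xy /yz.
  by exists (exist _ z (conj z0 xz)).
have [f [_ fP]] := iterated_choice (exist _ x (conj x0 (fun a h => h)) : T) step.
have [||k kP] := accA (N := fun k => annihilator (sval (f k))).
- move=> k; split; first by rewrite /annihilator /= scale0r.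
  move=> a b c; rewrite /annihilator /= => hb hc.
  by rewrite scalerDl -[a *: b]/(a * b) -scalerA hb hc scaler0 addr0.
- by move=> k; have [] := fP k.
by have [_] := fP k; apply; exact: kP.
Qed.

(** [b *: y] has an annihilator containing that of [y], hence equal to it, and [a] belongs to it. *)
Lemma maximal_ann_prime y a b : maximal_ann y -> (a * b) *: y = 0 -> b *: y <> 0 -> a *: y = 0.
Proof.
move=> [y0 ymax] aby by0; apply: (ymax (b *: y) by0).
  by move=> c cy; rewrite /annihilator /= scalerA mulrC -scalerA cy scaler0.
by rewrite /annihilator /= scalerA.
Qed.

Lemma kill_list y (ys : seq M) : maximal_ann y ->
  (forall y', y' \in ys -> exists a, a *: y' = 0 /\ a *: y <> 0) ->
  exists a, (forall y', y' \in ys -> a *: y' = 0) /\ a *: y <> 0.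
Proof.
move=> my; elim: ys => [|z ys ih] h.
  by exists 1; split=> //; rewrite scale1r; exact: my.1.
have [|a [aP ay]] := ih; first by move=> y' y'ys; apply: h; rewrite inE y'ys orbT.
have [b [bz byy]] := h z (mem_head _ _).
exists (a * b); split=> [y'|/(maximal_ann_prime my)/(_ byy)//].
rewrite inE => /orP[/eqP ->|/aP ay']; first by rewrite -scalerA bz scaler0.
by rewrite mulrC -scalerA ay' scaler0.
Qed.

(** If the annihilator of some [y'] were contained in that of [y], maximality would make them equal,
    but [r] kills [y] and not [y']. So each [y'] has its own separating element, and [kill_list]
    multiplies them. *)
Lemma separate_ann y (ys : seq M) r : maximal_ann y -> (forall y', y' \in ys -> maximal_ann y') ->
  r *: y = 0 -> (forall y', y' \in ys -> r *: y' <> 0) ->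
  exists a, (forall y', y' \in ys -> a *: y' = 0) /\ a *: y <> 0.
Proof.
move=> my mys ry rys; apply: kill_list => // y' y'ys; apply: contrapT => nex.
have y'y : annihilator y' `<=` annihilator y.
  by move=> a ay'; apply: contrapT => ay; apply: nex; exists a.
by apply: (rys _ y'ys); apply: ((mys _ y'ys).2 y my.1 y'y).
Qed.

(* Prime avoidance for the finitely many associated primes listed by [ys]. *)
Lemma ann_avoidance (ys : seq M) : (forall v : M, v <> 0 -> exists2 r, I r & r *: v <> 0) -> I 0 ->
  (forall y, y \in ys -> maximal_ann y) ->
  exists2 r, I r & forall y, y \in ys -> r *: y <> 0.
Proof.
move=> nsoc I0; elim: ys => [|y ys ih] mys; first by exists 0.
have my : maximal_ann y by apply: mys; exact: mem_head.
have mys' y' : y' \in ys -> maximal_ann y' by move=> h; apply: mys; rewrite inE h orbT.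
have [r Ir rP] := ih mys'.
have [ry|ry] := pselect (r *: y = 0); last first.
  by exists r => // y'; rewrite inE => /orP[/eqP ->|/rP].
have [a [aP ay]] := separate_ann my mys' ry rP.
(* In [a * t + r], the factor [a] preserves the action of [r] on [ys], while on [y] only [a * t]
   acts, and not by zero since the annihilator of [y] is prime. *)
have [t It ty] := nsoc y my.1.
exists (a * t + r); first exact: I_ideal.
move=> y'; rewrite inE scalerDl => /orP[/eqP ->|y'ys].
  by rewrite ry addr0 => /(maximal_ann_prime my)/(_ ty).
by rewrite mulrC -scalerA aP// scaler0 add0r; exact: rP.
Qed.

(** Finiteness of the relevant primes is replaced by a finite list [ys] whose span contains every
    element with maximal annihilator. An [r] in [I] avoiding the annihilators of [ys] would still
    kill some such [y]; an element killing [ys] but not [y] then contradicts that [y] is in the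
    span. *)
Lemma socle_neq0 : I 0 -> exists v : M, v <> 0 /\ forall r, I r -> r *: v = 0.
Proof.
move=> I0; apply: contrapT => nex.
have nsoc (v : M) : v <> 0 -> exists2 r, I r & r *: v <> 0.
  move=> v0; apply: contrapT => h; apply: nex; exists v; split=> // r Ir.
  by apply: contrapT => rv; apply: h; exists r.
pose T := {ys : seq M | forall y, y \in ys -> maximal_ann y}.
have [ys mys ysP] : exists2 ys : seq M, (forall y, y \in ys -> maximal_ann y) &
    forall y, maximal_ann y -> in_span ys y.
  apply: contrapT => nys.
  have step (t : T) : exists t' : T, in_span (sval t) `<=` in_span (sval t') /\
      ~ (in_span (sval t') `<=` in_span (sval t)).
    case: t => ys mys /=; apply: contrapT => nstep; apply: nys; exists ys => // y my.
    apply: contrapT => ny; apply: nstep.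
    have mys' z : z \in y :: ys -> maximal_ann z by rewrite inE => /orP[/eqP ->|/mys].
    exists (exist _ (y :: ys) mys') => /=; split; first exact: (@in_span_cons A M y ys).
    by move=> h; apply: ny; apply: h; exact: (@in_span_head A M y ys).
  have nil_max (y : M) : y \in [::] -> maximal_ann y by [].
  have [f [_ fP]] := iterated_choice (exist _ [::] nil_max : T) step.
  have [||k kP] := accM (N := fun k => in_span (sval (f k))).
  - by move=> k; exact: in_span_submod.
  - by move=> k; have [] := fP k.
  by have [_] := fP k; apply; exact: kP.
have [r Ir rP] := ann_avoidance nsoc I0 mys.
have [x [x0 rx]] := I_zerodiv Ir.
have [y [my xy]] := maximal_ann_ex x0.
have [a [aP ay]] := separate_ann my mys (xy _ rx) rP.
by apply: ay; apply: in_span_kill (ysP y my).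
Qed.

End Socle.

(** * Dickson's lemma *)

Section Dickson.

(** [p k] is a place where [f] is minimal from [k] on; the search restarts just after each such
    place. *)
Lemma monotone_subseq (f : nat -> nat) : exists g : nat -> nat,
  (forall k, (g k < g k.+1)%N) /\ (forall k, (f (g k) <= f (g k.+1))%N).
Proof.
have h k : exists p, (k <= p)%N /\ forall q, (k <= q)%N -> (f p <= f q)%N.
  have ex : exists v, `[< exists2 p, (k <= p)%N & f p = v >].
    by exists (f k); apply/asboolP; exists k.
  case: (ex_minnP ex) => v /asboolP[p kp pv] vmin; exists p; split=> // q kq.
  by rewrite pv; apply: vmin; apply/asboolP; exists q.
have [p pP] := choice h.
pose s k := iter k (fun i => (p i).+1) 0%N.
exists (fun k => p (s k)); split=> k.
  by have [] := pP (s k.+1).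
have [_] := pP (s k); apply; have [h1 _] := pP (s k.+1).
by apply: leq_trans h1; rewrite /s /= -/(s k) leqW//; have [] := pP (s k).
Qed.

Lemma monotone_subseq_all (I : eqType) (s : seq I) (f : I -> nat -> nat) : exists g : nat -> nat,
  (forall k, (g k < g k.+1)%N) /\ (forall i k, i \in s -> (f i (g k) <= f i (g k.+1))%N).
Proof.
elim: s f => [|i s ih] f; first by exists id.
have [g [g1 g2]] := ih f.
have [h [h1 h2]] := monotone_subseq (fun k => f i (g k)).
have gm : {homo g : a b / (a < b)%N} by apply: homo_ltn => //; exact: ltn_trans.
exists (g \o h); split=> [k|j k] /=; first exact: gm.
rewrite inE => /orP[/eqP ->//|js].
have fm : {homo (fun k => f j (g k)) : a b / (a <= b)%N}.
  apply: homo_leq => [x|y x z|l]; [exact: leqnn|exact: leq_trans|exact: g2].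
by apply: fm; exact: ltnW.
Qed.

Variables m n : nat.
Local Notation term := (multinom m * 'I_n)%type.

Lemma dickson_pair (u : nat -> term) : exists i j, (i < j)%N /\ divides (u i) (u j).
Proof.
(* Having both the component and [n] minus the component grow forces the component to be constant,
   as [divides] demands. *)
pose f (o : option (option 'I_m)) k : nat :=
  match o with None => (u k).2 | Some None => (n - (u k).2)%N | Some (Some j) => (u k).1 j end.
have [g [g1 g2]] := monotone_subseq_all (enum {: option (option 'I_m)}) f.
exists (g 0%N), (g 1%N); split; first exact: g1.
have h o : (f o (g 0%N) <= f o (g 1%N))%N by apply: g2; rewrite mem_enum.
apply/andP; split; last by apply/mnm_lepP => j; exact: (h (Some (Some j))).
apply/eqP/val_inj/eqP; rewrite eqn_leq (h None) /=.
have := h (Some None); rewrite /= leq_sub2lE//; exact: ltnW.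
Qed.

Lemma dickson (S : set term) : exists l : seq term,
  (forall x, x \in l -> S x) /\ forall y, S y -> exists2 x, x \in l & divides x y.
Proof.
apply: contrapT => nex.
pose T := {l : seq term | forall x, x \in l -> S x}.
have step (t : T) : exists t' : T, exists y, sval t' = y :: sval t /\
    forall x, x \in sval t -> ~~ divides x y.
  case: t => l lS /=; apply: contrapT => nstep; apply: nex; exists l; split=> // y Sy.
  apply: contrapT => ny; apply: nstep.
  have lS' x : x \in y :: l -> S x by rewrite inE => /orP[/eqP ->|/lS].
  exists (exist _ (y :: l) lS'), y; split=> // x xl; apply/negP => xy.
  by apply: ny; exists x.
have nil_S (x : term) : x \in [::] -> S x by [].
have [f [_ fP]] := iterated_choice (exist _ [::] nil_S : T) step.
have [u uP] := choice fP.
have mem i j : (i < j)%N -> u i \in sval (f j).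
  elim: j => // j ih; rewrite ltnS leq_eqVlt => /orP[/eqP ->|/ih h].
    by have [-> _] := uP j; rewrite mem_head.
  by have [-> _] := uP j; rewrite inE h orbT.
have [i [j [ij uij]]] := dickson_pair u.
by have [_ /(_ _ (mem _ _ ij))] := uP j; rewrite uij.
Qed.

End Dickson.

(** * Standard bases and Noetherianity for germs *)

Section GermTaylor.
Context {R : realType}.
Local Notation C := (complex R : numFieldType).
Variables (m : nat) (zeta : 'rV[C]_m).
Local Notation mon := (multinom m).
Local Notation O := (germ_ring zeta).

Definition gtaylor (W : normedModType C) (g : germ zeta W) (c : mon -> W) :=
  taylor zeta (germ_repr g) c.

Lemma gtaylor_growth (W : normedModType C) (g : germ zeta W) c :
  gtaylor g c -> exists r B : R, 0 < r /\ growth r B c.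
Proof. by move=> [r [B [r0 [gc _]]]]; exists r, B. Qed.

Lemma gtaylor_uniq (W : normedModType C) (g : germ zeta W) c d :
  gtaylor g c -> gtaylor g d -> c = d.
Proof. exact: taylor_uniq. Qed.

Lemma gtaylor_inj (W : normedModType C) (g h : germ zeta W) c :
  gtaylor g c -> gtaylor h c -> g = h.
Proof. by move=> gc hc; apply: germP; exact: taylor_eq gc hc. Qed.

Lemma gtaylorD (W : normedModType C) (g h : germ zeta W) c d :
  gtaylor g c -> gtaylor h d -> gtaylor (g + h) (fun a => c a + d a).
Proof.
move=> gc hd; apply: taylor_near (taylorD gc hd).
by apply: filterS (near_germ_add g h) => x ->.
Qed.

Lemma gtaylorZ (W : normedModType C) (a : O) (g : germ zeta W) A c :
  gtaylor (W := C) a A -> gtaylor g c -> gtaylor (a *: g) (conv A c).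
Proof.
move=> aA gc; apply: taylor_near (taylorM aA gc).
by apply: filterS (near_germ_scale a g) => x ->.
Qed.

Lemma gtaylor_germ_cst (W : normedModType C) (v : W) :
  gtaylor (germ_cst zeta v) (fun a => if a == @mnm0 m then v else 0).
Proof.
apply: taylor_near (taylor_cst zeta v).
by apply: filterS (near_germ_cst zeta v) => x ->.
Qed.

Lemma gtaylor_row n (g : germ zeta 'rV[C]_n) : exists c, gtaylor g c.
Proof. by apply: holo_taylor; exact: germ_repr_holo. Qed.

Lemma gtaylor_realize (W : normedModType C) (c : mon -> W) r B :
  seq_complete W -> 0 < r -> growth r B c -> exists g : germ zeta W, gtaylor g c.
Proof.
move=> cW r0 gc; have [f [hf fc]] := growth_realize zeta cW r0 gc.
exists (germ_of hf); apply: taylor_near fc.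
by apply: filterS (germ_ofK hf) => x ->.
Qed.

Lemma gtaylor0 (W : normedModType C) : gtaylor (0 : germ zeta W) (fun=> 0).
Proof.
have := gtaylor_germ_cst (0 : W); congr gtaylor.
by apply/funext => a; case: ifP.
Qed.

Lemma gtaylorN (W : normedModType C) (g : germ zeta W) c :
  gtaylor g c -> gtaylor (- g) (fun a => - c a).
Proof.
move=> gc; apply: taylor_near (taylorN gc).
by apply: filterS (near_germ_opp g) => x ->.
Qed.

Lemma gtaylor_sum (W : normedModType C) (I : Type) (s : seq I) (g : I -> germ zeta W) c :
  (forall i, gtaylor (g i) (c i)) ->
  gtaylor (\sum_(i <- s) g i) (fun a => \sum_(i <- s) c i a).
Proof.
move=> gc; elim: s => [|i s ih].
  by rewrite big_nil; have := gtaylor0 W; congr gtaylor; apply/funext => a; rewrite big_nil.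
rewrite big_cons; have := gtaylorD (gc i) ih; congr gtaylor.
by apply/funext => a; rewrite big_cons.
Qed.

Definition delta_mon (b a : mon) : C := if a == b then 1 else 0.

Lemma gtaylor_mon_ex (b : mon) : exists g : germ zeta C, gtaylor g (delta_mon b).
Proof.
apply: (@gtaylor_realize _ (delta_mon b) 1 1 (@scalar_seq_complete R)) => // N.
under eq_bigr do rewrite expr1n mulr1.
have [bN|bN] := boolP (b \in mons m N).
  rewrite (big_rem b)//= /delta_mon eqxx rnorm1 big_seq big1 ?addr0// => a.
  by rewrite mem_rem_uniq ?mons_uniq// inE => /andP[/negbTE -> _]; rewrite rnorm0.
rewrite big_seq big1// => a aN; rewrite /delta_mon.
by case: eqP => [ab|_]; [rewrite -ab aN in bN|rewrite rnorm0].
Qed.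

Lemma conv_delta (W : normedModType C) (b : mon) (c : mon -> W) a :
  conv (delta_mon b) c a = if lem b a then c (mnm_sub a b) else 0.
Proof.
rewrite /conv; case: ifP => ba.
  rewrite -big_filter (big_rem b) /=; last first.
    by rewrite mem_filter ba mem_mons ltnS lem_mdeg.
  rewrite /delta_mon eqxx scale1r big_seq big1 ?addr0// => d.
  rewrite mem_rem_uniq ?filter_uniq ?mons_uniq// inE => /andP[/negbTE -> _].
  by rewrite scale0r.
rewrite big1// => d da; rewrite /delta_mon; case: eqP => [db|_]; last by rewrite scale0r.
by rewrite -db da in ba.
Qed.

Variable n : nat.
Local Notation G := (germ zeta 'rV[C]_n).
Local Notation term := (mon * 'I_n)%type.

Definition lead_terms (K : set G) : set term :=
  [set x | exists g c, [/\ K g, gtaylor g c & is_lead c x]].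

Lemma lead_ex (c : mon -> 'rV[C]_n) : c <> (fun=> 0) -> exists x, is_lead c x.
Proof.
move=> c0; have [x xP] : exists x : term, tcoef c x != 0.
  apply: contrapT => /forallNP h; apply: c0; apply/funext => a; apply/rowP => j.
  by rewrite mxE; apply/eqP; have /negP := h (a, j); rewrite negbK.
elim/(well_founded_induction (@ltT_wf m n)): x xP => x ih xP.
have [[y yx yP]|nex] := pselect (exists2 y, ltT y x & tcoef c y != 0); first exact: ih yx yP.
exists x; split=> // y yx; apply: contrapT => /eqP yP; apply: nex; by exists y.
Qed.

Lemma lead_terms_shift K x b : is_submod K -> lead_terms K x -> lead_terms K (tshift b x).
Proof.
move=> [K0 Kl] [g [c [Kg gc [cx cmin]]]].
have [d dP] := gtaylor_mon_ex b.
exists ((d : O) *: g), (conv (delta_mon b) c); split.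
- by rewrite -[_ *: _]addr0; exact: Kl.
- exact: gtaylorZ.
split; first by rewrite /tcoef conv_delta lem_addr /= addmC addmK.
move=> y yx; rewrite /tcoef conv_delta; case: ifP => [bY|_]; last by rewrite mxE.
apply: (cmin (mnm_sub y.1 b, y.2)).
rewrite -(ltT_shift b); move: yx; congr ltT.
by rewrite /tshift /= addmC submK//; case: (y).
Qed.

(** The [f k] form a standard basis: by Dickson's lemma their leading terms divide all those of [K],
    so a remainder with no term divisible by them avoids [lead_terms K] altogether. *)
Lemma submod_normal_form (K : set G) : is_submod K ->
  exists (s : nat) (f : 'I_s -> G), (forall k, K (f k)) /\
    forall g, exists (q : 'I_s -> O) (r : G) p,
      [/\ g = \sum_(k < s) q k *: f k + r, gtaylor r p &
          forall x, lead_terms K x -> tcoef p x = 0].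
Proof.
move=> Ksub; have [K0 Kl] := Ksub.
have [l [lK lP]] := dickson (lead_terms K).
pose s := size l.
have fex (k : 'I_s) : exists fc : G * (mon -> 'rV[C]_n), [/\ K fc.1, gtaylor fc.1 fc.2,
    is_lead fc.2 (tnth (in_tuple l) k) & tcoef fc.2 (tnth (in_tuple l) k) = 1].
  set x := tnth _ _; have [g [c [Kg gc [cx cmin]]]] : lead_terms K x.
    by apply: lK; exact: mem_tnth.
  (* Scaling by a constant germ makes the generators monic, as [series_division] requires. *)
  pose t := (tcoef c x)^-1.
  pose e : germ zeta C := germ_cst zeta (t : C).
  have ec a : conv (fun a => if a == @mnm0 m then t else 0) c a = t *: c a.
    have a0 : lem (@mnm0 m) a by apply/mnm_lepP => i; rewrite mnm0E.
    have := conv_delta (@mnm0 m) c a; rewrite a0 subm0 => <-.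
    rewrite /conv scaler_sumr; apply: eq_bigr => d _; rewrite scalerA /delta_mon.
    by case: ifP; rewrite ?mulr1 ?mulr0.
  exists ((e : O) *: g, fun a => t *: c a) => /=; split.
  - by rewrite -[_ *: _]addr0; exact: Kl.
  - have := gtaylorZ (gtaylor_germ_cst (t : C) : gtaylor (W := C) (e : O) _) gc.
    by congr gtaylor; apply/funext => a; exact: ec.
  - split=> [|y yx]; first by rewrite /tcoef mxE mulf_neq0// invr_eq0.
    by rewrite /tcoef mxE -/(tcoef c y) cmin ?mulr0.
  - by rewrite /tcoef mxE mulVf.
have [fc fcP] := choice fex.
exists s, (fun k => (fc k).1); split=> [k|g]; first by have [] := fcP k.
have [G0 gG] := gtaylor_row g.
have F_lead k : is_lead (fc k).2 (tnth (in_tuple l) k) by have [] := fcP k.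
have F_monic k : tcoef (fc k).2 (tnth (in_tuple l) k) = 1 by have [] := fcP k.
have F_growth k : exists r B : R, 0 < r /\ growth r B (fc k).2.
  by have [_ h _ _] := fcP k; exact: gtaylor_growth h.
have [q [p [r [r0 qg [B pg] GE pl]]]] := series_division F_lead F_monic (gtaylor_growth gG) F_growth.
have qex k : exists a : germ zeta C, gtaylor a (q k).
  by have [Bk qk] := qg k; apply: gtaylor_realize qk => //; exact: scalar_seq_complete.
have [Q QP] := choice qex.
have [h hp] := gtaylor_realize (@row_seq_complete R n) r0 pg.
exists Q, h, p; split=> //.
- apply: (gtaylor_inj gG).
  have := gtaylorD (gtaylor_sum (index_enum 'I_s) (fun k => gtaylorZ (QP k : gtaylor (W := C) (Q k : O) _) (let: And4 _ h _ _ := fcP k in h))) hp.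
  by congr gtaylor; apply/funext => a; rewrite GE.
- move=> x /lP[y yl yx]; have /tnthP[k yk] : y \in in_tuple l by [].
  by apply: (pl k); rewrite -yk.
Qed.

(** Leading terms detect membership. This serves both Noetherianity and the choice of the lift of
    [v]. *)
Lemma lead_normal_form (K : set G) g : is_submod K -> ~ K g ->
  exists h p x, [/\ K (g - h), gtaylor h p, is_lead p x & ~ lead_terms K x].
Proof.
move=> Ksub nKg; have [s [f [fK /(_ g)[q [r [p [gE rp pK]]]]]]] := submod_normal_form Ksub.
have sumK : K (\sum_(k < s) q k *: f k).
  elim/big_ind: _ => [|x y Kx Ky|k _]; first exact: Ksub.1.
    by rewrite -[x]scale1r; exact: Ksub.2.
  by rewrite -[_ *: _]addr0; apply: Ksub.2 => //; exact: Ksub.1.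
have p0 : p <> (fun=> 0).
  move=> p0; apply: nKg; rewrite gE (_ : r = 0) ?addr0//.
  by apply: gtaylor_inj rp _; rewrite p0; exact: gtaylor0.
have [x xP] := lead_ex p0.
exists r, p, x; split=> //; first by rewrite gE addrK.
by move=> /pK h; have := xP.1; rewrite h eqxx.
Qed.

(** The leading terms of the union are multiples of finitely many, which already occur in some
    [N k]. A later element outside [N k] would have a remainder in the union with a new leading
    term. *)
Lemma germ_noetherian : noetherian G.
Proof.
move=> N Nsub Nmono.
pose K := [set g | exists k, N k g].
have Nle k l : (k <= l)%N -> N k `<=` N l.
  move=> /subnKC <-; elim: (l - k)%N => [|d ih]; first by rewrite addn0.
  by rewrite addnS; exact: subset_trans ih (Nmono _).
have Ksub : is_submod K.
  split; first by exists 0%N; exact: (Nsub 0%N).1.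
  move=> a x y [k kx] [l ly]; exists (maxn k l); apply: (Nsub _).2.
    by apply: Nle kx; exact: leq_maxl.
  by apply: Nle ly; exact: leq_maxr.
have [l [lK lP]] := dickson (lead_terms K).
have [k kP] : exists k, forall x, x \in l -> lead_terms (N k) x.
  elim: l lK {lP} => [|x l ih] lK; first by exists 0%N.
  have [|k kP] := ih; first by move=> y yl; apply: lK; rewrite inE yl orbT.
  have [g [c [[k' Nk'] gc cx]]] := lK x (mem_head _ _).
  exists (maxn k k') => y; rewrite inE => /orP[/eqP ->|/kP[h [d [Nh hd dy]]]].
    by exists g, c; split=> //; apply: Nle Nk'; exact: leq_maxr.
  by exists h, d; split=> //; apply: Nle Nh; exact: leq_maxl.
exists k => j g Njg; apply: contrapT => nNg.
have [h [p [x [Nh hp px nx]]]] := lead_normal_form (Nsub k) nNg.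
have Kh : K h.
  have -> : h = (-1) *: (g - h) + g by rewrite scaleN1r opprB subrK.
  by apply: Ksub.2; [exists k|exists j].
have [y yl yx] : exists2 y, y \in l & divides y x by apply: lP; exists h, p.
apply: nx; have := lead_terms_shift (mnm_sub x.1 y.1) (Nsub k) (kP _ yl).
congr lead_terms; move: yx => /andP[/eqP e yx].
by rewrite /tshift submK// e; case: (x).
Qed.

End GermTaylor.

(** * The unbounded functional and automatic continuity *)

Section Unbounded.
Context {R : realType}.
Local Notation C := (complex R : numFieldType).
Local Notation cnorm := (@rnorm R C).
Variable E : normedModType C.

Lemma in_span_sum (ys : seq E) x : in_span ys x ->
  exists c : 'I_(size ys) -> C, x = \sum_i c i *: tnth (in_tuple ys) i.
Proof.
elim: ys x => [|y ys ih] x /=; first by move=> ->; exists (fun=> 0); rewrite big_ord0.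
move=> [a [x' [/ih[c ->] ->]]].
exists (fun i => if unlift ord0 i is Some j then c j else a).
rewrite big_ord_recl unlift_none; congr (_ + _).
apply: eq_bigr => i _; rewrite liftK; congr (_ *: _).
by rewrite !(tnth_nth 0).
Qed.

Lemma not_in_span (ys : seq E) : ~ finitely_generated E -> exists y, ~ in_span ys y.
Proof.
move=> nfg; apply: contrapT => /forallNP h; apply: nfg.
exists (size ys), (tnth (in_tuple ys)) => x; apply: in_span_sum.
by apply: contrapT; exact: h.
Qed.

Definition is_graph (S : set (E * C)) := is_submod S /\ forall c, S (0, c) -> c = 0.

(** Zorn's lemma is applied to the sets whose union with [S0] is a graph, rather than to graphs
    containing [S0], so that the empty chain is covered too. *)
Lemma graph_extension (S0 : set (E * C)) : is_graph S0 ->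
  exists l : E -> C, linear l /\ forall x c, S0 (x, c) -> l x = c.
Proof.
move=> S0g.
have [F Ftot|A [Ag Amax]] := @Zorn_bigcup (E * C) (fun X => is_graph (X `|` S0)).
  move=> Fch; have [[X0 FX0]|F0] := pselect (F !=set0); last first.
    rewrite (_ : _ `|` _ = S0)//; apply/seteqP; split=> x; last by right.
    by case=> // -[X FX _]; case: F0; exists X.
  have up x : (\bigcup_(X in F) X `|` S0) x -> exists2 X, F X & (X `|` S0) x.
    by case=> [[X FX Xx]|S0x]; [exists X => //; left|exists X0 => //; right].
  have dn X x : F X -> (X `|` S0) x -> (\bigcup_(X in F) X `|` S0) x.
    by move=> FX [Xx|S0x]; [left; exists X|right].
  split; first split.
  - by right; exact: S0g.1.1.
  - move=> a x y /up[X FX Xx] /up[Y FY Yy].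
    have [XY|YX] := Fch X Y FX FY.
      by apply: (dn Y) => //; apply: (Ftot Y FY).1.2 => //; exact: setSU Xx.
    by apply: (dn X) => //; apply: (Ftot X FX).1.2 => //; exact: setSU Yy.
  - by move=> c /up[X FX]; exact: (Ftot X FX).2.
pose S := A `|` S0; have [Ssub Sfun] : is_graph S by [].
have [S00 Slin] := Ssub.
have Suniq x c c' : S (x, c) -> S (x, c') -> c = c'.
  move=> h h'; apply/subr0_eq; apply: Sfun.
  have := Slin (-1) (x, c') (x, c) h' h.
  by rewrite scaleN1r (_ : - (x, c') + (x, c) = (0, c - c'))//; congr pair; rewrite /= addrC ?subrr.
have Sdom x : exists c, S (x, c).
  apply: contrapT => nx.
  (* Prescribing the value [0] at [x] is enough to contradict maximality. *)
  pose S1 := [set u : E * C | exists a y c, S (y, c) /\ u = (y + a *: x, c)].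
  have SS1 : S `<=` S1 by move=> [y c] Sy; exists 0, y, c; rewrite scale0r addr0.
  have S1x : S1 (x, 0) by exists 1, 0, 0; rewrite scale1r add0r.
  have S0S1 : S1 `|` S0 = S1.
    by apply/setUidl => y S0y; apply: SS1; right.
  apply: (Amax S1).
    split; first by move=> y Ay; apply: SS1; left.
    by move=> h; apply: nx; exists 0; left; exact: h.
  rewrite S0S1; split; first split.
  - by apply: SS1.
  - move=> a _ _ [b [y [c [Sy ->]]]] [b' [y' [c' [Sy' ->]]]].
    exists (a * b + b'), (a *: y + y'), (a *: c + c'); split; first exact: (Slin a (y, c) (y', c')).
    by congr pair; rewrite /= scalerDr scalerA addrACA scalerDl.
  - move=> c [a [y [c' [Sy [/esym/eqP]]]]]; rewrite addr_eq0 => /eqP yE ->.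
    have [a0|a0] := eqVneq a 0; last first.
      exfalso; apply: nx; exists ((- a^-1) *: c').
      have := Slin (- a^-1) (y, c') 0 Sy S00; rewrite addr0.
      by congr S; congr pair; rewrite /= yE scalerN scaleNr opprK scalerA mulVf// scale1r.
    by apply: Sfun; move: Sy; rewrite yE a0 scale0r oppr0.
have [l lP] := choice Sdom.
exists l; split=> [a x y|x c S0x]; last by apply: Suniq (lP x) _; right.
exact: Suniq (lP _) (Slin a _ _ (lP x) (lP y)).
Qed.

(** On a linearly independent sequence [u] any values may be prescribed; [k * |u k|] at [u k] gives
    the value [k] at the normalized vector. *)
Lemma unbounded_functional : ~ finitely_generated E ->
  exists l : E -> C, linear l /\ forall B : R, exists e, rnorm e <= 1 /\ B < cnorm (l e).
Proof.
move=> nfg.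
have step (ys : seq E) : exists ys', exists y, ys' = y :: ys /\ ~ in_span ys y.
  by have [y ny] := not_in_span ys nfg; exists (y :: ys), y.
have [f [f0 fP]] := iterated_choice [::] step.
have [u uP] := choice fP.
pose val k : C := (k%:R * rnorm (u k))%:C%C.
pose L := fix L k : seq (E * C)%type := if k is k'.+1 then (u k', val k') :: L k' else [::].
have Lfst k x c : in_span (L k) (x, c) -> in_span (f k) x.
  elim: k x c => [|k ih] x c /=; first by rewrite f0 => -[-> _].
  have [-> _] := uP k => -[a [[x' c'] [/ih h [-> _]]]].
  by exists a, x'.
pose S0 : set (E * C) := [set p | exists k, in_span (L k) p].
have Lmono k d : in_span (L k) `<=` in_span (L (k + d)%N).
  elim: d => [|d ih]; first by rewrite addn0.
  by rewrite addnS; apply: subset_trans ih _; exact: in_span_cons.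
have S0g : is_graph S0.
  split; first split.
  - by exists 0%N; rewrite /=.
  - move=> a x y [k kx] [l ly]; exists (k + l)%N; apply: (in_span_submod _).2.
      exact: Lmono.
    by rewrite addnC; exact: Lmono.
  move=> c [k]; elim: k c => [|k ih] c /=; first by case.
  move=> [a [[x' c'] [h [/esym/eqP]]]]; rewrite addrC addr_eq0 => /eqP x'E ->.
  have [a0|a0] := eqVneq a 0.
    by rewrite a0 scale0r add0r; apply: ih; move: h; rewrite x'E a0 scale0r oppr0.
  have [_] := uP k; case.
  have -> : u k = (- a^-1) *: x' + 0.
    by rewrite x'E scalerN scaleNr opprK scalerA mulVf// scale1r addr0.
  apply: (in_span_submod _).2; first exact: Lfst h.
  exact: (in_span_submod _).1.
have [l [llin lS]] := graph_extension S0g.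
exists l; split=> // B; pose k := Num.bound `|B|.
have Bk : B < k%:R.
  by apply: le_lt_trans (ler_norm _) _; apply: archi_boundP.
have uk0 : 0 < rnorm (u k).
  rewrite lt_neqAle rnorm_ge0 andbT eq_sym; apply/eqP => /rnorm_eq0 uk.
  by have [_] := uP k; apply; rewrite uk; exact: (in_span_submod _).1.
have luk : l (u k) = val k.
  by apply: lS; exists k.+1; exact: (@in_span_head C (E * C)%type).
pose t : C := ((rnorm (u k))^-1)%:C%C.
have nt : cnorm t = (rnorm (u k))^-1 by rewrite rnorm_real ger0_norm// invr_ge0 ltW.
have l0 : l 0 = 0 by apply: lS; exists 0%N.
exists (t *: u k); split; first by rewrite rnormZ nt mulVf// gt_eqF.
have := llin t (u k) 0; rewrite addr0 l0 addr0 => ->.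
rewrite luk -[t *: _]/(t * _) rnormM nt /val rnorm_real ger0_norm ?mulr_ge0// ?ltW//.
by rewrite mulrC mulfK// gt_eqF.
Qed.

Lemma bounded_of_kernel (I : eqType) (s : seq I) (mu : I -> E -> C) (l : E -> C) :
  (forall i, linear (mu i)) -> linear l ->
  (forall i, i \in s -> exists B : R, forall e, rnorm e <= 1 -> cnorm (mu i e) <= B) ->
  (forall e, (forall i, i \in s -> mu i e = 0) -> l e = 0) ->
  exists B : R, forall e, rnorm e <= 1 -> cnorm (l e) <= B.
Proof.
move=> mulin; elim: s l => [|i s ih] l llin mub ker.
  by exists 0 => e _; rewrite ker ?rnorm0.
have mub' j : j \in s -> exists B : R, forall e, rnorm e <= 1 -> cnorm (mu j e) <= B.
  by move=> js; apply: mub; rewrite inE js orbT.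
have [[e0 e0s me0]|nex] := pselect (exists2 e0, forall j, j \in s -> mu j e0 = 0 & mu i e0 != 0).
  pose t := l e0 / mu i e0.
  have [|e es|B BP] := ih (fun e => l e - t * mu i e) _ mub'.
  - by move=> a x y; rewrite llin mulin -[a *: mu i x]/(a * _) -[a *: l x]/(a * _)
      -[a *: (_ - _)]/(a * _); ring.
  - pose b := - (mu i e / mu i e0).
    have : l (b *: e0 + e) = 0.
      apply: ker => j; rewrite mulin inE => /orP[/eqP ->|js].
        by rewrite -[b *: _]/(b * _) /b mulNr divfK// addrC subrr.
      by rewrite (e0s _ js) (es _ js) scaler0 addr0.
    rewrite llin -[b *: _]/(b * _) => h; rewrite -h /t /b; field.
    by [].
  have [B' B'P] := mub i (mem_head _ _).
  exists (B + cnorm t * B') => e e1.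
  rewrite -[l e](subrK (t * mu i e)); apply: le_trans (ler_rnormD _ _) _.
  by apply: lerD; [exact: BP|rewrite rnormM ler_wpM2l ?rnorm_ge0// B'P].
apply: ih => // e es; apply: ker => j; rewrite inE => /orP[/eqP ->|/es//].
by apply: contrapT => /eqP h; apply: nex; exists e.
Qed.

End Unbounded.

(** * Automatic continuity of the Taylor coefficients *)

Section AutomaticContinuity.
Context {R : realType}.
Local Notation C := (complex R : numFieldType).
Local Notation cnorm := (@rnorm R C).
Variables (m n : nat) (zeta : 'rV[C]_m).
Local Notation mon := (multinom m).
Local Notation O := (germ_ring zeta).
Local Notation G := (germ zeta 'rV[C]_n).
Local Notation term := (mon * 'I_n)%type.
Variable (E : normedModType C).

Lemma germ_cst_lin (W : normedModType C) (a : C) (x y : W) :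
  germ_cst zeta (a *: x + y) = (germ_cst zeta a : O) *: germ_cst zeta x + germ_cst zeta y.
Proof.
apply: germP; near=> z.
rewrite (near (near_germ_cst zeta (a *: x + y)) z)//.
rewrite (near (near_germ_add ((germ_cst zeta a : O) *: germ_cst zeta x) (germ_cst zeta y)) z)//.
rewrite (near (near_germ_scale (germ_cst zeta a) (germ_cst zeta x)) z)//.
rewrite (near (near_germ_cst zeta a) z)// (near (near_germ_cst zeta x) z)//.
by rewrite (near (near_germ_cst zeta y) z).
Unshelve. all: by end_near. Qed.

Lemma gtaylor_cstZ (W : normedModType C) (a : C) (g : germ zeta W) c :
  gtaylor g c -> gtaylor ((germ_cst zeta a : O) *: g) (fun b => a *: c b).
Proof.
move=> gc; have := gtaylorZ (gtaylor_germ_cst zeta a : gtaylor (W := C) (germ_cst zeta a : O) _) gc.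
congr gtaylor; apply/funext => b.
have b0 : lem (@mnm0 m) b by apply/mnm_lepP => i; rewrite mnm0E.
have := conv_delta (@mnm0 m) c b; rewrite b0 subm0 => <-.
rewrite /conv scaler_sumr; apply: eq_bigr => d _; rewrite scalerA /delta_mon.
by case: ifP; rewrite ?mulr1 ?mulr0.
Qed.

Definition var_pow (j : 'I_m) (k : nat) : mon := mnm_muln (mnm1 j) k.

Lemma var_powD j k l : var_pow j (k + l) = mnm_add (var_pow j k) (var_pow j l).
Proof. by apply/mnmP => i; rewrite mnmDE !mulmnE mnm1E -mulnDr. Qed.

Lemma var_pow0 j : var_pow j 0 = @mnm0 m.
Proof. exact: mulm0n. Qed.

Lemma mdeg_var_pow j k : mdeg (var_pow j k) = k.
Proof. by rewrite /var_pow mdegMn mdeg1 mul1n. Qed.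

Lemma lem_var_pow j k b : lem (var_pow j k) b = (k <= b j)%N.
Proof.
apply/mnm_lepP/idP => [/(_ j)|h i]; rewrite mulmnE mnm1E; first by rewrite eqxx mul1n.
by case: eqP => [<-|_]; rewrite ?mul1n ?mul0n.
Qed.

(* the coefficients of [\sum_k e k *: z_j ^ (L * k)] *)
Definition lacunary (L : nat) (j : 'I_m) (e : nat -> E) (a : mon) : E :=
  if (a == var_pow j (mdeg a)) && (L %| mdeg a)%N then e (mdeg a %/ L)%N else 0.

(** Radius and bound do not depend on [e], so the vectors can be chosen at will in the unit ball. *)
Lemma lacunary_growth L j e : (forall k, rnorm (e k) <= 1) ->
  growth 2^-1 (2 ^+ m) (lacunary L j e).
Proof.
move=> e1 N; rewrite sum_mons_box; apply: le_trans (@sum_box_half R m N).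
rewrite [leRHS](bigID (fun x : {ffun 'I_m -> 'I_N} => (mdeg (boxmon x) < N)%N)) /=.
rewrite -[leLHS]addr0; apply: lerD; last first.
  by apply: sumr_ge0 => x _; rewrite exprn_ge0 ?invr_ge0.
apply: ler_sum => x _; rewrite ler_piMl ?exprn_ge0 ?invr_ge0//.
by rewrite /lacunary; case: ifP => _; rewrite ?rnorm0.
Qed.

Lemma lacunary_rec L j e a : (0 < L)%N ->
  lacunary L j e a = (if a == @mnm0 m then e 0%N else 0) +
    conv (delta_mon (var_pow j L)) (lacunary L j (fun k => e k.+1)) a.
Proof.
move=> L0; rewrite conv_delta; have [->|a0] := eqVneq a (@mnm0 m).
  rewrite lem_var_pow mnm0E leqNgt L0 addr0 /lacunary mdeg0 dvdn0 div0n.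
  by rewrite var_pow0 eqxx.
rewrite add0r lem_var_pow; case: leqP => [La|aL]; last first.
  rewrite /lacunary; case: ifP => // /andP[/eqP aE La].
  have : (L <= mdeg a)%N by apply: dvdn_leq => //; rewrite lt0n mdeg_eq0.
  move: aL; rewrite {1}aE mulmnE mnm1E eqxx mul1n; by rewrite ltnNge => /negbTE ->.
have La' : lem (var_pow j L) a by rewrite lem_var_pow.
set b := mnm_sub a _; have aE : a = mnm_add b (var_pow j L) by rewrite submK.
rewrite /lacunary aE mdegD mdeg_var_pow dvdn_addl ?dvdnn// divnDr ?dvdnn// divnn L0 addn1.
rewrite var_powD (_ : (_ == _) = (b == var_pow j (mdeg b)))//.
by apply/eqP/eqP => [|<-//]; exact: addIm.
Qed.

Hypothesis E_complete : seq_complete E.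
Variable psi : {linear germ zeta E -> G}.
Variable tau : G -> mon -> 'rV[C]_n.
Hypothesis tauP : forall g, gtaylor g (tau g).

Definition cst_coef (x : term) (e : E) : C := tcoef (tau (psi (germ_cst zeta e))) x.

Lemma cst_coef_lin x : linear (cst_coef x).
Proof.
move=> a e e'; rewrite /cst_coef germ_cst_lin linearP.
have h := gtaylorD (gtaylor_cstZ a (tauP (psi (germ_cst zeta e)))) (tauP (psi (germ_cst zeta e'))).
by rewrite (gtaylor_uniq (tauP _) h) /tcoef !mxE.
Qed.

(** Each step splits [F k] as a constant plus the variable to the power [L] times [F k.+1]. Since
    [x] has exponent less than [L] in the variable [j], what is left after [N + 1] steps has no
    coefficient at [x + N L], and the identity is finite. *)
Lemma lacunary_coef (L : nat) (j : 'I_m) (e : nat -> E) (F : nat -> germ zeta E) (x : term) N :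
  (mdeg x.1 < L)%N ->
  (forall k, gtaylor (F k) (lacunary L j (fun i => e (k + i)%N))) ->
  tcoef (tau (psi (F 0%N))) (mnm_add x.1 (var_pow j (N * L)), x.2) =
  \sum_(i < N.+1) cst_coef (mnm_add x.1 (var_pow j ((N - i) * L)), x.2) (e i).
Proof.
move=> xL FP; have L0 : (0 < L)%N by apply: leq_ltn_trans xL.
have [d dP] := gtaylor_mon_ex zeta (var_pow j L).
have Frec k : F k = germ_cst zeta (e k) + (d : O) *: F k.+1.
  apply: (gtaylor_inj (FP k)).
  have := gtaylorD (gtaylor_germ_cst zeta (e k)) (gtaylorZ (dP : gtaylor (W := C) (d : O) _) (FP k.+1)).
  congr gtaylor; apply/funext => a; rewrite (lacunary_rec _ _ _ L0) addn0.
  by congr (_ + conv _ (lacunary L j _) a); apply/funext => i; rewrite addnS.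
have step k a : tau (psi (F k)) a = tau (psi (germ_cst zeta (e k))) a +
    if lem (var_pow j L) a then tau (psi (F k.+1)) (mnm_sub a (var_pow j L)) else 0.
  rewrite -conv_delta; move: a; apply/funeqP.
  apply: (gtaylor_uniq (tauP _)); rewrite Frec linearD linearZ.
  exact: (gtaylorD (tauP _) (gtaylorZ (dP : gtaylor (W := C) (d : O) _) (tauP _))).
suff gen k : tcoef (tau (psi (F k))) (mnm_add x.1 (var_pow j (N * L)), x.2) =
    \sum_(i < N.+1) cst_coef (mnm_add x.1 (var_pow j ((N - i) * L)), x.2) (e (k + i)%N).
  by rewrite gen.
elim: N k => [|N ih] k; rewrite /tcoef step /=.
  rewrite big_ord_recl big_ord0 addr0 subn0 mul0n addn0 mxE lem_var_pow.
  rewrite var_pow0 addmC add0m leqNgt (leq_ltn_trans _ xL) ?mxE ?addr0//.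
  by rewrite mdegE (bigD1 j)//= leq_addr.
rewrite mxE big_ord_recl /= subn0 addn0; congr (_ + _).
rewrite lem_var_pow mnmDE mulmnE mnm1E eqxx mul1n mulSn.
rewrite (leq_trans (leq_addr (N * L) L) (leq_addl _ _)).
rewrite addnC var_powD addmA addmK -[LHS]/(tcoef _ (mnm_add x.1 (var_pow j (N * L)), x.2)) ih.
by apply: eq_bigr => i _; rewrite /bump /= add1n subSS addSnnS.
Qed.

Lemma cst_coef_bounded (x : term) : (0 < m)%N ->
  exists B : R, forall e, rnorm e <= 1 -> cnorm (cst_coef x e) <= B.
Proof.
move=> m0; pose j : 'I_m := Ordinal m0; pose L := (mdeg x.1).+1.
apply: contrapT => /forallNP nb.
have big (B : R) : exists e, rnorm e <= 1 /\ B < cnorm (cst_coef x e).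
  have /existsNP[e] := nb B; rewrite not_implyE => -[e1 /negP]; rewrite -ltNge => h.
  by exists e.
pose mu k e := cst_coef (mnm_add x.1 (var_pow j (k * L)), x.2) e.
have mu0 e : mu 0%N e = cst_coef x e.
  rewrite /mu mul0n var_pow0.
  by rewrite addmC add0m; case: (x).
(* The value at [w N] must outweigh a superexponential term and the contributions
   of the previous vectors to the coefficient at [x + N L]. *)
pose good (w : nat -> E) N := [set e : E | rnorm e <= 1 /\
  N%:R ^+ (N * L + mdeg x.1).+1 + cnorm (\sum_(i < N) mu (N - i)%N (w i)) < cnorm (mu 0%N e)].
have wfn : well_founded (fun k l : nat => (k < l)%N).
  by move=> k; elim/ltn_ind: k => k ih; constructor.
(* [w N] depends on all earlier vectors; the default [0] is never taken because [good w N] is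
   nonempty by [big]. *)
have [|w wP] := @wf_fixpoint nat E _ 0 wfn (fun N w => xget 0 (good w N)).
  move=> N w w' ww'; congr xget; rewrite /good.
  by rewrite (eq_bigr (fun i : 'I_N => mu (N - i)%N (w' i)))// => i _; rewrite ww'.
have wgood N : good w N (w N).
  rewrite wP; have [e [e1 he]] := big (N%:R ^+ (N * L + mdeg x.1).+1 + cnorm (\sum_(i < N) mu (N - i)%N (w i))).
  by apply: (@xgetPex _ 0 (good w N)); exists e; rewrite /good /= mu0.
have w1 N : rnorm (w N) <= 1 by have [] := wgood N.
have Fex k : exists F : germ zeta E, gtaylor F (lacunary L j (fun i => w (k + i)%N)).
  by apply: gtaylor_realize (lacunary_growth L j _) => //; rewrite invr_gt0.
have [F FP] := choice Fex.
have [r [B [r0 gB]]] := gtaylor_growth (tauP (psi (F 0%N))).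
have B0 := growth_ge0 gB.
(* The coefficient in degree [D] is at most [B * r ^- D], hence at most [N ^ (D + 1)] once [N]
   exceeds [r^-1] and [B]. This is the term built into [good] before [r] and [B] were known. *)
pose N := (Num.bound r^-1 + Num.bound B).+1.
have Nr : r^-1 <= N%:R.
  apply: le_trans (ltW (archi_boundP _)) _; first by rewrite invr_ge0 ltW.
  by rewrite ler_nat leqW// leq_addr.
have NB : B <= N%:R.
  apply: le_trans (ltW (archi_boundP B0)) _.
  by rewrite ler_nat leqW// leq_addl.
have [_] := wgood N.
pose a := mnm_add x.1 (var_pow j (N * L)).
have aN : mdeg a = (N * L + mdeg x.1)%N by rewrite /a mdegD mdeg_var_pow addnC.
have ub : cnorm (tcoef (tau (psi (F 0%N))) (a, x.2)) <= N%:R ^+ (N * L + mdeg x.1).+1.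
  have h := gB (mdeg a).+1; rewrite (big_rem a) ?mem_mons//= in h.
  have h1 : rnorm (tau (psi (F 0%N)) a) * r ^+ mdeg a <= B.
    apply: le_trans h; rewrite lerDl sumr_ge0// => b _.
    by rewrite mulr_ge0 ?rnorm_ge0 ?exprn_ge0// ltW.
  apply: le_trans (row_coord_le _ _) _.
  move: h1; rewrite -ler_pdivlMr ?exprn_gt0// => /le_trans; apply.
  rewrite exprS -aN -exprVn; apply: ler_pM => //; first by rewrite exprn_ge0// invr_ge0 ltW.
  by apply: lerXn2r; rewrite ?nnegrE ?invr_ge0 ?(ltW r0).
rewrite (lacunary_coef (x := x) (e := w) N (ltnSn _) FP) big_ord_recr /= subnn in ub.
pose S : C := \sum_(i < N) mu (N - i)%N (w i); pose X : C := mu 0%N (w N).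
rewrite -/S -/X => lb; have {}ub : cnorm (S + X) <= N%:R ^+ (N * L + mdeg x.1).+1 := ub.
have := ler_rnormB (S + X) S; rewrite (addrC S) addrK addrC; lra.
Qed.

End AutomaticContinuity.

(** * The homomorphism that does not factor *)

Section Main.
Context {R : realType}.
Local Notation C := (complex R : numFieldType).
Variables (m n : nat) (zeta : 'rV[C]_m).
Local Notation O := (germ_ring zeta).
Local Notation G := (germ zeta 'rV[C]_n).

Definition germ_val (W : normedModType C) (g : germ zeta W) : W := germ_repr g zeta.

Lemma germ_val_lin (W : normedModType C) (a : O) (f g : germ zeta W) :
  germ_val (a *: f + g) = germ_repr (a : germ zeta C) zeta *: germ_val f + germ_val g.
Proof.
rewrite /germ_val (nbhs_singleton (near_germ_add (a *: f) g)).
by rewrite (nbhs_singleton (near_germ_scale a f)).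
Qed.

Lemma germ_val_cst (W : normedModType C) (w : W) : germ_val (germ_cst zeta w) = w.
Proof. exact: nbhs_singleton (near_germ_cst zeta w). Qed.

Lemma germ_max_idealE (a : O) : germ_max_ideal zeta a <-> germ_val (a : germ zeta C) = 0.
Proof. by []. Qed.

Lemma surjective_noetherian (A : comNzRingType) (M N : lmodType A) (p : {linear N -> M}) :
  (forall y, exists x, p x = y) -> noetherian N -> noetherian M.
Proof.
move=> ps nN K Ksub Kmono.
have [||k kP] := nN (fun k => p @^-1` (K k)).
- move=> k; split=> [|a x y Kx Ky]; first by rewrite /preimage /= linear0; exact: (Ksub k).1.
  by rewrite /preimage /= linearP; exact: (Ksub k).2.
- by move=> k x; exact: Kmono.
by exists k => l y; have [x <-] := ps y; exact: kP.
Qed.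

(** Multiples of a constant basis vector embed the ring in the free module, so a chain of ideals
    becomes a chain of submodules there. *)
Lemma germ_ring_noetherian : (0 < n)%N -> @noetherian O O^o.
Proof.
move=> n0 I Isub Imono.
pose e : 'rV[C]_n := delta_mx ord0 (Ordinal n0).
pose ge : G := germ_cst zeta e.
have inj (a : O) : a *: ge = 0 -> a = 0.
  move=> h; apply: germP; near=> x.
  have : germ_repr (germ_scale a ge) x = germ_repr (0 : G) x by rewrite [germ_scale _ _]h.
  rewrite (near (near_germ_scale (a : germ zeta C) ge) x)//.
  rewrite (near (near_germ_cst zeta (0 : 'rV[C]_n)) x)//.
  rewrite (near (near_germ_cst zeta e) x)// (near (near_germ_cst zeta (0 : C)) x)//.
  move=> /(congr1 (fun M : 'rV[C]_n => M ord0 (Ordinal n0))).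
  by rewrite !mxE !eqxx mulr1.
pose K k := [set g : G | exists2 a : O, I k a & g = a *: ge].
have [||k kP] := @germ_noetherian R m zeta n K.
- move=> k; split; first by exists 0; [exact: (Isub k).1|rewrite scale0r].
  move=> a _ _ [b Ib ->] [c Ic ->]; exists (a * b + c); first exact: (Isub k).2.
  by rewrite scalerDl scalerA.
- by move=> k _ [a Ia ->]; exists a => //; exact: Imono.
exists k => l a Ia; have [|b Ib e1] := kP l (a *: ge); first by exists a.
rewrite (_ : a = b)//; apply/subr0_eq/inj.
by rewrite scalerBl e1 subrr.
Unshelve. all: by end_near. Qed.

Theorem nonfactoring_hom (hm : (0 < m)%N) (hn : (0 < n)%N) (M : lmodType O)
    (p : {linear G -> M}) (p_surj : forall y : M, exists x, p x = y) :
  depth_eq0 M (germ_max_ideal zeta) ->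
  forall E : completeNormedModType C,
    ~ finitely_generated E ->
    exists phi : {linear germ zeta E -> M},
      ~ (exists psi : {linear germ zeta E -> G}, forall f, phi f = p (psi f)).
Proof.
move=> [mM nreg] E nfg.
pose I : set O := germ_max_ideal zeta.
have I0 : I 0 by exact: nbhs_singleton (near_germ_cst zeta (0 : C)).
have Iid (a b c : O) : I b -> I c -> I (a * b + c).
  move=> /germ_max_idealE hb /germ_max_idealE hc; apply/germ_max_idealE.
  by have := germ_val_lin a (b : germ zeta C) c; rewrite hb hc scaler0 addr0; apply.
(* At depth 0, a nonzerodivisor [r] of the ideal could only satisfy [r M = M]; then [I M = M], which
   the first conjunct of [depth_eq0] excludes. *)
have Izd (r : O) : I r -> exists x : M, x <> 0 /\ r *: x = 0.
  move=> Ir; apply: contrapT => nx; apply: nreg; exists r; split=> //.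
    by move=> x rx; apply: contrapT => x0; apply: nx; exists x.
  move=> rM; apply: mM; apply/seteqP; split=> // x _.
  have [y _ yx] : range (fun y : M => r *: y) x by rewrite rM.
  by exists 1%N, (fun=> r), (fun=> y); split=> [//|]; rewrite big_ord1.
have [v [v0 vI]] := socle_neq0 (germ_ring_noetherian hn)
  (surjective_noetherian p_surj (@germ_noetherian R m zeta n)) Iid Izd I0.
(* A germ minus its value is in the maximal ideal, so it kills [v]. This makes [phi0] linear over
   germs although [l] is only linear over the scalars. *)
have actv (a : O) : a *: v = (germ_cst zeta (germ_val (a : germ zeta C)) : O) *: v.
  apply/eqP; rewrite -subr_eq0 -scalerBl; apply/eqP/vI/germ_max_idealE.
  rewrite /germ_val (nbhs_singleton (near_germ_add (a : germ zeta C) _)).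
  rewrite (nbhs_singleton (near_germ_opp (germ_cst zeta (germ_repr (a : germ zeta C) zeta)))).
  by rewrite (nbhs_singleton (near_germ_cst zeta _)) subrr.
have [l [llin lunb]] := unbounded_functional nfg.
pose phi0 (f : germ zeta E) : M := (germ_cst zeta (l (germ_val f)) : O) *: v.
have phi_lin : linear phi0.
  move=> a f g; rewrite /phi0 germ_val_lin llin germ_cst_lin scalerDl.
  congr (_ + _).
  rewrite -[X in X *: v]/((germ_cst zeta _ : O) * (germ_cst zeta _ : O)) mulrC -scalerA.
  by rewrite -[X in _ *: X = _]/((germ_cst zeta (germ_val (a : germ zeta C)) : O) *: v) -actv !scalerA mulrC.
pose phi : {linear germ zeta E -> M} :=
  HB.pack phi0 (GRing.isLinear.Build O (germ zeta E) M _ phi0 phi_lin).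
exists phi => -[psi psiP].
have [g pg] := p_surj v.
pose K : set G := [set h | p h = 0].
have Ksub : is_submod K.
  split; first by rewrite /K /= linear0.
  by move=> a x y; rewrite /K /= linearP => -> ->; rewrite scaler0 addr0.
have nKg : ~ K g by rewrite /K /= pg.
have [h [q [x [Kgh hq qx nx]]]] := lead_normal_form Ksub nKg.
have ph : p h = v by move: Kgh; rewrite /K /= linearB pg => /subr0_eq.
have [tau tauP] := choice (@gtaylor_row R m zeta n).
have Ecomplete := @complete_seq_complete R E.
(* All terms up to [x], inclusive: none has a larger degree than [x]. *)
pose s := [seq y <- terms m n (mdeg x.1).+1 | ~~ ltT x y].
have [||e ek|B BP] := @bounded_of_kernel R E _ s (cst_coef psi tau) l _ llin.
- by move=> y; apply: cst_coef_lin.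
- by move=> y _; apply: cst_coef_bounded.
- apply: contrapT => le0.
  (* Up to [x] its coefficients are those of [- l e *: q], so [l e <> 0] would make [x] a leading
     term of [K]. *)
  pose k := psi (germ_cst zeta e) - (germ_cst zeta (l e) : O) *: h.
  have Kk : K k.
    by rewrite /K /= /k linearB linearZ ph -psiP /= /phi0 germ_val_cst subrr.
  have kt : gtaylor k (fun a => tau (psi (germ_cst zeta e)) a - l e *: q a).
    exact: (gtaylorD (tauP _) (gtaylorN (gtaylor_cstZ (l e) hq))).
  apply: nx; exists k, (fun a => tau (psi (germ_cst zeta e)) a - l e *: q a); split=> //.
  have ys y : ~~ ltT x y -> tcoef (tau (psi (germ_cst zeta e))) y = 0.
    move=> xy; apply: ek; rewrite /s mem_filter xy mem_terms ltnS /=.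
    by have := ltT_total x y; rewrite (negbTE xy) orFb => /orP[/eqP <-//|/ltT_mdeg].
  split=> [|y yx].
    rewrite /tcoef !mxE -/(tcoef _ x) ys ?ltT_irr// sub0r oppr_eq0 mulf_neq0//.
      exact/eqP.
    exact: qx.1.
  rewrite /tcoef !mxE -/(tcoef _ y) ys; last first.
    by apply/negP => xy; have := ltT_trans xy yx; rewrite ltT_irr.
  by rewrite -/(tcoef q y) qx.2// mulr0 subr0.
have [e [e1 Be]] := lunb B.
by have := BP e e1; rewrite leNgt Be.
Qed.

End Main.

Theorem theorem5p1 (R : realType) (m n : nat) (hm : (0 < m)%N) (hn : (0 < n)%N)
    (zeta : 'rV[R[i]]_m) (M : lmodType (germ_ring zeta))
    (M_neq0 : exists x : M, x <> 0) (M_fg : finitely_generated M)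
    (p : {linear germ zeta 'rV[R[i]]_n -> M})
    (p_surj : forall y : M, exists x, p x = y) :
  depth_eq0 M (germ_max_ideal zeta) ->
  forall E : completeNormedModType R[i],
    ~ finitely_generated E ->
    exists phi : {linear germ zeta E -> M},
      ~ (exists psi : {linear germ zeta E -> germ zeta 'rV[R[i]]_n},
           forall f, phi f = p (psi f)).
Proof. exact: (nonfactoring_hom hm hn p_surj). Qed.
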